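(* If $\omega$ is a regular frequency, then, as $\varepsilon\to0$ along the sequence $(\varepsilon_j)$ occurring in the definition of a regular frequency (up to a subsequence extraction), $$\forall n\in\mathbb N,\quad \lim_{\varepsilon\to0}\|u^r_\varepsilon-u^r\|_{H^1(a^r+n/\theta_2,\;a^r+(n+1)/\theta_2)}=0\qquad\text{and}\qquad \lim_{\varepsilon\to0}|\Lambda^r_\varepsilon-\Lambda^r|=0.$$ Moreover, the energy flux of $u^r$ is positive: $$\mathrm{Re}\big[(1-\Lambda^r)\,\overline{(1+\Lambda^r)}\big]>0.$$
   Context: Periodic coefficients. $\mu_p,\rho_p:\mathbb R^2\to\mathbb R$ are continuous, $1$-periodic in each variable and bounded below by positive constants; $(\theta_1,\theta_2)\in\mathbb R^2$ with $\theta_2>0$ and $\delta:=\theta_1/\theta_2$ irrational; $z>0$; $\omega\in\mathbb R$; $a^r\in\mathbb R$ with $a^r\theta_2\in\mathbb Z$. For $s\in\mathbb R$ put $\mu_s(x):=\mu_p(s+\theta_1x,\theta_2x)$, $\rho_s(x):=\rho_p(s+\theta_1x,\theta_2x)$. Equations $-(\mu u')'-\rho\kappa u=0$ are understood weakly for $u\in H^1$, so that $u$ and $\mu u'$ have point values. Standing assumptions. The irrationality measure $m(\delta):=\sup\{\nu>0:\ |\delta-p/q|\le q^{-\nu}\text{ for infinitely many }(p,q)\in\mathbb Z\times\mathbb N^*\}$ is finite and $\mu_p,\rho_p\in C^m(\mathbb R^2)$ for some integer $m>m(\delta)$. Also $\omega^2\in\sigma(\mathcal A_\theta)$, where $\mathcal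 A_\theta u=-\frac1{\rho_0}(\mu_0u')'$ with domain $\{u\in H^1(\mathbb R):\mu_0u'\in H^1(\mathbb R)\}$ is self-adjoint in $L^2(\mathbb R;\rho_0\,dx)$ ($\mu_0,\rho_0$ are $\mu_s,\rho_s$ at $s=0$). Robin operators. $R^r_{\pm,s}u:=\mp\mu_su'-izu$, $R^l_{\pm,s}u:=\pm\mu_su'-izu$. Function space and winding number. $L^2_{per}(\mathbb R)$: $1$-periodic functions in $L^2_{loc}(\mathbb R)$, with the $L^2(0,1)$ inner product. $\mathcal N_{per}$: continuous $1$-periodic functions $f:\mathbb R\to\mathbb C$ that never vanish; writing $f=|f|e^{i\,\mathrm{Arg} f}$ with $\mathrm{Arg} f$ continuous on $\mathbb R$, $\mathbf w(f):=(\mathrm{Arg} f(1)-\mathrm{Arg} f(0))/2\pi$. Fundamental eigenpairs for $\varepsilon>0$. $u^r_{s,\varepsilon}\in H^1(0,\infty)$ and $u^l_{s,\varepsilon}\in H^1(-\infty,0)$ are the unique solutions of $-(\mu_su')'-\rho_s(\omega^2+i\varepsilon)u=0$ with $R^r_{+,s}u^r_{s,\varepsilon}(0)=1$, $R^l_{+,s}u^l_{s,\varepsilon}(0)=1$. Put $p^r_\varepsilon(s)=R^r_{+,s}u^r_{s,\varepsilon}(1/\theta_2)$, $\boldsymbol s^r_\varepsilon(s)=R^r_{-,s}u^r_{s,\varepsilon}(1/\theta_2)$, $p^l_\varepsilon(s)=R^l_{+,s}u^l_{s,\varepsilon}(-1/\theta_2)$, $\boldsymbol s^l_\varepsilon(s)=R^l_{-,s}u^l_{s,\varepsilon}(-1/\theta_2)$,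 and define on $L^2_{per}(\mathbb R)$: $\mathcal P^r_\varepsilon\varphi(s)=p^r_\varepsilon(s-\delta)\varphi(s-\delta)$, $\mathcal S^r_\varepsilon\varphi(s)=\boldsymbol s^r_\varepsilon(s-\delta)\varphi(s-\delta)$, $\mathcal P^l_\varepsilon\varphi(s)=p^l_\varepsilon(s+\delta)\varphi(s+\delta)$, $\mathcal S^l_\varepsilon\varphi(s)=\boldsymbol s^l_\varepsilon(s+\delta)\varphi(s+\delta)$. For $i\in\{l,r\}$ there is a unique pair $(\lambda^i_{0,\varepsilon},\varphi^i_{0,\varepsilon})\in\mathbb C\times\mathcal N_{per}$ with $|\lambda^i_{0,\varepsilon}|<1$, $\mathbf w(\varphi^i_{0,\varepsilon})=0$, $\varphi^i_{0,\varepsilon}(0)=1$ and $\mathcal P^i_\varepsilon\varphi^i_{0,\varepsilon}=\lambda^i_{0,\varepsilon}\varphi^i_{0,\varepsilon}$; put $\psi^i_{0,\varepsilon}:=\mathcal S^i_\varepsilon\varphi^i_{0,\varepsilon}$. Cell functions without absorption. $e^{r,0}_s,e^{r,1}_s\in H^1(0,1/\theta_2)$ solve $-(\mu_su')'-\rho_s\omega^2u=0$ on $(0,1/\theta_2)$ with $R^r_{+,s}e^{r,0}_s(0)=1,\ R^r_{-,s}e^{r,0}_s(1/\theta_2)=0$ and $R^r_{+,s}e^{r,1}_s(0)=0,\ R^r_{-,s}e^{r,1}_s(1/\theta_2)=1$; $t^{r,00}(s)=R^r_{-,s}e^{r,0}_s(0)$, $t^{r,10}(s)=R^r_{-,s}e^{r,1}_s(0)$.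 Likewise $e^{l,0}_s,e^{l,1}_s\in H^1(-1/\theta_2,0)$ solve the same equation on $(-1/\theta_2,0)$ with $R^l_{+,s}e^{l,0}_s(0)=1,\ R^l_{-,s}e^{l,0}_s(-1/\theta_2)=0$ and $R^l_{+,s}e^{l,1}_s(0)=0,\ R^l_{-,s}e^{l,1}_s(-1/\theta_2)=1$; $t^{l,00}(s)=R^l_{-,s}e^{l,0}_s(0)$, $t^{l,10}(s)=R^l_{-,s}e^{l,1}_s(0)$. Flux density. With $\delta^r:=\delta$, $\delta^l:=-\delta$, $$Q^i_s(\varphi,\psi):=\mathrm{Re}\Big\{\big[(1-t^{i,00}(s))\varphi(s)-t^{i,10}(s)\psi(s+\delta^i)\big]\,\overline{\big[(1+t^{i,00}(s))\varphi(s)+t^{i,10}(s)\psi(s+\delta^i)\big]}\Big\}.$$ Regular frequency. $\omega$ is regular if: (a) there is a sequence $\varepsilon_j\to0^+$ such that for each $i\in\{l,r\}$, along it, $\lambda^i_{0,\varepsilon}\to\lambda^i_0$ in $\mathbb C$ and $\varphi^i_{0,\varepsilon}\to\varphi^i_0$, $\psi^i_{0,\varepsilon}\to\psi^i_0$ uniformly on $\mathbb R$, for some $\lambda_0^i\in\mathbb C$ and continuous $1$-periodic $\varphi_0^i,\psi_0^i$; (b) for each $i$, $Q^i_0\ne0$, where $Q^i_0\ge 0$ is the value of $Q^i_s(\varphi^i_0,\psi^i_0)$, which is independent of $s$. (When $\omega$ is regular, $\varphi^i_0$ never vanishes.) Half-line objects. For $\varepsilon>0$, $u^r_\varepsilon\in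 H^1(a^r,\infty)$ is the unique solution of $-(\mu_0u')'-\rho_0(\omega^2+i\varepsilon)u=0$ on $(a^r,\infty)$ with $R^r_{+,0}u^r_\varepsilon(a^r)=1$, and $\Lambda^r_\varepsilon:=R^r_{-,0}u^r_\varepsilon(a^r)$. With $s^*:=a^r\theta_1$, the function $u^r$ on $(a^r,\infty)$ is given for $x\in(0,1/\theta_2)$, $n\in\mathbb N$ by $$u^r(a^r+x+n/\theta_2)=(\lambda^r_0)^n\,\varphi^r_0(s^* )^{-1}\big[\varphi^r_0(s^*+n\delta)\,e^{r,0}_{s^*+n\delta}(x)+\psi^r_0(s^*+(n+1)\delta)\,e^{r,1}_{s^*+n\delta}(x)\big],$$ and $\Lambda^r:=R^r_{-,0}u^r(a^r)=t^{r,00}(s^* )+\varphi^r_0(s^* )^{-1}\psi^r_0(s^*+\delta)\,t^{r,10}(s^* )$. *)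

(* Defs.v *)
From HB Require Import structures.
From mathcomp Require Import all_boot all_order all_algebra.
From mathcomp Require Import complex.
From mathcomp Require Import all_classical all_reals all_analysis.

Set Implicit Arguments.
Unset Strict Implicit.
Unset Printing Implicit Defensive.

Import Order.TTheory GRing.Theory Num.Theory.
Import numFieldNormedType.Exports.

Local Open Scope classical_set_scope.
Local Open Scope complex_scope.
Local Open Scope ring_scope.

Notation normc := ComplexField.Normc.normc.
Local Notation Re := complex.Re.
Local Notation Im := complex.Im.
Local Notation leb := (@lebesgue_measure _).

Section ComplexFunctions.
Context {R : realType}.
Implicit Types (I : set R) (f g u : R -> R[i]) (w : R -> R).

Definition cts_on I f : Prop :=
  {within I, continuous (fun x => Re (f x))} /\
  {within I, continuous (fun x => Im (f x))}.

Definition unif_cvg (f : nat -> R -> R[i]) (g : R -> R[i]) : Prop :=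
  forall e : R, 0 < e ->
    \forall j \near \oo, forall s, normc (f j s - g s) <= e.

Definition cint I f : R[i] :=
  (\int[leb]_(x in I) Re (f x))%R +i* (\int[leb]_(x in I) Im (f x))%R.

Definition ae_eq_on I f g : Prop := {ae leb, forall x, I x -> f x = g x}.

Definition cmeasurable I f : Prop :=
  measurable_fun I (fun x => Re (f x)) /\ measurable_fun I (fun x => Im (f x)).

(* L^2(I; w dx) *)
Definition L2norm w I f : \bar R :=
  ((\int[leb]_(x in I) (w x * normc (f x) ^+ 2)%:E) `^ 2^-1)%E.

Definition inL2 w I f : Prop := cmeasurable I f /\ (L2norm w I f < +oo)%E.

Definition L1loc I f : Prop :=
  locally_integrable I (fun x => Re (f x)) /\
  locally_integrable I (fun x => Im (f x)).

(* Real-valued C^1 functions with compact support in the open set I.  Testing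
   against real functions is enough, the equations below being C-linear. *)
Definition test_fun I (phi : R -> R) : Prop :=
  [/\ forall x, derivable phi x 1, continuous (derive1 phi) &
      exists K : set R,
        [/\ compact K, K `<=` I & forall x, ~ K x -> phi x = 0]].

Definition is_wderiv I u g : Prop :=
  [/\ L1loc I u, L1loc I g &
      forall phi, test_fun I phi ->
        cint I (fun x => u x * (derive1 phi x)%:C) =
        - cint I (fun x => g x * (phi x)%:C)].

(* The weak derivative; determined by u up to a null set whenever it exists. *)
Definition wderiv I u : R -> R[i] := xget (fun=> 0) [set g | is_wderiv I u g].

Definition inH1 I u : Prop :=
  [/\ inL2 (fun=> 1) I u, is_wderiv I u (wderiv I u) &
      inL2 (fun=> 1) I (wderiv I u)].

Definition H1norm I u : \bar R :=
  if `[< inH1 I u >] then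
    ((\int[leb]_(x in I)
        (normc (u x) ^+ 2 + normc (wderiv I u x) ^+ 2)%:E) `^ 2^-1)%E
  else +oo%E.

(* The representative of f that is continuous up to the boundary of the open
   interval I (unique on the closure of I whenever it exists): the point values
   of f in the closure of I are those of this representative. *)
Definition crep I f : R -> R[i] :=
  xget (fun=> 0) [set g | cts_on (closure I) g /\ ae_eq_on I g f].

(* -(mu u')' - rho kappa u = 0 on I, weakly *)
Definition weak_sol I (mu rho : R -> R) (kappa : R[i]) u : Prop :=
  inH1 I u /\
  forall phi, test_fun I phi ->
    cint I (fun x => (mu x)%:C * wderiv I u x * (derive1 phi x)%:C
                     - (rho x)%:C * kappa * u x * (phi x)%:C) = 0.

Definition periodic1 f : Prop := forall s, f (s + 1) = f s.

Definition Nper f : Prop :=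
  [/\ cts_on setT f, periodic1 f & forall s, f s != 0].

(* winding f k : the winding number of f is k *)
Definition winding f (k : R) : Prop :=
  exists2 Arg : R -> R,
    continuous Arg /\
      (forall s, f s = (normc (f s))%:C * (cos (Arg s) +i* sin (Arg s))) &
    k = (Arg 1 - Arg 0) / (2 * pi).

End ComplexFunctions.

Section RealData.
Context {R : realType}.

Fixpoint Cm (m : nat) (f : R -> R -> R) : Prop :=
  continuous (fun p : R * R => f p.1 p.2) /\
  if m is m'.+1 then
    [/\ forall x y, derivable (fun t => f t y) x 1,
        forall x y, derivable (fun t => f x t) y 1,
        Cm m' (fun x y => derive1 (fun t => f t y) x) &
        Cm m' (fun x y => derive1 (fun t => f x t) y)]
  else True.

Definition irrationality_measure (d : R) : \bar R :=
  ereal_sup [set nu%:E | nu in [set nu : R | 0 < nu /\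
    infinite_set [set pq : int * nat | (0 < pq.2)%N /\
      `|d - pq.1%:~R / pq.2%:R| <= pq.2%:R `^ (- nu)]]].

Definition admissible_coef (f : R -> R -> R) : Prop :=
  [/\ continuous (fun p : R * R => f p.1 p.2),
      forall x y, f (x + 1) y = f x y,
      forall x y, f x (y + 1) = f x y &
      exists2 c : R, 0 < c & forall x y, c <= f x y].

End RealData.

Record medium (R : realType) := Medium {
  mup : R -> R -> R;
  rhop : R -> R -> R;
  theta1 : R;
  theta2 : R;
  zimp : R;
  omega : R
}.

(* The superscripts l and r. *)
Inductive side := Left | Right.

Section Medium.
Context {R : realType}.
Implicit Types (S : medium R) (i : side) (I : set R) (eps s : R).
Implicit Types (u phi psi : R -> R[i]) (U E : R -> R -> R[i]).

Definition delta S : R := theta1 S / theta2 S.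

Definition mu_ S s (x : R) : R := mup S (s + theta1 S * x) (theta2 S * x).
Definition rho_ S s (x : R) : R := rhop S (s + theta1 S * x) (theta2 S * x).

(* The operator A_theta u = - rho_0^-1 (mu_0 u')' in L^2(R; rho_0 dx). *)
Definition domA S u : Prop :=
  inH1 setT u /\ inH1 setT (fun x => (mu_ S 0 x)%:C * wderiv setT u x).

Definition opA S u : R -> R[i] := fun x =>
  - ((rho_ S 0 x)^-1)%:C *
    wderiv setT (fun y => (mu_ S 0 y)%:C * wderiv setT u y) x.

(* A_theta - zeta is a bijection from the domain of A_theta onto
   L^2(R; rho_0 dx), with bounded inverse. *)
Definition resolvent_set S : set R[i] := [set zeta |
  exists M : R, forall f, inL2 (rho_ S 0) setT f ->
    exists u, [/\ domA S u,
      ae_eq_on setT (fun x => opA S u x - zeta * u x) f,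
      (L2norm (rho_ S 0) setT u <= M%:E * L2norm (rho_ S 0) setT f)%E &
      forall v, domA S v ->
        ae_eq_on setT (fun x => opA S v x - zeta * v x) f ->
        ae_eq_on setT v u]].

Definition spectrum S : set R[i] := ~` resolvent_set S.

Record standing_assumptions S : Prop := {
  mup_admissible : admissible_coef (mup S);
  rhop_admissible : admissible_coef (rhop S);
  theta2_gt0 : 0 < theta2 S;
  delta_irrational : irrational (delta S);
  zimp_gt0 : 0 < zimp S;
  irrationality_measure_fin : (irrationality_measure (delta S) < +oo)%E;
  coef_Cm : exists m : nat, [/\ (irrationality_measure (delta S) < m%:R%:E)%E,
                                Cm m (mup S) & Cm m (rhop S)];
  omega_spectrum : spectrum S ((omega S ^+ 2)%:C)
}.

Definition orient i : R := if i is Right then 1 else - 1.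
Definition delta_ S i : R := orient i * delta S.

Definition halfline i : set R :=
  if i is Right then `]0, +oo[%classic else `]-oo, 0[%classic.
Definition cell S i : set R :=
  if i is Right then `]0, (theta2 S)^-1[%classic
  else `](- (theta2 S)^-1), 0[%classic.
Definition cell_end S i : R := orient i / theta2 S.

(* c mu_s u' - i z u at the point x, for u in H^1(I) *)
Definition robin S (c : R) I s u (x : R) : R[i] :=
  c%:C * crep I (fun y => (mu_ S s y)%:C * wderiv I u y) x
  - 'i%C * (zimp S)%:C * crep I u x.

Definition robinP S i := robin S (- orient i).
Definition robinM S i := robin S (orient i).

(* u^i_{s,eps} *)
Definition is_fundamental S i eps s u : Prop :=
  weak_sol (halfline i) (mu_ S s) (rho_ S s) (omega S ^+ 2 +i* eps) u /\
  robinP S i (halfline i) s u 0 = 1.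

(* p^i, s^i and the operators P^i, S^i associated with a family s |-> U s;
   they are to be used with U s = u^i_{s,eps}. *)
Definition pcoef S i U s : R[i] :=
  robinP S i (halfline i) s (U s) (cell_end S i).
Definition scoef S i U s : R[i] :=
  robinM S i (halfline i) s (U s) (cell_end S i).

Definition opP S i U phi : R -> R[i] := fun s =>
  pcoef S i U (s - delta_ S i) * phi (s - delta_ S i).
Definition opS S i U phi : R -> R[i] := fun s =>
  scoef S i U (s - delta_ S i) * phi (s - delta_ S i).

(* The pair (lambda^i_{0,eps}, phi^i_{0,eps}). *)
Definition is_fundamental_eigenpair S i U (lam : R[i]) phi : Prop :=
  [/\ normc lam < 1, Nper phi, winding phi 0, phi 0 = 1 &
      opP S i U phi = (fun s => lam * phi s)].

(* e^{i,0}_s (b0 = 1, b1 = 0) and e^{i,1}_s (b0 = 0, b1 = 1) *)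
Definition is_cell_fun S i (b0 b1 : R[i]) s u : Prop :=
  [/\ weak_sol (cell S i) (mu_ S s) (rho_ S s) ((omega S ^+ 2)%:C) u,
      robinP S i (cell S i) s u 0 = b0 &
      robinM S i (cell S i) s u (cell_end S i) = b1].

(* t^{i,00} for E = e^{i,0}, t^{i,10} for E = e^{i,1} *)
Definition tcoef S i E s : R[i] :=
  robinM S i (cell S i) s (E s) 0.

Definition fluxQ S i E0 E1 phi psi s : R :=
  let t00 := tcoef S i E0 s in
  let t10 := tcoef S i E1 s in
  let psi' := psi (s + delta_ S i) in
  Re (((1 - t00) * phi s - t10 * psi') *
      (((1 + t00) * phi s + t10 * psi')^*)%C).

(* omega is regular, with eps_j, lambda^i_0, phi^i_0, psi^i_0 as witnesses.
   The flux density does not depend on s, so that it is nonzero as soon as it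
   is nonzero at one point. *)
Definition regular_along S (U : side -> R -> R -> R -> R[i])
    (lam : side -> R -> R[i]) (phi : side -> R -> R -> R[i])
    (E0 E1 : side -> R -> R -> R[i]) (eps : nat -> R)
    (lam0 : side -> R[i]) (phi0 psi0 : side -> R -> R[i]) : Prop :=
  [/\ forall j, 0 < eps j, eps j @[j --> \oo] --> (0 : R) &
      forall i,
        [/\ normc (lam i (eps j) - lam0 i) @[j --> \oo] --> (0 : R),
            cts_on setT (phi0 i) /\ periodic1 (phi0 i),
            cts_on setT (psi0 i) /\ periodic1 (psi0 i),
            unif_cvg (fun j => phi i (eps j)) (phi0 i) /\
            unif_cvg (fun j => opS S i (U i (eps j)) (phi i (eps j))) (psi0 i) &
            exists s, fluxQ S i (E0 i) (E1 i) (phi0 i) (psi0 i) s != 0]].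

(* u^r_eps on (a, +oo) *)
Definition is_halfline_sol S (a eps : R) u : Prop :=
  weak_sol `]a, +oo[%classic (mu_ S 0) (rho_ S 0) (omega S ^+ 2 +i* eps) u /\
  robinP S Right `]a, +oo[%classic 0 u a = 1.

(* u^r, for y = a + x + n / theta2 with n natural and 0 <= x < 1 / theta2 *)
Definition halfline_limit S (a : R) (lam : R[i]) phi psi E0 E1 : R -> R[i] :=
  fun y =>
  let n := Num.truncn ((y - a) * theta2 S) in
  let x := y - a - n%:R / theta2 S in
  let s := a * theta1 S in
  lam ^+ n * (phi s)^-1 *
    (phi (s + n%:R * delta S) * E0 (s + n%:R * delta S) x +
     psi (s + n.+1%:R * delta S) * E1 (s + n%:R * delta S) x).

Definition Lambda S (a : R) u : R[i] := robinM S Right `]a, +oo[%classic 0 u a.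

End Medium.

(* Main.v *)
Require Import Defs.
From HB Require Import structures.
From mathcomp Require Import all_boot all_order all_algebra.
From mathcomp Require Import complex.
From mathcomp Require Import all_classical all_reals all_analysis.
From mathcomp Require Import measurable_realfun.
From mathcomp Require Import ring lra.

Set Implicit Arguments.
Unset Strict Implicit.
Unset Printing Implicit Defensive.

Import Order.TTheory GRing.Theory Num.Theory.
Import numFieldNormedType.Exports.

Local Open Scope classical_set_scope.
Local Open Scope complex_scope.
Local Open Scope ring_scope.

(** Weak solutions are replaced by classical ones: a weak solution u of
    -(mu u')' = rho kappa u has a pair (v, w) of continuous representatives of
    (u, mu u'), which solves v' = w / mu, w' = - rho kappa v
    ([weak_sol_rep]). Robin traces are then linear combinations of values of v
    and w, and convergence in H1 on a bounded interval follows from uniform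
    convergence of v and w ([H1norm_le]). Write L = 1 / theta2 for the length
    of a cell and delta for the rotation.

    Convergence. On one cell, the problem which prescribes - w - i z v at 0 and
    w - i z v at L is well posed, with a constant that depends only on bounds
    of the coefficients and on |kappa|, as long as Im kappa >= 0
    ([robin_stability]). The function phi_eps(s) u_{s,eps} solves it with data
    phi_eps(s) and psi_eps(s + delta); these converge, so it converges on the
    first cell to the solution X(s) of the problem without absorption whose
    data are phi_0(s) and psi_0(s + delta) ([profile_cvg]). Seen from its
    second cell, u_{s,eps} is the multiple p_eps(s) of u_{s+delta,eps}, because
    a decaying solution is determined by one Robin trace; with the eigenvalue
    equation this gives
      phi_eps(s) u_{s,eps}(n L + x)
        = lambda_eps^n phi_eps(s + n delta) u_{s + n delta,eps}(x)
    ([hsol_rotn]), hence convergence on every cell as soon as phi_0(s) does not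
    vanish ([limit_cvg]). In the limit the cells fit together into a solution
    on the half-line ([limit_csol]), which is u^r up to a null set when
    s = s^*.

    Positivity. The flux Im(w conj v) of a decaying solution is nonincreasing
    under absorption and cannot stay below a negative constant, so it is
    nonnegative ([flux_ge0]). The flux F(s) of X(s) is therefore nonnegative;
    it is also continuous and 1-periodic in s, and F(s) =
    |lambda_0|^2 F(s + delta) with |lambda_0| <= 1, since the flux is conserved
    along a cell without absorption. Comparing both sides at a maximum of F
    gives |lambda_0| = 1, so that F is invariant under an irrational rotation
    and is constant ([rotation_pos]). The flux density of the definition of a
    regular frequency is 4 z F ([fluxQ_flux]); it is nonzero somewhere, hence F
    is positive. A zero of phi_0 at s would give F(s) = - z |X(s)(0)|^2, so phi_0
    never vanishes ([phi0_neq0]), and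
      Re((1 - Lambda) conj(1 + Lambda)) = 4 z F(s) / |phi_0(s)|^2 > 0
    for s = s^*. *)

Local Notation Re := complex.Re.
Local Notation Im := complex.Im.
Local Notation leb := (@lebesgue_measure _).

(** * Continuity of arithmetic expressions *)

Section ContinuousArith.
Context {R : realType} {T : topologicalType}.
Implicit Types f g : T -> R.

Lemma contD f g : continuous f -> continuous g -> continuous (fun x => f x + g x).
Proof. by move=> cf cg x; apply: cvgD; [exact: cf|exact: cg]. Qed.
Lemma contN f : continuous f -> continuous (fun x => - f x).
Proof. by move=> cf x; apply: cvgN; exact: cf. Qed.
Lemma contM f g : continuous f -> continuous g -> continuous (fun x => f x * g x).
Proof. by move=> cf cg x; apply: cvgM; [exact: cf|exact: cg]. Qed.
Lemma contX f n : continuous f -> continuous (fun x => f x ^+ n).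
Proof.
move=> cf; elim: n => [|n IH]; first by move=> x; exact: cst_continuous.
rewrite (_ : (fun x => _) = (fun x => f x * f x ^+ n)); first exact: contM.
by apply/funext => x; rewrite exprS.
Qed.
Lemma contV f : continuous f -> (forall x, f x != 0) -> continuous (fun x => (f x)^-1).
Proof. by move=> cf f0 x; apply: cvgV; [exact: f0|exact: cf]. Qed.
Lemma cont_cst (c : R) : continuous (fun _ : T => c).
Proof. exact: cst_continuous. Qed.
Lemma cont_comp (S : topologicalType) (f : S -> R) (h : T -> S) :
  continuous h -> continuous f -> continuous (fun x => f (h x)).
Proof.
move=> ch cf x; apply: (@continuous_comp _ _ _ h f); [exact: ch|exact: cf].
Qed.
End ContinuousArith.

Lemma cont_id {T : topologicalType} : continuous (fun x : T => x).
Proof. by move=> x; exact: cvg_id. Qed.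

Ltac cont_step := let x := fresh "x" in intro x; lazymatch goal with
  | |- continuous_at _ ?F => lazymatch F with
    | (fun x => @?f x + @?g x) => refine (@contD _ _ f g _ _ x)
    | (fun x => @?f x * @?g x) => refine (@contM _ _ f g _ _ x)
    | (fun x => - @?f x) => refine (@contN _ _ f _ x)
    | (fun x => @?f x ^+ ?n) => refine (@contX _ _ f n _ x)
    | (fun x => x) => refine (@cont_id _ x)
    | (fun x => ?c) => refine (@cont_cst _ _ c x)
    end
  end.
(** Continuity of a polynomial expression, by recursion on the expression; the
    continuity of its atoms is looked up in the context. *)
Ltac cont := repeat (first [ assumption | cont_step ]).

(** * A step function of class C1 *)

Section Kernel.
Context {R : realType}.
Implicit Types (t x y r h : R).

Lemma is_derive_littleo (f : R -> R) x (l : R) :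
  (forall e : R, 0 < e -> \forall h \near (0 : R),
     `|f (x + h) - f x - l * h| <= e * `|h|) ->
  is_derive x 1 f l.
Proof.
move=> fl.
have H : (fun h => h^-1 *: (f (h *: (1 : R) + x) - f x)) @ 0^' --> l.
  apply/cvgrPdist_le => e e0; near=> h.
  have h0 : h != 0 by near: h; exact: nbhs_dnbhs_neq.
  have H : `|f (x + h) - f x - l * h| <= e * `|h|.
    by near: h; apply: nbhs_dnbhs; exact: fl.
  rewrite scaler1 (addrC h) -(ler_pM2r (_ : 0 < `|h|)) ?normr_gt0//.
  rewrite -normrM mulrBl mulrAC mulVf// mul1r distrC.
  by apply: le_trans H.
by apply: DeriveDef; [apply/cvg_ex; exists l|apply: cvg_lim].
Unshelve. all: by end_near. Qed.

Definition pos_part t : R := Num.max 0 t.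

Lemma is_derive_pos_sq t : is_derive t 1 (fun t => pos_part t ^+ 2) (2 * pos_part t).
Proof.
apply: is_derive_littleo => e e0; near=> h.
have he : `|h| <= e.
  by near: h; exact: (@nbhs0_le R R^o e e0).
apply: (@le_trans _ _ (`|h| * `|h|)); last by rewrite ler_wpM2r.
rewrite -normrM ger0_norm; last by rewrite -expr2 sqr_ge0.
rewrite /pos_part ler_norml; case: (leP 0 t); case: (leP 0 (t + h)); nra.
Unshelve. all: by end_near. Qed.

Lemma continuous_pos_part : continuous pos_part.
Proof. by move=> t; apply: continuous_max; [exact: cst_continuous|exact: cvg_id]. Qed.

(** A second difference of squared positive parts: a step from 0 to 1 on the
    unit interval, whose derivative [tent] is a continuous kernel of mass 1.
    Piecewise quadratics are enough since test functions are of class C1. *)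
Definition ramp t : R :=
  2 * (pos_part t ^+ 2 - 2 * pos_part (t - 2^-1) ^+ 2 + pos_part (t - 1) ^+ 2).
Definition tent t : R :=
  4 * (pos_part t - 2 * pos_part (t - 2^-1) + pos_part (t - 1)).

Lemma is_derive_ramp t : is_derive t 1 ramp (tent t).
Proof.
have H (c : R) : is_derive t 1 (fun t => pos_part (t - c) ^+ 2) (2 * pos_part (t - c)).
  have := @is_derive1_comp _ (fun t => pos_part t ^+ 2) (fun t => t - c) t _ 1
    (is_derive_pos_sq _).
  rewrite mulr1; apply.
  by apply: is_derive_eq; rewrite subr0.
have H0 := is_derive_pos_sq t.
have H1 := H 2^-1; have H2 := H 1.
rewrite /ramp; apply: is_derive_eq; rewrite /tent /GRing.scale /=; ring.
Qed.

Lemma continuous_tent : continuous tent.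
Proof.
have H (c : R) : continuous (fun t => pos_part (t - c)).
  by apply: (@cont_comp _ _ _ pos_part (fun t => t - c)); [cont|exact: continuous_pos_part].
have cp := continuous_pos_part; rewrite /tent; cont; exact: H.
Qed.

Lemma ramp_le0 t : t <= 0 -> ramp t = 0.
Proof.
move=> t0; rewrite /ramp /pos_part.
by rewrite !max_l ?(expr0n,mulr0,subrr,addr0)//; lra.
Qed.

Lemma ramp_ge1 t : 1 <= t -> ramp t = 1.
Proof.
move=> t0; rewrite /ramp /pos_part !max_r; [|lra..].
by field.
Qed.

Lemma tent_ge0 t : 0 <= tent t.
Proof. rewrite /tent /pos_part; case: (leP 0 t); case: (leP 0 (t - 2^-1)); case: (leP 0 (t - 1)); lra. Qed.
Lemma tent_le2 t : tent t <= 2.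
Proof. rewrite /tent /pos_part; case: (leP 0 t); case: (leP 0 (t - 2^-1)); case: (leP 0 (t - 1)); lra. Qed.
Lemma tent_le0 t : t <= 0 -> tent t = 0.
Proof. rewrite /tent /pos_part; case: (leP 0 t); case: (leP 0 (t - 2^-1)); case: (leP 0 (t - 1)); lra. Qed.
Lemma tent_ge1 t : 1 <= t -> tent t = 0.
Proof. rewrite /tent /pos_part; case: (leP 0 t); case: (leP 0 (t - 2^-1)); case: (leP 0 (t - 1)); lra. Qed.
Lemma ramp_ge0 t : 0 <= ramp t.
Proof. rewrite /ramp /pos_part; case: (leP 0 t); case: (leP 0 (t - 2^-1)); case: (leP 0 (t - 1)); nra. Qed.
Lemma ramp_le1 t : ramp t <= 1.
Proof. rewrite /ramp /pos_part; case: (leP 0 t); case: (leP 0 (t - 2^-1)); case: (leP 0 (t - 1)); nra. Qed.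

Definition step x r t := ramp ((t - x) / r).
Definition bump x r t := tent ((t - x) / r) / r.

Lemma is_derive_step x r t : is_derive t 1 (step x r) (bump x r t).
Proof.
have := @is_derive1_comp _ ramp (fun t => (t - x) / r) t _ r^-1
   (is_derive_ramp _); apply.
by apply: is_derive_eq; rewrite subr0 scaler0 add0r /GRing.scale /= mulr1.
Qed.

Lemma continuous_bump x r : continuous (bump x r).
Proof.
apply: contM; last cont.
by apply: (@cont_comp _ _ _ tent (fun t => (t - x) / r)); [cont|exact: continuous_tent].
Qed.

Lemma step_le x r t : 0 < r -> t <= x -> step x r t = 0.
Proof. by move=> r0 tx; rewrite /step ramp_le0// pmulr_lle0 ?invr_gt0// subr_le0. Qed.
Lemma step_ge x r t : 0 < r -> x + r <= t -> step x r t = 1.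
Proof. by move=> r0 tx; rewrite /step ramp_ge1// ler_pdivlMr// mul1r lerBrDl. Qed.
Lemma bump_le x r t : 0 < r -> t <= x -> bump x r t = 0.
Proof. by move=> r0 tx; rewrite /bump tent_le0 ?mul0r// pmulr_lle0 ?invr_gt0// subr_le0. Qed.
Lemma bump_ge x r t : 0 < r -> x + r <= t -> bump x r t = 0.
Proof. by move=> r0 tx; rewrite /bump tent_ge1 ?mul0r// ler_pdivlMr// mul1r lerBrDl. Qed.
Lemma bump_ge0 x r t : 0 < r -> 0 <= bump x r t.
Proof. by move=> r0; rewrite /bump mulr_ge0 ?tent_ge0// invr_ge0 ltW. Qed.
Lemma bump_bound x r t : 0 < r -> bump x r t <= 2 / r.
Proof. by move=> r0; rewrite /bump ler_pM2r ?invr_gt0// tent_le2. Qed.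

End Kernel.

(** * Averages at Lebesgue points *)

Section Integrals.
Context {R : realType}.
Implicit Types (f g h : R -> R) (a b x y r : R) (A B I : set R).

Lemma locint_itv f I a b : locally_integrable I f -> `[a, b]%classic `<=` I ->
  leb.-integrable `[a, b] (EFin \o f).
Proof.
move=> [mf oI fI] abI; apply/integrableP; split.
  by apply/measurable_EFinP; apply: measurable_funS mf => //; exact: open_measurable.
exact: (fI _ abI (@segment_compact _ _ _)).
Qed.

Lemma continuous_bounded_itv h a b : continuous h ->
  [bounded h x | x in `[a, b]%classic].
Proof.
move=> ch; have [ab|ba] := leP a b; last first.
  rewrite set_itv_ge ?bnd_simp -?ltNge//.
  by exists 0; split; [exact: num_real|move=> ? ? ?].
have : compact (h @` `[a, b]%classic).
  apply: continuous_compact; last exact: segment_compact.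
  exact: continuous_subspaceT.
move=> /compact_bounded [M [Mr hM]]; exists M; split => // N MN x abx.
by apply: (hM N MN); exists x.
Qed.

Lemma integrable_mulC_itv f h a b :
  leb.-integrable `[a, b] (EFin \o f) -> continuous h ->
  leb.-integrable `[a, b] (EFin \o (fun x => f x * h x)).
Proof.
move=> fi ch.
have mh : measurable_fun `[a, b]%classic h.
  by apply: measurable_funTS; exact: continuous_measurable_fun.
have := integrableMl _ fi mh (continuous_bounded_itv _ _ ch).
by apply.
Qed.

Lemma Rintegral_sub A B f : A `<=` B -> (forall x, B x -> ~ A x -> f x = 0) ->
  (\int[leb]_(x in B) f x = \int[leb]_(x in A) f x)%R.
Proof.
move=> AB f0; rewrite Rintegral_mkcond [RHS]Rintegral_mkcond.
apply: eq_Rintegral => x _; rewrite !patchE.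
have [Ax|Ax] := pselect (A x); first by rewrite !mem_set//; exact: AB.
rewrite (memNset Ax); have [Bx|Bx] := pselect (B x); last by rewrite memNset.
by rewrite mem_set// f0.
Qed.

Lemma int_bump x r : 0 < r -> (\int[leb]_(t in `[x, x + r]) bump x r t = 1)%R.
Proof.
move=> r0; rewrite /Rintegral (@continuous_FTC2 _ _ (step x r)); first last.
- by move=> t _; rewrite derive1E; apply: derive_val; exact: is_derive_step.
- have ds t : derivable (step x r) t 1 by have [] := is_derive_step x r t.
  have cs t : step x r @ t --> step x r t.
    by apply: differentiable_continuous; apply/derivable1_diffP.
  split; first by move=> t _.
  + exact: cvg_at_right_filter.
  + exact: cvg_at_left_filter.
- exact/continuous_subspaceT/continuous_bump.
- by rewrite ltrDl.
by rewrite step_ge// step_le// sube0.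
Qed.

(** The kernel is at most 2 / r and has mass 1, so the error is at most a
    fixed multiple of the average of |f - f x| over the ball of radius 2 r,
    which tends to 0 at a Lebesgue point. *)
Lemma tent_average f x : locally_integrable setT f -> lebesgue_pt f x ->
  (fun r => \int[leb]_(t in `[x, x + r]) (f t * bump x r t))%R @ 0^'+ --> f x.
Proof.
move=> lf fx.
apply/cvgrPdist_le => e e0.
have /fx [d /= d0 davg_lt] : nbhs 0%E [set y : \bar R | (y < (e / 8)%:E)%E].
  by apply: open_ereal_lt'; rewrite lte_fin divr_gt0.
near=> r.
have r0 : 0 < r by near: r; exact: nbhs_right_gt.
have dav : (davg f x (2 * r) <= (e / 8)%:E)%E.
  apply/ltW/davg_lt => /=; last by rewrite mulr_gt0.
  rewrite sub0r normrN gtr0_norm ?mulr_gt0// mulrC -ltr_pdivlMr//.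
  by near: r; apply: nbhs_right_lt; rewrite divr_gt0.
have fint : leb.-integrable `[x, x + r] (EFin \o f) by exact: locint_itv lf _.
have cint : leb.-integrable `[x, x + r] (EFin \o (cst (f x))).
  by apply: continuous_compact_integrable; [exact: segment_compact|exact/continuous_subspaceT/cst_continuous].
have fcint : leb.-integrable `[x, x + r] (EFin \o (fun t => f t - f x)).
  have := integrableB _ fint cint; exact.
have cb := @continuous_bump _ x r.
have -> : f x = (\int[leb]_(t in `[x, x + r]) (cst (f x) t * bump x r t))%R.
  rewrite RintegralZl//; first by rewrite int_bump// mulr1.
  apply: continuous_compact_integrable; [exact: segment_compact|exact/continuous_subspaceT].
rewrite distrC -RintegralB//; [|exact: integrable_mulC_itv..].
under eq_Rintegral do rewrite -mulrBl.
rewrite (le_trans (le_normr_Rintegral _ _))//; first exact: integrable_mulC_itv.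
have ballE : leb (ball x (2 * r)) = (2 * r *+ 2)%:E.
  by rewrite lebesgue_measure_ball// mulr_ge0// ltW.
have fm : measurable_fun setT f by case: lf.
apply: (@le_trans _ _ (2 / r * \int[leb]_(t in `[x, x + r]) `|f t - f x|)%R).
  rewrite -RintegralZl//; last exact: integrable_norm.
  apply: le_Rintegral => //.
  - by have := integrable_norm (integrable_mulC_itv fcint cb).
  - have := integrableZl _ (2 / r) (integrable_norm fcint); exact.
  - move=> t _; rewrite normrM mulrC ler_wpM2r// ger0_norm ?bump_ge0//.
    exact: bump_bound.
rewrite mulrC -ler_pdivlMr ?divr_gt0// -lee_fin.
rewrite /Rintegral fineK; last first.
  by apply: integrable_fin_num => //; exact: integrable_norm fcint.
apply: (@le_trans _ _ (\int[leb]_(t in ball x (2 * r)) `|(f t - f x)%:E|)%E).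
  apply: ge0_subset_integral => //.
  - exact: measurable_ball.
  - apply/measurable_EFinP; apply: measurableT_comp => //.
    by apply: measurable_funB => //; exact: measurable_funTS.
  - move=> t /=; rewrite in_itv/= /ball/= => /andP[xt txr].
    by rewrite distrC ger0_norm ?subr_ge0//; lra.
move: dav; rewrite /davg /iavg ballE inver /=.
rewrite gt_eqF ?pmulrn_lgt0 ?mulr_gt0// lee_pdivrMl ?pmulrn_lgt0 ?mulr_gt0//.
move=> /le_trans; apply; rewrite -EFinM lee_fin.
have -> : e / (2 / r) = r * (e / 2) by field; lra.
have -> : 2 * r *+ 2 * (e / 8) = r * (e / 2) by field.
by [].
Unshelve. all: by end_near. Qed.

End Integrals.

(** * The fundamental theorem of calculus for weak derivatives *)

Section WeakDerivative.
Context {R : realType}.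
Implicit Types (f g h : R -> R) (a b x y r t : R) (A B I : set R).

Definition weak_id I f g := forall phi, test_fun I phi ->
  (\int[leb]_(x in I) (f x * derive1 phi x) =
  - \int[leb]_(x in I) (g x * phi x))%R.

(** Tested against this function, the identity defining weak derivatives
    compares averages of f to the right of x and of y with the integral of g
    in between. *)
Definition trapezoid x y r t : R := step x r t - step y r t.

Lemma derive1_trapezoid x y r t :
  is_derive t 1 (trapezoid x y r) (bump x r t - bump y r t).
Proof.
have H1 := is_derive_step x r t; have H2 := is_derive_step y r t.
by rewrite /trapezoid; apply: is_derive_eq.
Qed.

Lemma derive1_trapezoidE x y r :
  derive1 (trapezoid x y r) = fun t => bump x r t - bump y r t.
Proof.
apply/funext => t; rewrite derive1E; apply: derive_val.
exact: derive1_trapezoid.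
Qed.

Lemma trapezoid_out x y r t : 0 < r -> x <= y -> ~ `[x, (y + r)]%classic t ->
  trapezoid x y r t = 0.
Proof.
move=> r0 xy /=; rewrite in_itv/= => /negP; rewrite negb_and -!ltNge => /orP[tx|yt].
  by rewrite /trapezoid !step_le ?subrr//; lra.
by rewrite /trapezoid !step_ge ?subrr//; lra.
Qed.

Lemma test_trapezoid I x y r : 0 < r -> x <= y -> `[x, (y + r)]%classic `<=` I ->
  test_fun I (trapezoid x y r).
Proof.
move=> r0 xy xyI; split.
- by move=> t; have [] := derive1_trapezoid x y r t.
- rewrite derive1_trapezoidE; have c1 := @continuous_bump _ x r.
  by have c2 := @continuous_bump _ y r; cont.
- exists `[x, (y + r)]%classic; split => //; first exact: segment_compact.
  by move=> t; exact: trapezoid_out.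
Qed.

Lemma trapezoid_cvg x y (c : R) t : 0 < c -> x < y ->
  \forall n \near \oo, trapezoid x y (c / n.+1%:R) t = \1_`]x, y] t.
Proof.
move=> c0 xy.
have r0 n : 0 < c / n.+1%:R :> R by rewrite divr_gt0.
have small d : 0 < d -> \forall n \near \oo, c / n.+1%:R <= d :> R.
  move=> d0; near=> n; rewrite ler_pdivrMr// -ler_pdivrMl//.
  have : d^-1 * c <= n%:R :> R by near: n; exact: nbhs_infty_ger.
  by move=> /le_trans; apply; rewrite ler_nat.
have [tx|xt] := leP t x.
  near=> n; rewrite /trapezoid !step_le// ?(le_trans tx) ?ltW//.
  rewrite indicE memNset ?subrr// => /=; rewrite in_itv/= ltNge tx //.
have [ty|yt] := leP t y.
  have tx0 : 0 < t - x by rewrite subr_gt0.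
  near=> n; rewrite /trapezoid step_ge//; last first.
    by rewrite -lerBrDl; near: n; exact: small.
  by rewrite step_le// subr0 indicE mem_set//= in_itv/= xt.
have ty0 : 0 < t - y by rewrite subr_gt0.
near=> n; have ny : c / n.+1%:R <= t - y by near: n; exact: small.
have {r0} := r0 n; move: (c / _) ny => r ny r0.
rewrite /trapezoid !step_ge//; [|lra..].
by rewrite subrr indicE memNset//= in_itv/= => /andP[_]; rewrite leNgt yt.
Unshelve. all: by end_near. Qed.

Lemma trapezoid_bound x y r t : `|trapezoid x y r t| <= 1.
Proof.
rewrite ler_norml /trapezoid /step.
have := ramp_ge0 ((t - x) / r); have := ramp_ge0 ((t - y) / r).
have := ramp_le1 ((t - x) / r); have := ramp_le1 ((t - y) / r).
lra.
Qed.

(** As the ramps of [trapezoid] get steeper, one side of the weak identity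
    tends to the increment of f by [tent_average], and the other to the
    integral of g by dominated convergence. *)
Lemma weak_ftc I f g a b x y :
  locally_integrable I f -> locally_integrable I g -> weak_id I f g ->
  `[a, b]%classic `<=` I -> a < x -> x < y -> y < b ->
  lebesgue_pt (f \_ `[a, b]) x -> lebesgue_pt (f \_ `[a, b]) y ->
  f y - f x = (\int[leb]_(t in `[x, y]) g t)%R.
Proof.
move=> lf lg wid abI ax xy yb fx fy.
have fi : leb.-integrable `[a, b] (EFin \o f) by exact: locint_itv lf _.
have gi : leb.-integrable `[a, b] (EFin \o g) by exact: locint_itv lg _.
have lf1 : locally_integrable setT (f \_ `[a, b]) by exact: integrable_locally_restrict.
(* c is the room to the right of y, in which the ramps of width at most c fit *)
pose c := b - y; have c0 : 0 < c by rewrite subr_gt0.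
pose r n : R := c / n.+1%:R.
have r0 n : 0 < r n by rewrite divr_gt0.
have rc n : r n <= c by rewrite /r ler_pdivrMr// ler_peMr ?(ltW c0)// ler1n.
have rcvg : r @ \oo --> (0 : R).
  rewrite -[X in _ --> X](mulr0 c); apply: cvgM; [exact: cvg_cst|exact: cvg_harmonic].
have avg z : lebesgue_pt (f \_ `[a, b]) z ->
  (\int[leb]_(t in `[z, z + r n]) ((f \_ `[a, b]) t * bump z (r n) t))%R @[n --> \oo] --> (f \_ `[a, b]) z.
  by move=> /(tent_average lf1) /cvg_at_rightP; apply.
have key n : (\int[leb]_(t in `[y, y + r n]) ((f \_ `[a, b]) t * bump y (r n) t) -
    \int[leb]_(t in `[x, x + r n]) ((f \_ `[a, b]) t * bump x (r n) t) =
    \int[leb]_(t in `[a, b]) (g t * trapezoid x y (r n) t))%R.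
  have rn := r0 n; have rcn := rc n; rewrite /c in rcn.
  have xyab : `[x, (y + r n)]%classic `<=` `[a, b]%classic.
    by move=> t /=; rewrite !in_itv/= => /andP[? ?]; apply/andP; split; lra.
  have := wid _ (test_trapezoid rn (ltW xy) (subset_trans xyab abI)).
  rewrite derive1_trapezoidE (Rintegral_sub abI); last first.
    move=> t _ abt; have nxy : ~ `[x, y + r n]%classic t by move=> /xyab.
    move: nxy => /=; rewrite in_itv/= => /negP; rewrite negb_and -!ltNge.
    by move=> /orP[?|?]; [rewrite !bump_le ?subrr ?mulr0//; lra|
                         rewrite !bump_ge ?subrr ?mulr0//; lra].
  rewrite [X in _ = - X](Rintegral_sub abI); last first.
    by move=> t _ abt; rewrite trapezoid_out ?mulr0//; [exact: ltW|move=> /xyab].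
  move=> /(congr1 -%R); rewrite opprK => <-.
  have bumpE z : a <= z -> z + r n <= b ->
      (\int[leb]_(t in `[z, z + r n]) ((f \_ `[a, b]) t * bump z (r n) t) =
       \int[leb]_(t in `[a, b]) (f t * bump z (r n) t))%R.
    move=> az zb; have zab : `[z, (z + r n)]%classic `<=` `[a, b]%classic.
      by move=> t /=; rewrite !in_itv/= => /andP[? ?]; apply/andP; split; lra.
    rewrite [RHS](Rintegral_sub zab); last first.
      move=> t _ /=; rewrite in_itv/= => /negP; rewrite negb_and -!ltNge.
      by move=> /orP[?|?]; [rewrite bump_le ?mulr0//; lra|rewrite bump_ge ?mulr0//; lra].
    apply: eq_Rintegral => t /[!inE]/= tz; rewrite patchE mem_set//.
    exact: zab.
  rewrite !bumpE; [|lra..].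
  rewrite -RintegralB//; [|by apply: integrable_mulC_itv => //; exact: continuous_bump..].
  rewrite -[RHS]mulN1r -RintegralZl//; last first.
    apply: (@integrable_mulC_itv _ f (fun t => bump x (r n) t - bump y (r n) t)) => //.
    by have c1 := @continuous_bump _ x (r n); have c2 := @continuous_bump _ y (r n); cont.
  by apply: eq_Rintegral => t _; ring.
have glim : (\int[leb]_(t in `[a, b]) (g t * trapezoid x y (r n) t))%R @[n --> \oo] -->
    (\int[leb]_(t in `[x, y]) g t)%R.
  have -> : (\int[leb]_(t in `[x, y]) g t = \int[leb]_(t in `[a, b]) (g t * \1_`]x, y] t))%R.
    have xyab : `]x, y]%classic `<=` `[a, b]%classic.
      by move=> t /=; rewrite !in_itv/= => /andP[? ?]; apply/andP; split; lra.
    rewrite -Rintegral_itv_obnd_cbnd//; last exact: integrableS gi.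
    rewrite [RHS](Rintegral_sub xyab).
      by apply: eq_Rintegral => t xt; rewrite indicE xt mulr1.
    by move=> t _ xyt; rewrite indicE memNset// mulr0.
  have mg : measurable_fun `[a, b] g by apply/measurable_EFinP; case/integrableP: gi.
  have [] := @dominated_convergence _ _ _ leb `[a, b]%classic _
    (fun n t => (g t * trapezoid x y (r n) t)%:E)
    (fun t => (g t * \1_`]x, y] t)%:E) (fun t => `|g t|%:E).
  - by [].
  - move=> n; apply/measurable_EFinP; apply: measurable_funM => //.
    apply: measurable_funTS; apply: continuous_measurable_fun.
    move=> t; apply: differentiable_continuous; apply/derivable1_diffP.
    by have [] := derive1_trapezoid x y (r n) t.
  - apply/measurable_EFinP; apply: measurable_funM => //.
  - apply: aeW => t _; apply: cvg_EFin; first exact: nearW.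
    apply: cvg_near_cst; have := trapezoid_cvg t c0 xy.
    by apply: filterS => n; rewrite -/(r n) /= => ->.
  - exact: (integrable_norm gi).
  - apply: aeW => t n _ /=; rewrite lee_fin normrM ler_piMr//.
    exact: trapezoid_bound.
  move=> ig _ /=; rewrite -[X in _ --> X -> _]fineK; last exact: integrable_fin_num.
  exact: fine_cvg.
have inE z : a < z -> z < b -> (f \_ `[a, b]) z = f z.
  by move=> az zb; rewrite patchE mem_set//= in_itv/= !ltW.
have lhs : (\int[leb]_(t in `[a, b]) (g t * trapezoid x y (r n) t))%R @[n --> \oo] -->
    f y - f x.
  rewrite -(inE y) -1?(inE x); [|lra..].
  under eq_cvg do rewrite -key; exact: (cvgB (avg _ fy) (avg _ fx)).
exact: (cvg_unique _ lhs glim).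
Qed.
End WeakDerivative.

(** * Almost everywhere properties *)

Section AlmostEverywhere.
Context {R : realType}.
Implicit Types (P : R -> Prop) (I : set R).

Lemma ae_mono P (Q : R -> Prop) : (forall x, P x -> Q x) ->
  (\forall x \ae (@lebesgue_measure R), P x) -> \forall x \ae (@lebesgue_measure R), Q x.
Proof. by move=> PQ; apply: (@filterS _ _ (ae_filter_ringOfSetsType _)). Qed.

Lemma ae_and P (Q : R -> Prop) :
  (\forall x \ae (@lebesgue_measure R), P x) -> (\forall x \ae (@lebesgue_measure R), Q x) ->
  \forall x \ae (@lebesgue_measure R), P x /\ Q x.
Proof. by move=> ? ?; apply: (@filterI _ _ (ae_filter_ringOfSetsType _)). Qed.

Lemma ae_forall_count (C : countType) (P : C -> R -> Prop) :
  (forall c, \forall x \ae (@lebesgue_measure R), P c x) ->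
  \forall x \ae (@lebesgue_measure R), forall c, P c x.
Proof.
move=> aeP.
have : \forall x \ae (@lebesgue_measure R), forall n : nat,
    if unpickle n is Some c then P c x else True.
  apply: ae_foralln => n; case: (unpickle n) => [c|]; first exact: aeP.
  exact: aeW.
by apply: ae_mono => x H c; have := H (pickle c); rewrite pickleK.
Qed.

Lemma ae_open_ex P I : open I -> I !=set0 ->
  (\forall x \ae (@lebesgue_measure R), P x) -> exists x, I x /\ P x.
Proof.
move=> oI [x0 Ix0] [N [mN N0 PN]]; apply: contrapT => /forallNP nP.
have [e /= e0 eI] : \forall e \near (0 : R)^'+, ball x0 e `<=` I.
  exact: (open_subball oI Ix0).
have ballI : ball x0 (e / 2) `<=` N.
  have : ball x0 (e / 2) `<=` I.
    apply: eI => /=; rewrite ?sub0r ?normrN ?gtr0_norm ?divr_gt0//.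
    by rewrite ltr_pdivrMr// mulr_natr mulr2n ltrDl.
  by move=> /subset_trans; apply => x Ix; apply: PN => /= Px; exact: (nP x).
have e20 : 0 < e / 2 by rewrite divr_gt0.
have : ((e / 2 *+ 2)%:E <= (0 : \bar R))%E.
  rewrite -(lebesgue_measure_ball x0 (ltW e20)) -N0; apply: le_measure => //; rewrite inE //.
  exact: measurable_ball.
by rewrite lee_fin leNgt pmulrn_lgt0// e20.
Qed.

Lemma rat_below (x e : R) : 0 < e -> exists q : rat, x - e < ratr q < x.
Proof.
move=> e0; have [|q] := @rat_in_itvoo _ (x - e) x; first by rewrite ltrBlDr ltrDl.
by rewrite in_itv; exists q.
Qed.
Lemma rat_above (x e : R) : 0 < e -> exists q : rat, x < ratr q < x + e.
Proof.
move=> e0; have [|q] := @rat_in_itvoo _ x (x + e); first by rewrite ltrDl.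
by rewrite in_itv; exists q.
Qed.

Lemma open_itv_sub I x : open I -> I x -> exists2 e : R, 0 < e & `](x - e), (x + e)[%classic `<=` I.
Proof.
move=> oI Ix; have [e /= e0 eI] := open_subball oI Ix.
exists (e / 2); first by rewrite divr_gt0.
rewrite -ball_itv; apply: eI => /=; rewrite ?sub0r ?normrN ?gtr0_norm ?divr_gt0//.
by rewrite ltr_pdivrMr// mulr_natr mulr2n ltrDl.
Qed.

End AlmostEverywhere.

(** * Uniqueness of weak derivatives *)

Section WeakUnique.
Context {R : realType}.
Implicit Types (f g h : R -> R) (a b x y r t : R) (A B I K : set R).

Lemma integrable_supp I K f h : locally_integrable I f -> compact K -> K `<=` I ->
  continuous h -> (forall x, ~ K x -> h x = 0) ->
  leb.-integrable I (EFin \o (fun x => f x * h x)).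
Proof.
move=> lf cK KI ch h0.
have [mf oI fI] := lf.
have mK : measurable K by exact: compact_measurable.
have mI : measurable I by exact: open_measurable.
have fK : leb.-integrable K (EFin \o f).
  apply/integrableP; split; last exact: fI.
  by apply/measurable_EFinP; apply: measurable_funS mf.
have bK : [bounded h x | x in K].
  have : compact (h @` K).
    by apply: continuous_compact => //; exact: continuous_subspaceT.
  move=> /compact_bounded [M [Mr hM]]; exists M; split => // N MN x Kx.
  by apply: (hM N MN); exists x.
have mh : measurable_fun K h.
  by apply: measurable_funTS; exact: continuous_measurable_fun.
have fhK : leb.-integrable K (EFin \o (fun x => f x * h x)).
  by have := integrableMl _ fK mh bK; apply.
apply/integrable_mkcond => //; move/integrable_mkcond: fhK => /(_ mK).
congr integrable; apply/funext => x; rewrite !patchE /=.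
have [Kx|Kx] := pselect (K x); first by rewrite !mem_set//; exact: KI.
by rewrite memNset//; case: ifPn => // _; rewrite h0// mulr0.
Qed.

Lemma near_cst_derive1 (f : R -> R) (c x : R) :
  (\forall y \near x, f y = c) -> derive1 f x = 0.
Proof.
move=> fc; rewrite derive1E (@near_eq_derive _ _ _ f (cst c) x 1); first exact: derive_cst.
exact: fc.
Qed.

Lemma derive1_supp K (phi : R -> R) x : compact K -> (forall x, ~ K x -> phi x = 0) ->
  ~ K x -> derive1 phi x = 0.
Proof.
move=> cK phi0 Kx.
have oK : open (~` K) by apply: closed_openC; apply: compact_closed.
apply: (@near_cst_derive1 _ 0); have : nbhs x (~` K) by exact: open_nbhs_nbhs.
by apply: filterS => y /phi0 ->.
Qed.

Lemma test_fun_cont I (phi : R -> R) : test_fun I phi -> continuous phi.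
Proof.
by move=> [dphi _ _] x; apply: differentiable_continuous; apply/derivable1_diffP.
Qed.

Lemma integrable_test I f phi : locally_integrable I f -> test_fun I phi ->
  leb.-integrable I (EFin \o (fun x => f x * phi x)).
Proof.
move=> lf tphi; have cphi := test_fun_cont tphi.
by case: tphi => _ _ [K [cK KI phi0]]; exact: integrable_supp lf cK KI cphi phi0.
Qed.

Lemma integrable_test_derive I f phi : locally_integrable I f -> test_fun I phi ->
  leb.-integrable I (EFin \o (fun x => f x * derive1 phi x)).
Proof.
move=> lf [_ cphi' [K [cK KI phi0]]].
apply: (integrable_supp lf cK KI cphi') => x Kx.
exact: derive1_supp cK phi0 Kx.
Qed.

(** By [weak_ftc] for the zero function, which has weak derivative d, all
    integrals of d over segments of I vanish. The differentiation theorem of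
    Lebesgue on the countably many segments with rational ends then gives d =
    0 outside one null set. *)
Lemma weak_zero I d : locally_integrable I d ->
  (forall phi, test_fun I phi -> (\int[leb]_(x in I) (d x * phi x) = 0)%R) ->
  \forall x \ae (@lebesgue_measure R), I x -> d x = 0.
Proof.
move=> ld d0; have [md oI _] := ld.
have lz : locally_integrable I (cst (0 : R)).
  apply: open_integrable_locally => //.
  exact: integrable0.
have zint a x y b : `[a, b]%classic `<=` I -> a < x -> x < y -> y < b ->
    (\int[leb]_(t in `[x, y]) d t = 0)%R.
  move=> abI ax xy yb.
  have lpt z : lebesgue_pt ((cst 0) \_ `[a, b]) z.
    rewrite (_ : _ \_ _ = cst 0); last first.
      by apply/funext => u; rewrite patchE; case: ifP.
    apply: (@continuous_lebesgue_pt _ _ _ setT) => //.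
    + by split => //; exact: openT.
    + exact: cst_continuous.
  have := @weak_ftc _ I (cst 0) d a b x y lz ld _ abI ax xy yb (lpt x) (lpt y).
  rewrite subrr => -> //; move=> phi tphi.
  rewrite d0// oppr0 (@Rintegral_sub _ set0) ?Rintegral_set0// => t _ _.
  by rewrite mul0r.
pose ok (p : rat * rat * rat) := let: (q1, m, q2) := p in
  ratr q1 < ratr m :> R /\ `[ratr q1 : R, ratr q2]%classic `<=` I.
have : \forall x \ae (@lebesgue_measure R), forall p : rat * rat * rat, ok p ->
    ratr p.1.2 < x -> x < ratr p.2 -> d x = 0.
  apply: ae_forall_count => -[[q1 m] q2] /=; have [[q1m qI]|nok] := pselect (ok (q1, m, q2)); last first.
    by apply: aeW => x /nok.
  pose a : R := ratr q1; pose b : R := ratr q2; pose c : R := ratr m.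
  have di : leb.-integrable `[a, b] (EFin \o d) by exact: locint_itv ld _.
  pose d1 := d \_ `[a, b].
  have d1i : leb.-integrable setT (EFin \o d1).
    by rewrite /d1 -restrict_EFin; apply/integrable_restrict => //=; rewrite setTI.
  have d1l : locally_integrable setT d1 by apply: open_integrable_locally => //; exact: openT.
  have int1 y : leb.-integrable [set` Interval (BLeft c) (BRight y)] (EFin \o d1).
    exact: integrableS d1i.
  apply: ae_mono (FTC1 int1 d1l) => x /= H _ cx xb {ok}.
  have [|_ H2] := H; first by rewrite lte_fin.
  transitivity (d1 x); first by rewrite /d1 patchE mem_set//= in_itv/=; apply/andP; split; [lra|apply: ltW].
  rewrite -H2; apply: (@near_cst_derive1 _ 0); near=> y.
  have cy : c < y by near: y; exact: lt_nbhsr.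
  have yb : y < b by near: y; exact: lt_nbhsl.
  rewrite -(zint a c y b)//; apply: eq_Rintegral => t /[!inE]/=; rewrite in_itv/= => /andP[ct ty].
  by rewrite /d1 patchE mem_set//= in_itv/=; apply/andP; split; lra.
apply: ae_mono => x H Ix.
have [e e0 eI] := open_itv_sub oI Ix.
have [q2 /andP[xq2 q2e]] := rat_above x e0.
have [m /andP[em mx]] := rat_below x e0.
have [|q1 ] := @rat_below R (ratr m) (ratr m - (x - e)); first by rewrite subr_gt0.
rewrite subKr => /andP[eq1 q1m].
apply: (H (q1, m, q2)) => //; split => // t /=; rewrite in_itv/= => /andP[q1t tq2].
by apply: eI => /=; rewrite in_itv/=; apply/andP; split; lra.
Unshelve. all: by end_near. Qed.

End WeakUnique.

(** * Continuous representatives *)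

Section WeakPrimitive.
Context {R : realType}.
Implicit Types (f g h k : R -> R) (a b x y r t : R) (A B I K : set R).

Lemma locint_itvT f a b : locally_integrable setT f -> leb.-integrable `[a, b] (EFin \o f).
Proof. by move=> lf; apply: (locint_itv lf). Qed.

(** F is the indefinite integral of g plus a constant, and [weak_ftc]
    identifies it with f at Lebesgue points. Restricting f to segments with
    rational ends makes one null set serve for all pairs of points. The last
    clause gives a classical derivative wherever g has a continuous version k. *)
Lemma weak_primitive I a f g : is_interval I -> I !=set0 -> I `<=` [set x | a < x] ->
  locally_integrable I f -> locally_integrable I g ->
  locally_integrable setT (g \_ I) -> weak_id I f g ->
  exists F : R -> R, [/\ continuous F,
    \forall x \ae (@lebesgue_measure R), I x -> F x = f x &
    forall k, (forall x, I x -> {for x, continuous k}) ->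
      (\forall x \ae (@lebesgue_measure R), I x -> k x = g x) ->
      forall x, I x -> is_derive x 1 F (k x)].
Proof.
move=> iI I0 Ia lf lg lgT wid.
have [mf oI _] := lf.
have mI : measurable I by exact: open_measurable.
(* m lies to the left of I, where the extension of g by 0 vanishes *)
pose m := a - 1; have ma : m < a by rewrite /m ltrBlDr ltrDl.
pose G x := (\int[leb]_(t in `[m, x]) (g \_ I) t)%R.
have gi x y : leb.-integrable `[x, y] (EFin \o (g \_ I)) by exact: locint_itvT.
have G0 x : x <= a -> G x = 0.
  move=> xa; rewrite /G (@Rintegral_sub _ set0) ?Rintegral_set0//.
  move=> t /=; rewrite in_itv/= => /andP[_ tx] _; rewrite patchE memNset// => /Ia /=.
  by rewrite ltNge (le_trans tx).
have cG : continuous G.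
  move=> x; have [xa|ax] := ltP x a.
    rewrite /continuous_at G0 ?(ltW xa)//; apply: cvg_near_cst.
    by near=> y; apply: G0; apply/ltW; near: y; exact: lt_nbhsl.
  have mx : m < x by exact: lt_le_trans ax.
  have x1 : x < x + 1 by rewrite ltrDl.
  have := @parameterized_integral_continuous _ m (x + 1) (g \_ I) (ltW (lt_trans mx x1)) (gi _ _).
  move=> /continuous_within_itvP => /(_ (lt_trans mx x1)) [+ _ _].
  by apply; rewrite in_itv/= mx.
have GB x y : I x -> I y -> x <= y -> G y - G x = (\int[leb]_(t in `[x, y]) g t)%R.
  move=> Ix Iy xy; have mx : m <= x by apply/ltW/(lt_trans ma)/Ia.
  rewrite /G Rintegral_itvB//.
  rewrite Rintegral_itv_obnd_cbnd; last by apply: integrableS (gi x y) => //; exact: subset_itv_oc_cc.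
  apply: eq_Rintegral => t /[!inE]/=; rewrite in_itv/= => txy.
  by rewrite patchE mem_set//; exact: (iI x y).
pose good x := forall q : rat * rat, `[ratr q.1 : R, ratr q.2]%classic `<=` I ->
   lebesgue_pt (f \_ `[ratr q.1, ratr q.2]) x.
have aegood : \forall x \ae (@lebesgue_measure R), good x.
  apply: ae_forall_count => -[q1 q2] /=.
  have [qI|nqI] := pselect (`[ratr q1 : R, ratr q2]%classic `<=` I); last exact: aeW.
  have fi : leb.-integrable `[ratr q1, ratr q2] (EFin \o f) by exact: locint_itv lf _.
  by apply: ae_mono (lebesgue_differentiation (integrable_locally_restrict _ fi)).
have goodB x y : I x -> I y -> good x -> good y -> x < y -> f y - f x = G y - G x.
  move=> Ix Iy gx gy xy; rewrite GB ?(ltW xy)//.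
  have [e e0 eI] := open_itv_sub oI Ix.
  have [e' e'0 eI'] := open_itv_sub oI Iy.
  have [q1 /andP[xq1 q1x]] := rat_below x e0.
  have [q2 /andP[yq2 q2y]] := rat_above y e'0.
  have qI : `[ratr q1 : R, ratr q2]%classic `<=` I.
    apply: (iI (ratr q1) (ratr q2)).
      by apply: eI => /=; rewrite in_itv/=; apply/andP; split; lra.
    by apply: eI' => /=; rewrite in_itv/=; apply/andP; split; lra.
  exact: (weak_ftc lf lg wid qI q1x xy yq2 (gx (q1, q2) qI) (gy (q1, q2) qI)).
have [x0 [Ix0 gx0]] := ae_open_ex oI I0 aegood.
exists (fun x => (f x0 - G x0) + G x); split.
- by cont.
- apply: ae_mono aegood => x gx Ix; have [xx0|xx0|->] := ltgtP x x0.
  + by have := goodB _ _ Ix Ix0 gx gx0 xx0; lra.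
  + by have := goodB _ _ Ix0 Ix gx0 gx xx0; lra.
  + by rewrite subrK.
- move=> k ck kg x Ix.
  have mk : measurable_fun I k.
    by apply: open_continuous_measurable_fun => // y /[!inE] Iy; exact: ck.
  have mkI : measurable_fun setT (k \_ I) by apply/(measurable_restrictT _ _).1.
  have aekg : \forall x \ae (@lebesgue_measure R), (k \_ I) x = (g \_ I) x.
    apply: ae_mono kg => y kgy; rewrite !patchE; case: ifPn => // /set_mem; exact: kgy.
  have mgI : measurable_fun setT (g \_ I) by case: lgT.
  have GE : G = fun x => (\int[leb]_(t in `[m, x]) (k \_ I) t)%R.
    apply/funext => y; congr fine; apply: ae_eq_integral => //.
    + by apply/measurable_EFinP; exact: measurable_funTS.
    + by apply/measurable_EFinP; exact: measurable_funTS.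
    + by apply: ae_mono aekg => z /= -> _.
  have ki y : leb.-integrable `[m, y] (EFin \o (k \_ I)).
    apply/integrableP; split; first by apply/measurable_EFinP; exact: measurable_funTS.
    have /integrableP[_] := gi m y; apply: le_lt_trans.
    rewrite le_eqVlt; apply/orP; left; apply/eqP; apply: ae_eq_integral => //.
    + by apply/measurable_EFinP; apply: measurableT_comp => //; exact: measurable_funTS.
    + by apply/measurable_EFinP; apply: measurableT_comp => //; exact: measurable_funTS.
    + by apply: ae_mono aekg => z /= -> _.
  have x1 : x < x + 1 by rewrite ltrDl.
  have mx : m < x by apply: (lt_trans ma); exact: Ia.
  have ckx : {for x, continuous (k \_ I)}.
    rewrite /prop_for /continuous_at patchE mem_set//.
    apply: cvg_trans (ck x Ix); apply: near_eq_cvg.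
    have : nbhs x I by exact: open_nbhs_nbhs.
    by apply: filterS => y Iy; rewrite patchE mem_set.
  have [d1 d2] := continuous_FTC1_closed x1 (ki _) mx ckx.
  rewrite -GE in d1 d2.
  have dG : is_derive x 1 G (k x).
    have -> : k x = (k \_ I) x by rewrite patchE mem_set.
    by rewrite -d2 derive1E; exact/derivableP.
  by have := is_deriveD (is_derive_cst (f x0 - G x0) x 1) dG; rewrite add0r.
Unshelve. all: by end_near. Qed.

End WeakPrimitive.

(** * Complex-valued functions of a real variable *)

Section ComplexCalculus.
Context {R : realType}.
Implicit Types (z c : R[i]) (r x : R) (f g u v w : R -> R[i]).

Lemma ReD z c : Re (z + c) = Re z + Re c. Proof. by case: z; case: c. Qed.
Lemma ImD z c : Im (z + c) = Im z + Im c. Proof. by case: z; case: c. Qed.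
Lemma ReN z : Re (- z) = - Re z. Proof. by case: z. Qed.
Lemma ImN z : Im (- z) = - Im z. Proof. by case: z. Qed.
Lemma ReM z c : Re (z * c) = Re z * Re c - Im z * Im c. Proof. by case: z; case: c. Qed.
Lemma ImM z c : Im (z * c) = Re z * Im c + Im z * Re c. Proof. by case: z; case: c. Qed.
Lemma ReC r : Re r%:C = r. Proof. by []. Qed.
Lemma ImC r : Im r%:C = 0. Proof. by []. Qed.
Lemma Rei : Re ('i%C : R[i]) = 0. Proof. by []. Qed.
Lemma Imi : Im ('i%C : R[i]) = 1. Proof. by []. Qed.
Lemma Re0 : Re (0 : R[i]) = 0. Proof. by []. Qed.
Lemma Im0 : Im (0 : R[i]) = 0. Proof. by []. Qed.
Lemma Re1 : Re (1 : R[i]) = 1. Proof. by []. Qed.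
Lemma Im1 : Im (1 : R[i]) = 0. Proof. by []. Qed.
Lemma Reconj z : Re (z^*)%C = Re z. Proof. by case: z. Qed.
Lemma Imconj z : Im (z^*)%C = - Im z. Proof. by case: z. Qed.
Lemma Reiz (r : R) z : Re ('i%C * r%:C * z) = - (r * Im z).
Proof. by case: z => a b /=; ring. Qed.
Lemma Imiz (r : R) z : Im ('i%C * r%:C * z) = r * Re z.
Proof. by case: z => a b /=; ring. Qed.
(** Pushes real and imaginary parts to the leaves of an expression. The rules
    for multiples of the imaginary unit come first, since those for products
    would expand them. *)
Definition reim := (Reiz, Imiz, ReD, ImD, ReN, ImN, ReM, ImM, ReC, ImC, Rei, Imi, Re0, Im0, Re1, Im1, Reconj, Imconj).

Lemma complex_eq z c : Re z = Re c -> Im z = Im c -> z = c.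
Proof. by case: z => a b; case: c => a' b' /= -> ->. Qed.

Definition nsq z : R := Re z ^+ 2 + Im z ^+ 2.

Lemma nsq_ge0 z : 0 <= nsq z. Proof. by rewrite addr_ge0// sqr_ge0. Qed.
Lemma normc_sq z : normc z ^+ 2 = nsq z.
Proof. by case: z => a b /=; rewrite sqr_sqrtr// addr_ge0// sqr_ge0. Qed.
Lemma normcE z : normc z = Num.sqrt (nsq z). Proof. by case: z. Qed.
Lemma normc_nneg z : 0 <= normc z. Proof. by rewrite normcE sqrtr_ge0. Qed.
Lemma nsqM z c : nsq (z * c) = nsq z * nsq c.
Proof. rewrite /nsq !reim; ring. Qed.
Lemma nsq_eq0 z : nsq z = 0 -> z = 0.
Proof.
rewrite /nsq => /eqP; rewrite paddr_eq0 ?sqr_ge0// !sqrf_eq0 => /andP[/eqP a /eqP b].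
exact: complex_eq.
Qed.
(** The difference of the two sides is the squared modulus of z - c. *)
Lemma nsqD z c : nsq (z + c) <= 2 * nsq z + 2 * nsq c.
Proof.
rewrite -subr_ge0 (_ : _ - _ = nsq (z - c)) ?nsq_ge0// /nsq !reim; ring.
Qed.
Lemma nsqN z : nsq (- z) = nsq z.
Proof. by rewrite /nsq !reim !sqrrN. Qed.
Lemma normc_lt e z : 0 <= e -> nsq z <= e ^+ 2 -> normc z <= e.
Proof.
move=> e0 ze; by rewrite normcE -[leRHS](ger0_norm e0) -sqrtr_sqr ler_wsqrtr.
Qed.

Definition ccont f := continuous (fun x => Re (f x)) /\ continuous (fun x => Im (f x)).

Lemma ccontD f g : ccont f -> ccont g -> ccont (fun x => f x + g x).
Proof.
move=> [a b] [c d]; split.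
  rewrite (_ : (fun x => _) = (fun x => Re (f x) + Re (g x))); first by cont.
  by apply/funext => x; rewrite ReD.
rewrite (_ : (fun x => _) = (fun x => Im (f x) + Im (g x))); first by cont.
by apply/funext => x; rewrite ImD.
Qed.
Lemma ccontM f g : ccont f -> ccont g -> ccont (fun x => f x * g x).
Proof.
move=> [a b] [c d]; split.
  rewrite (_ : (fun x => _) = (fun x => Re (f x) * Re (g x) - Im (f x) * Im (g x))); first by cont.
  by apply/funext => x; rewrite ReM.
rewrite (_ : (fun x => _) = (fun x => Re (f x) * Im (g x) + Im (f x) * Re (g x))); first by cont.
by apply/funext => x; rewrite ImM.
Qed.
Lemma ccontB f g : ccont f -> ccont g -> ccont (fun x => f x - g x).
Proof.
move=> [a b] [c d]; split.
  rewrite (_ : (fun x => _) = (fun x => Re (f x) - Re (g x))); first by cont.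
  by apply/funext => x; rewrite ReD ReN.
rewrite (_ : (fun x => _) = (fun x => Im (f x) - Im (g x))); first by cont.
by apply/funext => x; rewrite ImD ImN.
Qed.
Lemma ccont_cst z : ccont (fun=> z).
Proof. by split; cont. Qed.
Lemma ccont_real (h : R -> R) : continuous h -> ccont (fun x => (h x)%:C).
Proof. by move=> ch; split; [|exact: cont_cst]. Qed.
Lemma ccont_comp (h : R -> R) f : continuous h -> ccont f -> ccont (fun x => f (h x)).
Proof.
move=> ch [a b]; split.
  exact: (@cont_comp _ _ _ (fun x => Re (f x)) h).
exact: (@cont_comp _ _ _ (fun x => Im (f x)) h).
Qed.

(** Componentwise, so that the calculus of real-valued functions applies. *)
Definition cderive x f (l : R[i]) :=
  is_derive x 1 (fun x => Re (f x)) (Re l) /\ is_derive x 1 (fun x => Im (f x)) (Im l).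

Lemma cderiveD x f g l m : cderive x f l -> cderive x g m -> cderive x (fun x => f x + g x) (l + m).
Proof.
move=> [a b] [c d]; split; rewrite !reim.
  rewrite (_ : (fun x => _) = (fun x => Re (f x)) + (fun x => Re (g x))); first exact: is_deriveD.
  by apply/funext => y; rewrite ReD.
rewrite (_ : (fun x => _) = (fun x => Im (f x)) + (fun x => Im (g x))); first exact: is_deriveD.
by apply/funext => y; rewrite ImD.
Qed.

Lemma cderiveZ x f c l : cderive x f l -> cderive x (fun x => c * f x) (c * l).
Proof.
move=> [a b]; split; rewrite !reim.
  rewrite (_ : (fun x => _) = (fun x => Re c * Re (f x) - Im c * Im (f x))).
    by apply: is_derive_eq; rewrite /GRing.scale /=; ring.
  by apply/funext => y; rewrite ReM.
rewrite (_ : (fun x => _) = (fun x => Re c * Im (f x) + Im c * Re (f x))).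
  by apply: is_derive_eq; rewrite /GRing.scale /=; ring.
by apply/funext => y; rewrite ImM.
Qed.

Lemma cderiveB x f g l m : cderive x f l -> cderive x g m -> cderive x (fun x => f x - g x) (l - m).
Proof.
move=> a /(cderiveZ (-1)) b; have := cderiveD a b; rewrite mulN1r.
by congr cderive; apply/funext => y; rewrite mulN1r.
Qed.

Lemma cderive_shift x f (r : R) l : cderive (r + x) f l -> cderive x (fun x => f (r + x)) l.
Proof.
have H (h : R -> R) (k : R) : is_derive (r + x) 1 h k -> is_derive x 1 (fun x => h (r + x)) k.
  move=> dh; have := @is_derive1_comp _ h (fun x => r + x) x k 1 dh.
  by rewrite (mulr1 k); apply; apply: is_derive_eq; rewrite add0r mulr1.
by move=> [a b]; split; [exact: (H (fun x => Re (f x)))|exact: (H (fun x => Im (f x)))].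
Qed.

End ComplexCalculus.

(** * Classical representatives of weak solutions *)

Section WeakSolutions.
Context {R : realType}.
Implicit Types (f g h k mu rho : R -> R) (a x y r t : R) (I : set R) (u v w : R -> R[i]) (kappa : R[i]).

(** Local integrability of the extension of f by 0: unlike local integrability
    in the open set I, it gives control up to the boundary of I. *)
Definition locint_on I f := open I /\ locally_integrable setT (f \_ I).

Lemma locint_on_locint I f : locint_on I f -> locally_integrable I f.
Proof.
move=> [oI [mf _ fK]]; split => //.
  by apply/(measurable_restrictT _ _).2 => //; exact: open_measurable.
move=> K KI cK; apply: le_lt_trans (fK K _ cK) => //.
rewrite le_eqVlt; apply/orP; left; apply/eqP; apply: eq_integral => x /[!inE] Kx.
by rewrite patchE mem_set//; exact: KI.
Qed.

Lemma locint_onM I f h : locint_on I f -> continuous h -> locint_on I (fun x => h x * f x).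
Proof.
move=> [oI lf] ch; split => //; have [mf oT fK] := lf.
have E : (fun x => h x * f x) \_ I = fun x => (f \_ I) x * h x.
  by apply/funext => x; rewrite !patchE mulrC; case: ifP => // _; rewrite mul0r.
rewrite E; split => //.
  by apply: measurable_funM => //; exact: continuous_measurable_fun.
move=> K _ cK.
have mK : measurable K by exact: compact_measurable.
have fi : leb.-integrable K (EFin \o (f \_ I)).
  apply/integrableP; split; last exact: fK.
  by apply/measurable_EFinP; apply: measurable_funTS.
have bK : [bounded h x | x in K].
  have : compact (h @` K).
    by apply: continuous_compact => //; exact: continuous_subspaceT.
  move=> /compact_bounded [M [Mr hM]]; exists M; split => // N MN x Kx.
  by apply: (hM N MN); exists x.
have mh : measurable_fun K h.
  by apply: measurable_funTS; exact: continuous_measurable_fun.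
have fhi : leb.-integrable K (EFin \o (fun x => (f \_ I) x * h x)).
  by have := integrableMl _ fi mh bK; apply.
by case/integrableP : fhi.
Qed.

Lemma locint_onD I f g : locint_on I f -> locint_on I g -> locint_on I (fun x => f x + g x).
Proof.
move=> [oI lf] [_ lg]; split => //; have := locally_integrableD lf lg.
congr locally_integrable; apply/funext => x /=; rewrite !patchE.
by case: ifP => // _; rewrite addr0.
Qed.

Lemma locint_onN I f : locint_on I f -> locint_on I (fun x => - f x).
Proof.
move=> [oI lf]; split => //; have := locally_integrableN lf.
congr locally_integrable; apply/funext => x /=; rewrite !patchE.
by case: ifP => // _; rewrite oppr0.
Qed.

Lemma locint_on_sq I f : open I -> measurable_fun I f ->
  (\int[leb]_(x in I) (f x ^+ 2)%:E < +oo)%E -> locint_on I f.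
Proof.
move=> oI mf fi; split => //.
have mI : measurable I by exact: open_measurable.
have mfI : measurable_fun setT (f \_ I) by apply/(measurable_restrictT _ _).1.
split => //; first exact: openT.
move=> K _ cK; have mK : measurable K by exact: compact_measurable.
have mfK : measurable_fun K (f \_ I) by exact: measurable_funTS.
apply: (@le_lt_trans _ _ (\int[leb]_(x in K) (1 + ((f \_ I) x ^+ 2)%:E))%E).
  apply: ge0_le_integral => //.
  - by apply/measurable_EFinP; exact: measurableT_comp.
  - apply: emeasurable_funD => //; apply/measurable_EFinP; exact: measurable_funX.
  - move=> x _; rewrite -EFinD lee_fin -[(f \_ I) x ^+ 2]real_normK ?num_real//.
    by move: `|_| => y; nra.
rewrite ge0_integralD//; last 2 first.
- by move=> x _; rewrite lee_fin sqr_ge0.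
- by apply/measurable_EFinP; exact: measurable_funX.
rewrite integral_cst// mul1e lte_add_pinfty//; first exact: compact_finite_measure.
apply: le_lt_trans fi.
rewrite [leRHS]integral_mkcond /=; apply: (@le_trans _ _ (\int[leb]_x ((f \_ I) x ^+ 2)%:E)%E).
  apply: ge0_subset_integral => //.
    by apply/measurable_EFinP; exact: measurable_funX.
  by move=> x _; rewrite lee_fin sqr_ge0.
rewrite le_eqVlt; apply/orP; left; apply/eqP; apply: eq_integral => x _.
by rewrite !patchE; case: ifP => // _; rewrite expr0n.
Qed.

Lemma inL2P I u : inL2 (fun=> 1) I u -> cmeasurable I u /\
  (\int[leb]_(x in I) (nsq (u x))%:E < +oo)%E.
Proof.
move=> [mu uL]; split => //; move: uL; rewrite /L2norm.
under eq_integral do rewrite mul1r normc_sq.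
by apply: lty_poweRy; rewrite invr_eq0.
Qed.

Lemma measurable_nsq I u : cmeasurable I u -> measurable_fun I (fun x => nsq (u x)).
Proof. by move=> [? ?]; apply: measurable_funD; exact: measurable_funX. Qed.

Lemma inL2_locint_on I u : open I -> inL2 (fun=> 1) I u ->
  locint_on I (fun x => Re (u x)) /\ locint_on I (fun x => Im (u x)).
Proof.
move=> oI /inL2P [[m1 m2] fi].
have mI : measurable I by exact: open_measurable.
have mn : measurable_fun I (fun x => nsq (u x)) by exact: measurable_nsq.
split; apply: locint_on_sq => //; apply: le_lt_trans fi; apply: ge0_le_integral => //.
- by move=> x _; rewrite lee_fin sqr_ge0.
- by apply/measurable_EFinP; exact: measurable_funX.
- by apply/measurable_EFinP.
- by move=> x _; rewrite lee_fin lerDl sqr_ge0.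
- by move=> x _; rewrite lee_fin sqr_ge0.
- by apply/measurable_EFinP; exact: measurable_funX.
- by apply/measurable_EFinP.
- by move=> x _; rewrite lee_fin lerDr sqr_ge0.
Qed.

(** Two applications of [weak_primitive], to u and to mu g. The second one
    shows that mu^-1 W is a continuous version of g, which makes V
    differentiable. *)
Lemma weak_pair I a mu (u g q : R -> R) : is_interval I -> I !=set0 -> I `<=` [set x | a < x] ->
  continuous mu -> (forall x, 0 < mu x) ->
  locint_on I u -> locint_on I g -> locint_on I q -> weak_id I u g -> weak_id I (fun x => mu x * g x) q ->
  exists V W : R -> R, [/\ continuous V, continuous W,
   \forall x \ae (@lebesgue_measure R), I x -> V x = u x,
   \forall x \ae (@lebesgue_measure R), I x -> W x = mu x * g x &
   (forall x, I x -> is_derive x 1 V ((mu x)^-1 * W x)) /\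
   (forall k, continuous k ->
      (\forall x \ae (@lebesgue_measure R), I x -> k x = q x) ->
      forall x, I x -> is_derive x 1 W (k x))].
Proof.
move=> iI I0 Ia cmu mu0 lu lg lq wu wg.
have lmg := locint_onM lg cmu.
have [V [cV Vu V']] := weak_primitive iI I0 Ia (locint_on_locint lu) (locint_on_locint lg) lg.2 wu.
have [W [cW Wg W']] := weak_primitive iI I0 Ia (locint_on_locint lmg) (locint_on_locint lq) lq.2 wg.
exists V, W; split => //; split; last first.
  by move=> k ck; apply: W' => x _; exact: ck.
apply: V'.
  move=> x Ix; apply: cvgM; last exact: cW.
  by apply: cvgV; [rewrite gt_eqF|exact: cmu].
by apply: ae_mono Wg => x H /H ->; rewrite mulKf// gt_eqF.
Qed.

End WeakSolutions.

Section Representative.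
Context {R : realType}.
Implicit Types (mu rho : R -> R) (a x y r t : R) (I : set R) (f g u v w : R -> R[i]) (kappa : R[i]).

(** The equation -(mu v')' = rho kappa v as a first order system for v and w =
    mu v'. Continuity of v and w on the whole line encodes continuity up to
    the boundary of I. *)
Record csol I mu rho kappa v w : Prop := {
  csol_v : ccont v;
  csol_w : ccont w;
  csol_dv : forall x, I x -> cderive x v (((mu x)^-1)%:C * w x);
  csol_dw : forall x, I x -> cderive x w (- ((rho x)%:C * kappa * v x)) }.

Lemma wderiv_weak_id I u g : is_wderiv I u g ->
  weak_id I (fun x => Re (u x)) (fun x => Re (g x)) /\
  weak_id I (fun x => Im (u x)) (fun x => Im (g x)).
Proof.
move=> [_ _ ug]; split => phi /ug.
  move=> /(congr1 (@complex.Re R)); rewrite /cint /= => H.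
  transitivity (\int[leb]_(x in I) Re (u x * (derive1 phi x)%:C))%R.
    by apply: eq_Rintegral => x _; rewrite !reim mulr0 subr0.
  rewrite H; congr (- _); apply: eq_Rintegral => x _.
  by rewrite !reim mulr0 subr0.
move=> /(congr1 (@complex.Im R)); rewrite /cint /= => H.
transitivity (\int[leb]_(x in I) Im (u x * (derive1 phi x)%:C))%R.
  by apply: eq_Rintegral => x _; rewrite !reim mulr0 add0r.
rewrite H; congr (- _); apply: eq_Rintegral => x _.
by rewrite !reim mulr0 add0r.
Qed.

(** The source rho kappa u has the continuous version rho kappa v, so w is
    differentiable as well; [weak_pair] is applied to real and imaginary
    parts. *)
Lemma weak_sol_rep I a mu rho kappa u :
  open I -> is_interval I -> I !=set0 -> I `<=` [set x | a < x] ->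
  continuous mu -> continuous rho -> (forall x, 0 < mu x) ->
  weak_sol I mu rho kappa u ->
  exists v w, [/\ csol I mu rho kappa v w, ae_eq_on I v u &
    ae_eq_on I w (fun x => (mu x)%:C * wderiv I u x)].
Proof.
move=> oI iI I0 Ia cmu crho mu0 [[uL2 ug gL2] eqn].
set g := wderiv I u in ug gL2 eqn *.
have [lu1 lu2] := inL2_locint_on oI uL2.
have [lg1 lg2] := inL2_locint_on oI gL2.
have [wu1 wu2] := wderiv_weak_id ug.
pose q1 x := - (rho x * (Re kappa * Re (u x) - Im kappa * Im (u x))).
pose q2 x := - (rho x * (Re kappa * Im (u x) + Im kappa * Re (u x))).
have lq1 : locint_on I q1.
  by apply/locint_onN/locint_onM => //; apply: locint_onD; [|apply: locint_onN]; apply: locint_onM => //; cont.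
have lq2 : locint_on I q2.
  by apply/locint_onN/locint_onM => //; apply: locint_onD; apply: locint_onM => //; cont.
have mI : measurable I by exact: open_measurable.
have split_eq (gg qq : R -> R) : locint_on I gg -> locint_on I qq -> (forall phi, test_fun I phi ->
    (\int[leb]_(x in I) (mu x * gg x * derive1 phi x + qq x * phi x) = 0)%R) ->
    weak_id I (fun x => mu x * gg x) qq.
  move=> lgg lqq H phi tphi; apply/eqP; rewrite -subr_eq0 opprK; apply/eqP.
  rewrite -RintegralD//; first exact: H.
    exact: (integrable_test_derive (locint_on_locint (locint_onM lgg cmu)) tphi).
  exact: (integrable_test (locint_on_locint lqq) tphi).
have wg1 : weak_id I (fun x => mu x * Re (g x)) q1.
  apply: split_eq => // phi /eqn /(congr1 (@complex.Re R)); rewrite /cint /= => <-.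
  by apply: eq_Rintegral => x _; rewrite /q1 !reim; ring.
have wg2 : weak_id I (fun x => mu x * Im (g x)) q2.
  apply: split_eq => // phi /eqn /(congr1 (@complex.Im R)); rewrite /cint /= => <-.
  by apply: eq_Rintegral => x _; rewrite /q2 !reim; ring.
have [V1 [W1 [cV1 cW1 Vu1 Wg1 [dV1 dW1]]]] := weak_pair iI I0 Ia cmu mu0 lu1 lg1 lq1 wu1 wg1.
have [V2 [W2 [cV2 cW2 Vu2 Wg2 [dV2 dW2]]]] := weak_pair iI I0 Ia cmu mu0 lu2 lg2 lq2 wu2 wg2.
exists (fun x => V1 x +i* V2 x), (fun x => W1 x +i* W2 x); split.
- split => //= x Ix.
  + split; rewrite !reim /= mul0r ?subr0 ?addr0; [exact: dV1|exact: dV2].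
  + split; rewrite !reim /=.
      have := dW1 (fun x => - (rho x * (Re kappa * V1 x - Im kappa * V2 x))).
      move=> /(_ _ _ x Ix) H; apply: is_derive_eq (H _ _) _; last ring.
      * by cont.
      * apply: ae_mono (ae_and Vu1 Vu2) => y [h1 h2] Iy.
        by rewrite h1// h2.
    have := dW2 (fun x => - (rho x * (Re kappa * V2 x + Im kappa * V1 x))).
    move=> /(_ _ _ x Ix) H; apply: is_derive_eq (H _ _) _; last ring.
    * by cont.
    * apply: ae_mono (ae_and Vu1 Vu2) => y [h1 h2] Iy.
      by rewrite h1// h2.
- apply: ae_mono (ae_and Vu1 Vu2) => y [h1 h2] Iy.
  by apply: complex_eq => /=; [exact: h1|exact: h2].
- apply: ae_mono (ae_and Wg1 Wg2) => y [h1 h2] Iy.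
  by apply: complex_eq; rewrite !reim /= ?mul0r ?subr0 ?addr0; [exact: h1|exact: h2].
Qed.

Lemma cont_ae_eq I (f g : R -> R) : open I -> {within closure I, continuous f} ->
  continuous g -> (\forall x \ae (@lebesgue_measure R), I x -> f x = g x) ->
  forall x, closure I x -> f x = g x.
Proof.
move=> oI cf cg fg x cIx; apply: contrapT => fgx.
have e0 : 0 < `|f x - g x| / 2.
  by rewrite divr_gt0// normr_gt0 subr_eq0; apply/eqP.
have /subspace_continuousP/(_ x cIx) := cf.
move=> /cvgrPdist_lt /(_ _ e0) nf.
have /cvgrPdist_lt /(_ _ e0) ng := cg x.
have [r /= r0 rN] : nbhs x [set y | (closure I y -> `|f x - f y| < `|f x - g x| / 2) /\
     `|g x - g y| < `|f x - g x| / 2].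
  by apply: filterI.
have oJ : open (I `&` ball x r) by apply: openI => //; exact: ball_open.
have J0 : I `&` ball x r !=set0 by apply: cIx; exact: nbhsx_ballx.
have [y [[Iy xy] fgy]] := ae_open_ex oJ J0 fg.
have [/(_ (subset_closure Iy)) fy gy] := rN y xy.
have : `|f x - g x| <= `|f x - f y| + `|g x - g y|.
  by rewrite (distrC (g x)) (fgy Iy) -{1}(subrK (g y) (f x)) -addrA ler_normD.
move=> /le_lt_trans /(_ (ltrD fy gy)); rewrite -splitr ltxx //.
Qed.

(** Functions that are continuous up to the boundary and agree almost
    everywhere in I agree on the closure of I, so [crep] can be computed with
    any representative. *)
Lemma crepE I f F : open I -> ccont F -> ae_eq_on I F f ->
  forall x, closure I x -> crep I f x = F x.
Proof.
move=> oI [cF1 cF2] Ff x cx; rewrite /crep.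
set P := [set g | _].
have PF : P F by split => //; split; exact: continuous_subspaceT.
have : P (xget (fun=> 0) P) by apply: xgetPex; exists F.
move=> [[c1 c2] ae].
have aeF : \forall x \ae (@lebesgue_measure R), I x -> xget (fun=> 0) P x = F x.
  by apply: ae_mono (ae_and ae Ff) => y [h1 h2] Iy; rewrite h1// h2.
apply: complex_eq.
  apply: (cont_ae_eq oI c1 cF1 _ cx).
  by apply: ae_mono aeF => y h /h ->.
apply: (cont_ae_eq oI c2 cF2 _ cx).
by apply: ae_mono aeF => y h /h ->.
Qed.

End Representative.

(** * Stability of the impedance problem on a cell *)

Section Stability.
Context {R : realType}.
Implicit Types (L K z x y t eta tau : R) (D W g h q : R -> R[i]) (A B : R[i]).

Lemma nonincreasing_itv (f df : R -> R) (a b : R) : continuous f ->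
  (forall x, a < x -> x < b -> is_derive x 1 f (df x)) ->
  (forall x, a < x -> x < b -> df x <= 0) ->
  forall x y, a <= x -> x <= y -> y <= b -> f y <= f x.
Proof.
move=> cf dfE df0 x y ax xy yb.
apply: (@ler0_derive1_le_cc _ f a b) => //.
- by move=> u; rewrite in_itv/= => /andP[au ub]; have [] := dfE u au ub.
- move=> u; rewrite in_itv/= => /andP[au ub]; have H := dfE u au ub.
  by rewrite derive1E derive_val df0.
- exact: continuous_subspaceT.
- by rewrite in_itv/= yb (le_trans ax).
- by rewrite in_itv/= ax (le_trans xy).
Qed.

(** The function (N + c / K) exp(- K x) is nonincreasing. *)
Lemma gronwall K L (c : R) (N dN : R -> R) : 0 < K -> 0 <= c -> continuous N ->
  (forall x, 0 <= N x) ->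
  (forall x, 0 < x -> x < L -> is_derive x 1 N (dN x)) ->
  (forall x, 0 < x -> x < L -> dN x <= K * N x + c) ->
  forall x, 0 <= x -> x <= L -> N x <= expR (K * L) * (N 0 + c / K).
Proof.
move=> K0 c0 cN N0 dNE dNle x x0 xL.
pose M x := (N x + c / K) * expR (- K * x).
have cM : continuous M.
  have cexp : continuous (fun x : R => expR (- K * x)).
    apply: (@cont_comp _ _ _ (@expR R) (fun x => - K * x)); first by cont.
    exact: continuous_expR.
  by rewrite /M; cont.
have dM y : 0 < y -> y < L -> is_derive y 1 M ((dN y - (K * N y + c)) * expR (- K * y)).
  move=> y0 yL; have H := dNE y y0 yL.
  have dexp : is_derive y 1 (fun x : R => expR (- K * x)) (expR (- K * y) * - K).
    apply: (@is_derive1_comp _ (@expR R) (fun x => - K * x)).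
    by apply: is_derive_eq; rewrite /GRing.scale /=; ring.
  apply: is_derive_eq; rewrite /GRing.scale /=; field; lra.
have Mx : M x <= M 0.
  apply: (nonincreasing_itv cM dM) => // y y0 yL.
  by rewrite mulr_le0_ge0 ?expR_ge0// subr_le0 dNle.
rewrite /M mulr0 expR0 mulr1 in Mx.
have cK : 0 <= c / K by rewrite divr_ge0// ltW.
apply: (@le_trans _ _ ((N x + c / K) * expR (- K * x) * expR (K * x))).
  by rewrite -mulrA -expRD mulNr addNr expR0 mulr1 lerDl.
apply: (@le_trans _ _ ((N 0 + c / K) * expR (K * x))); first by rewrite ler_wpM2r ?expR_ge0.
rewrite mulrC ler_wpM2r ?addr_ge0// ler_expR ler_pM2l//.
Qed.

(** Im(W conj D), the energy flux of a solution D with mu D' = W. *)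
Definition flux D W x : R := Im (W x) * Re (D x) - Re (W x) * Im (D x).

Lemma is_derive_flux x D W l m : cderive x D l -> cderive x W m ->
  is_derive x 1 (flux D W)
    (Im m * Re (D x) - Re m * Im (D x) + (Im (W x) * Re l - Re (W x) * Im l)).
Proof.
move=> [D1 D2] [W1 W2]; apply: is_derive_eq; rewrite /GRing.scale /=; ring.
Qed.

Definition energy D W x : R := nsq (D x) + nsq (W x).

Lemma energy_ge0 D W x : 0 <= energy D W x.
Proof. by rewrite addr_ge0 ?nsq_ge0. Qed.

Lemma is_derive_energy x D W l m : cderive x D l -> cderive x W m ->
  is_derive x 1 (energy D W)
    (2 * (Re (D x) * Re l + Im (D x) * Im l) + 2 * (Re (W x) * Re m + Im (W x) * Im m)).
Proof.
move=> [D1 D2] [W1 W2].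
rewrite (_ : energy D W = (fun x => Re (D x) * Re (D x) + Im (D x) * Im (D x) +
   (Re (W x) * Re (W x) + Im (W x) * Im (W x)))); last first.
  by apply/funext => y; rewrite /energy /nsq !expr2.
apply: is_derive_eq; rewrite /GRing.scale /=; ring.
Qed.

Lemma continuous_energy D W : ccont D -> ccont W -> continuous (energy D W).
Proof. by move=> [? ?] [? ?]; rewrite /energy /nsq; cont. Qed.
Lemma continuous_flux D W : ccont D -> ccont W -> continuous (flux D W).
Proof. by move=> [? ?] [? ?]; rewrite /flux; cont. Qed.

(** The system satisfied by the difference (D, W) of two solutions with
    different coefficients: the difference of the coefficients enters through
    the sources g and h, of size eta. The sign of Im q is that of absorption. *)
Record perturbed L (C0 : R) eta (p : R -> R) q g h D W : Prop := {
  pert_D : ccont D;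
  pert_W : ccont W;
  pert_dD : forall x, 0 < x -> x < L -> cderive x D ((p x)%:C * W x + g x);
  pert_dW : forall x, 0 < x -> x < L -> cderive x W (- (q x * D x) + h x);
  pert_p : forall x, 0 < x -> x < L -> `|p x| <= C0;
  pert_q : forall x, 0 < x -> x < L -> nsq (q x) <= C0 ^+ 2 /\ 0 <= Im (q x);
  pert_gh : forall x, 0 < x -> x < L -> nsq (g x) <= eta ^+ 2 /\ nsq (h x) <= eta ^+ 2 }.

(** The derivative of the energy is at most C0 + C0^2 + 2 times the energy,
    plus 2 eta^2. *)
Lemma perturbed_gronwall L (C0 : R) eta p q g h D W : 0 <= C0 ->
  perturbed L C0 eta p q g h D W ->
  forall x, 0 <= x -> x <= L ->
  energy D W x <= expR ((C0 + C0 ^+ 2 + 2) * L) * (energy D W 0 + eta ^+ 2).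
Proof.
move=> C00 [cD cW dD dW pb qb ghb] x x0 xL.
set K := C0 + _ + _.
have K2 : 2 <= K by rewrite /K; nra.
have H : energy D W x <= expR (K * L) * (energy D W 0 + 2 * eta ^+ 2 / K).
  have dE y (y0 : 0 < y) (yL : y < L) := is_derive_energy (dD y y0 yL) (dW y y0 yL).
  apply: (@gronwall K L _ _ _ _ _ (continuous_energy cD cW) (energy_ge0 D W) dE) => //.
  - lra.
  - by rewrite mulr_ge0// sqr_ge0.
  - move=> y y0 yL; have := pb y y0 yL; have [] := qb y y0 yL; have [] := ghb y y0 yL.
    rewrite /energy /K /nsq !reim.
    move: (p y) (D y) (W y) (q y) (g y) (h y) => P [d1 d2] [w1 w2] [q1 q2] [g1 g2] [h1 h2] /=.
    rewrite ler_norml => gb hb qb' q20 /andP[p1 p2].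
    have e1 : 2 * (d1 * (P * w1 - 0 * w2) + d2 * (P * w2 + 0 * w1)) <= C0 * (d1 ^+ 2 + d2 ^+ 2 + (w1 ^+ 2 + w2 ^+ 2)).
      rewrite -subr_ge0.
      have -> : C0 * (d1 ^+ 2 + d2 ^+ 2 + (w1 ^+ 2 + w2 ^+ 2)) - 2 * (d1 * (P * w1 - 0 * w2) + d2 * (P * w2 + 0 * w1)) =
        (C0 - P) / 2 * ((d1 + w1) ^+ 2 + (d2 + w2) ^+ 2) + (C0 + P) / 2 * ((d1 - w1) ^+ 2 + (d2 - w2) ^+ 2) by field.
      by rewrite addr_ge0// mulr_ge0 ?addr_ge0 ?sqr_ge0// divr_ge0//; lra.
    have e2 : 2 * (d1 * g1 + d2 * g2) <= d1 ^+ 2 + d2 ^+ 2 + eta ^+ 2.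
      have := sqr_ge0 (d1 - g1); have := sqr_ge0 (d2 - g2); nra.
    have e3 : 2 * (w1 * h1 + w2 * h2) <= w1 ^+ 2 + w2 ^+ 2 + eta ^+ 2.
      have := sqr_ge0 (w1 - h1); have := sqr_ge0 (w2 - h2); nra.
    have e4 : 2 * (w1 * (- (q1 * d1 - q2 * d2)) + w2 * (- (q1 * d2 + q2 * d1))) <=
       w1 ^+ 2 + w2 ^+ 2 + C0 ^+ 2 * (d1 ^+ 2 + d2 ^+ 2).
      apply: (@le_trans _ _ (w1 ^+ 2 + w2 ^+ 2 + (q1 ^+ 2 + q2 ^+ 2) * (d1 ^+ 2 + d2 ^+ 2))).
        have := sqr_ge0 (w1 + (q1 * d1 - q2 * d2)); have := sqr_ge0 (w2 + (q1 * d2 + q2 * d1)); nra.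
      by rewrite lerD2l ler_wpM2r// addr_ge0// sqr_ge0.
    have := sqr_ge0 w1; have := sqr_ge0 w2; have := sqr_ge0 d1; have := sqr_ge0 d2.
    have := mulr_ge0 (sqr_ge0 C0) (sqr_ge0 w1); have := mulr_ge0 (sqr_ge0 C0) (sqr_ge0 w2).
    have -> : 2 * (d1 * (P * w1 - 0 * w2 + g1) + d2 * (P * w2 + 0 * w1 + g2)) =
      2 * (d1 * (P * w1 - 0 * w2) + d2 * (P * w2 + 0 * w1)) + 2 * (d1 * g1 + d2 * g2) by ring.
    have -> : 2 * (w1 * (- (q1 * d1 - q2 * d2) + h1) + w2 * (- (q1 * d2 + q2 * d1) + h2)) =
      2 * (w1 * (- (q1 * d1 - q2 * d2)) + w2 * (- (q1 * d2 + q2 * d1))) + 2 * (w1 * h1 + w2 * h2) by ring.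
    lra.
apply: (le_trans H); rewrite ler_wpM2l ?expR_ge0// lerD2l ler_pdivrMr; last by lra.
have := sqr_ge0 eta; nra.
Qed.

(** For zero data and sources the flux is - z |D 0|^2 at 0 and z |D L|^2 at L,
    whereas absorption makes it nonincreasing: hence D 0 = W 0 = 0 and the
    solution vanishes. With data and sources, the same balance of fluxes
    bounds D 0, hence W 0, and [perturbed_gronwall] carries the bound to the
    whole cell. *)
Lemma robin_stability L (C0 : R) z : 0 < L -> 0 <= C0 -> 0 < z ->
  exists2 C : R, 0 < C & forall eta p q g h D W A B,
  perturbed L C0 eta p q g h D W ->
  - W 0 - 'i%C * z%:C * D 0 = A -> W L - 'i%C * z%:C * D L = B ->
  forall x, 0 <= x -> x <= L -> energy D W x <= C * (nsq A + nsq B + eta ^+ 2).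
Proof.
move=> L0 C00 z0.
set E := expR ((C0 + C0 ^+ 2 + 2) * L).
have E0 : 0 < E by exact: expR_gt0.
pose k := 1 + 2 * z ^+ 2; have k0 : 0 < k by rewrite /k; nra.
(* the parameter of Young's inequality: the sources cost tau times the energy in
   the balance of fluxes, and by Gronwall's inequality this is at most
   z / 4 |D 0|^2 up to data, half of what the balance yields *)
pose tau := z / (4 * (L * E * k)).
have tau0 : 0 < tau by rewrite divr_gt0// !mulr_gt0.
pose C1 := 4 / z * (2 * (L * tau * E) + L / (2 * tau) + 1 / (2 * z)).
have C10 : 0 < C1.
  by rewrite /C1; repeat first [done | apply: addr_gt0 | apply: divr_gt0 | apply: mulr_gt0].
exists (E * (k * C1 + 3)); first by rewrite mulr_gt0// addr_gt0// mulr_gt0.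
move=> eta p q g h D W A B pert.
move=> hA hB x x0 xL.
have gr := perturbed_gronwall C00 pert.
have [cD cW dD dW pb qb ghb] := pert.
set N0 := energy D W 0 in gr.
have fL : flux D W L - flux D W 0 <= L * (tau * (E * (N0 + eta ^+ 2)) + eta ^+ 2 / (2 * tau)).
  set m := tau * _ + _.
  pose f x := flux D W x - m * x.
  have cf : continuous f by have cfl := continuous_flux cD cW; rewrite /f; cont.
  have : f L <= f 0.
    pose df x := - Im (q x) * nsq (D x) + (Im (h x) * Re (D x) - Re (h x) * Im (D x))
       + (Im (W x) * Re (g x) - Re (W x) * Im (g x)) - m.
    apply: (@nonincreasing_itv f df 0 L) => //; last exact: ltW.
      move=> y y0 yL; have H := is_derive_flux (dD y y0 yL) (dW y y0 yL).
      apply: is_derive_eq; rewrite /df /nsq !reim /GRing.scale /=; ring.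
    move=> y y0 yL; rewrite /df subr_le0 /m.
    have := gr y (ltW y0) (ltW yL); rewrite -/E /energy.
    have [_] := qb y y0 yL; have [] := ghb y y0 yL.
    rewrite /nsq.
    move: (D y) (W y) (q y) (g y) (h y) => [d1 d2] [w1 w2] [q1 q2] [g1 g2] [h1 h2] /=.
    move=> gb hb q20; set S := E * _ => NS.
    have t4 : 0 < 4 * tau by rewrite mulr_gt0.
    have y1 (a b : R) : a * b <= tau * b ^+ 2 + a ^+ 2 / (4 * tau).
      rewrite -subr_ge0.
      have -> : tau * b ^+ 2 + a ^+ 2 / (4 * tau) - a * b = (2 * tau * b - a) ^+ 2 / (4 * tau).
        by field; lra.
      by rewrite divr_ge0 ?sqr_ge0// ltW.
    have := y1 h2 d1; have := y1 (- h1) d2; have := y1 g1 w2; have := y1 (- g2) w1.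
    rewrite !sqrrN => i1 i2 i3 i4.
    have q2d : 0 <= q2 * (d1 ^+ 2 + d2 ^+ 2) by rewrite mulr_ge0// addr_ge0// sqr_ge0.
    have gh : (g1 ^+ 2 + g2 ^+ 2 + (h1 ^+ 2 + h2 ^+ 2)) / (4 * tau) <= eta ^+ 2 / (2 * tau).
      rewrite ler_pdivrMr// (_ : _ * (4 * tau) = 2 * eta ^+ 2); last by field; lra.
      lra.
    have tS : tau * (d1 ^+ 2 + d2 ^+ 2 + (w1 ^+ 2 + w2 ^+ 2)) <= tau * S by rewrite ler_wpM2l// ltW.
    lra.
  by rewrite /f mulr0 subr0; lra.
have hW0 : W 0 = - A - 'i%C * z%:C * D 0 by rewrite -hA; ring.
have hWL : W L = B + 'i%C * z%:C * D L by rewrite -hB; ring.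
have yz (a b : R) : - (a * b) <= z / 2 * b ^+ 2 + a ^+ 2 / (2 * z).
  rewrite -subr_ge0.
  have -> : z / 2 * b ^+ 2 + a ^+ 2 / (2 * z) - - (a * b) = (z * b + a) ^+ 2 / (2 * z).
    by field; lra.
  by rewrite divr_ge0 ?sqr_ge0// ltW// mulr_gt0.
have N0b : N0 <= k * nsq (D 0) + 2 * nsq A.
  rewrite /N0 /energy hW0 /k.
  have := nsqD (- A) (- ('i%C * z%:C * D 0)); rewrite !nsqN !nsqM.
  have -> : nsq ('i%C : R[i]) = 1 by rewrite /nsq !reim; ring.
  have -> : nsq z%:C = z ^+ 2 by rewrite /nsq !reim; ring.
  lra.
have D0 : nsq (D 0) <= C1 * (nsq A + nsq B + eta ^+ 2).
  have key : z / 2 * nsq (D 0) <= flux D W L - flux D W 0 + (nsq A + nsq B) / (2 * z).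
    rewrite /flux hW0 hWL /nsq !reim.
    move: (Re (D 0)) (Im (D 0)) (Re (D L)) (Im (D L)) (Re A) (Im A) (Re B) (Im B).
    move=> d1 d2 e1 e2 a1 a2 b1 b2.
    have := yz b2 e1; have := yz (- b1) e2; have := yz a2 d1; have := yz (- a1) d2.
    rewrite !sqrrN => i1 i2 i3 i4.
    have z20 : 0 <= z / 2 by rewrite divr_ge0// ltW.
    have := mulr_ge0 z20 (sqr_ge0 e1); have := mulr_ge0 z20 (sqr_ge0 e2).
    lra.
  have Lte0 : 0 <= L * tau * E by apply: mulr_ge0; [apply: mulr_ge0|]; exact: ltW.
  have zk : L * tau * E * k = z / 4 by rewrite /tau; field; rewrite !gt_eqF.
  have N0b' : L * tau * E * N0 <= z / 4 * nsq (D 0) + 2 * (L * tau * E) * nsq A.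
    by rewrite -zk; have := ler_wpM2l Lte0 N0b; lra.
  have z40 : 0 < z / 4 by rewrite divr_gt0.
  have zC1 : z / 4 * C1 = 2 * (L * tau * E) + L / (2 * tau) + 1 / (2 * z).
    rewrite /C1; move: (2 * (L * tau * E) + _ + _) => S; field; lra.
  rewrite -(ler_pM2l z40) [leRHS]mulrA zC1.
  have := nsq_ge0 A; have := nsq_ge0 B; have := sqr_ge0 eta.
  move: (nsq A) (nsq B) (eta ^+ 2) (nsq (D 0)) key fL N0b' => a b e n key fL N0b' e0 b0 a0.
  have m1 : 0 <= L / (2 * tau) by apply/ltW/divr_gt0 => //; exact: mulr_gt0.
  have m2 : 0 <= 1 / (2 * z) by apply/ltW/divr_gt0 => //; exact: mulr_gt0.
  have H : z / 2 * n <= L * tau * E * N0 + L * tau * E * e + L / (2 * tau) * e + 1 / (2 * z) * (a + b).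
    apply: (le_trans key); apply: (le_trans (lerD fL (lexx _))).
    rewrite le_eqVlt; apply/orP; left; apply/eqP; field; rewrite !gt_eqF//.
  have := mulr_ge0 m1 a0; have := mulr_ge0 m1 b0; have := mulr_ge0 m2 e0.
  have := mulr_ge0 Lte0 a0; have := mulr_ge0 Lte0 b0; have := mulr_ge0 Lte0 e0.
  move: (L * tau * E) (L / (2 * tau)) (1 / (2 * z)) N0b' H => l1 l2 l3 N0b' H.
  lra.
apply: (le_trans (gr x x0 xL)); rewrite -/E -mulrA ler_pM2l//.
rewrite mulrDl; have := nsq_ge0 A; have := nsq_ge0 B; have := sqr_ge0 eta.
have : k * nsq (D 0) <= k * (C1 * (nsq A + nsq B + eta ^+ 2)) by rewrite ler_pM2l.
rewrite mulrA; lra.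
Qed.

End Stability.

(** * Square integrable solutions on a half-line *)

Section HalfLine.
Context {R : realType}.
Implicit Types (L K z x y t eta tau : R) (mu rho : R -> R) (v w : R -> R[i]) (kappa c : R[i]).

Lemma csolD I mu rho kappa v w v' w' : csol I mu rho kappa v w -> csol I mu rho kappa v' w' ->
  csol I mu rho kappa (fun x => v x + v' x) (fun x => w x + w' x).
Proof.
move=> [cv cw dv dw] [cv' cw' dv' dw']; split; [exact: ccontD|exact: ccontD| |] => x Ix.
  by rewrite mulrDr; apply: cderiveD; [exact: dv|exact: dv'].
by rewrite mulrDr opprD; apply: cderiveD; [exact: dw|exact: dw'].
Qed.

Lemma csolZ I mu rho kappa v w c : csol I mu rho kappa v w ->
  csol I mu rho kappa (fun x => c * v x) (fun x => c * w x).
Proof.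
move=> [cv cw dv dw]; split; [by apply: ccontM => //; exact: ccont_cst..| |] => x Ix.
  by rewrite mulrCA; apply: cderiveZ; exact: dv.
by rewrite mulrCA -mulrN; apply: cderiveZ; exact: dw.
Qed.

Lemma csol_shift (I J : set R) mu rho kappa v w (r : R) : csol I mu rho kappa v w ->
  (forall x, J x -> I (r + x)) ->
  csol J (fun x => mu (r + x)) (fun x => rho (r + x)) kappa
     (fun x => v (r + x)) (fun x => w (r + x)).
Proof.
move=> [cv cw dv dw] JI.
have cr : continuous (fun x : R => r + x) by cont.
split; [exact: (ccont_comp cr)|exact: (ccont_comp cr)| |] => x Jx.
  by apply: (@cderive_shift _ x v r); apply: dv; exact: JI.
by apply: (@cderive_shift _ x w r); apply: dw; exact: JI.
Qed.

Lemma csolS (I J : set R) mu rho kappa v w : J `<=` I -> csol I mu rho kappa v w ->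
  csol J mu rho kappa v w.
Proof. by move=> JI [cv cw dv dw]; split => // x /JI; [exact: dv|exact: dw]. Qed.

(** Square integrability of v and w at infinity, stated as the existence of a
    bounded primitive of an upper bound g of the energy. The slack between the
    energy and g makes the property stable under sums. *)
Definition decays v w := exists (G g : R -> R) (M : R), forall x, 0 < x ->
  [/\ is_derive x 1 G (g x), energy v w x <= g x & G x <= M].

Lemma decaysD v w v' w' : decays v w -> decays v' w' ->
  decays (fun x => v x + v' x) (fun x => w x + w' x).
Proof.
move=> [G [g [M H]]] [G' [g' [M' H']]].
exists (fun x => 2 * G x + 2 * G' x), (fun x => 2 * g x + 2 * g' x), (2 * M + 2 * M') => x x0.
have [dG eg GM] := H x x0; have [dG' eg' GM'] := H' x x0; split.
- by apply: is_derive_eq; rewrite /GRing.scale /=; ring.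
- rewrite /energy in eg eg' *; have := nsqD (v x) (v' x); have := nsqD (w x) (w' x); lra.
- lra.
Qed.

Lemma decaysZ v w c : decays v w -> decays (fun x => c * v x) (fun x => c * w x).
Proof.
move=> [G [g [M H]]].
exists (fun x => nsq c * G x), (fun x => nsq c * g x), (nsq c * M) => x x0.
have [dG eg GM] := H x x0; split.
- by apply: is_derive_eq; rewrite /GRing.scale /=; ring.
- by rewrite /energy !nsqM -mulrDr ler_wpM2l ?nsq_ge0.
- by rewrite ler_wpM2l ?nsq_ge0.
Qed.

Lemma decays_shift v w (r : R) : 0 <= r -> decays v w ->
  decays (fun x => v (r + x)) (fun x => w (r + x)).
Proof.
move=> r0 [G [g [M H]]].
exists (fun x => G (r + x)), (fun x => g (r + x)), M => x x0.
have [dG eg GM] := H (r + x) (ltr_wpDl r0 x0); split => //.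
have := @is_derive1_comp _ G (fun x => r + x) x (g (r + x)) 1 dG.
by rewrite (mulr1 (g _)); apply; apply: is_derive_eq; rewrite add0r mulr1.
Qed.

Lemma flux_derive I mu rho kappa v w x : csol I mu rho kappa v w -> I x ->
  is_derive x 1 (flux v w) (- (rho x * Im kappa * nsq (v x))).
Proof.
move=> [cv cw dv dw] Ix; have H := is_derive_flux (dv x Ix) (dw x Ix).
by apply: is_derive_eq; rewrite /nsq !reim; ring.
Qed.

(** The flux is nonincreasing and at most the energy in modulus. If it were
    negative at a point, the energy would stay above a positive constant from
    there on, and could not have a bounded primitive. *)
Lemma flux_ge0 mu rho kappa v w : csol `]0, +oo[ mu rho kappa v w -> decays v w ->
  (forall x, 0 <= rho x) -> 0 <= Im kappa -> forall x, 0 <= x -> 0 <= flux v w x.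
Proof.
move=> sol [G [g [M H]]] rho0 k0 x0 x00; rewrite leNgt; apply/negP => fx0.
have [cv cw _ _] := sol.
have mono x : x0 <= x -> flux v w x <= flux v w x0.
  move=> x0x; apply: (@nonincreasing_itv _ (flux v w) (fun x => - (rho x * Im kappa * nsq (v x))) x0 x) => //.
  - exact: continuous_flux.
  - move=> y y0 _; apply: (flux_derive sol) => /=; rewrite in_itv/= andbT.
    exact: le_lt_trans y0.
  - by move=> y _ _; rewrite oppr_le0 !mulr_ge0// nsq_ge0.
pose a := - flux v w x0; have a0 : 0 < a by rewrite oppr_gt0.
pose x1 := x0 + 1; have x10 : 0 < x1 by rewrite ltr_wpDl.
(* far enough for an energy of at least a to push G above its bound M *)
pose X := x1 + (`|M - G x1| + 1) / a.
have x1X : x1 < X by rewrite ltrDl divr_gt0// ltr_wpDl.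
have [||y + E] := @MVT_segment _ G g x1 X (ltW x1X).
- by move=> y; rewrite in_itv/= => /andP[y1 _]; have [] := H y (lt_trans x10 y1).
- apply: derivable_within_continuous => y; rewrite in_itv/= => /andP[y1 _].
  by have [[]] := H y (lt_le_trans x10 y1).
rewrite in_itv/= => /andP[y1 y2].
have y0 : 0 < y by exact: lt_le_trans y1.
have [_ eg _] := H y y0; have [_ _ GM] := H X (lt_trans x10 x1X).
have ag : a <= g y.
  apply: le_trans eg; rewrite /a /energy.
  have x0y : x0 <= y by apply: le_trans y1; rewrite /x1 lerDl.
  have := mono y x0y; rewrite /flux /nsq.
  move: (v y) (w y) => [v1 v2] [w1 w2] /= m.
  have := sqr_ge0 (v1 + w2); have := sqr_ge0 (v2 - w1).
  have := sqr_ge0 v1; have := sqr_ge0 v2; have := sqr_ge0 w1; have := sqr_ge0 w2.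
  nra.
have : a * (X - x1) <= g y * (X - x1) by rewrite ler_wpM2r// subr_ge0 ltW.
rewrite -E /X addrAC subrr add0r mulrCA divff ?gt_eqF// mulr1.
have := ler_norm (M - G x1); rewrite -/X; lra.
Qed.

Lemma csol_perturbed L (C0 : R) I mu rho kappa v w : (forall x, 0 < x -> x < L -> I x) ->
  csol I mu rho kappa v w ->
  (forall x, 0 < mu x) -> (forall x, 0 <= rho x) -> 0 <= Im kappa ->
  (forall x, 0 < x -> x < L -> (mu x)^-1 <= C0 /\ (rho x) ^+ 2 * nsq kappa <= C0 ^+ 2) ->
  perturbed L C0 0 (fun x => (mu x)^-1) (fun x => (rho x)%:C * kappa) (fun=> 0) (fun=> 0) v w.
Proof.
move=> locint_on [cv cw dv dw] mu0 rho0 k0 bd; split => // x x0 xL.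
- by rewrite addr0; apply: dv; exact: locint_on.
- by rewrite addr0; apply: dw; exact: locint_on.
- by rewrite ger0_norm ?invr_ge0 ?(ltW (mu0 x))//; have [] := bd x x0 xL.
- rewrite nsqM; have [_] := bd x x0 xL; have -> : nsq (rho x)%:C = rho x ^+ 2.
    by rewrite /nsq !reim; ring.
  by move=> H; split => //; rewrite !reim mul0r addr0 mulr_ge0.
- by rewrite /nsq !reim; split; lra.
Qed.

(** A common bound of 1 / mu and |rho kappa| when c <= mu, 0 <= rho <= rM and
    |kappa|^2 <= k. *)
Definition coef_bound (c rM k : R) : R := c^-1 + rM * (k + 1).

Lemma coef_bound_ge0 (c rM k : R) : 0 < c -> 0 <= rM -> 0 <= k -> 0 <= coef_bound c rM k.
Proof.
move=> c0 rM0 k0; apply: addr_ge0; first by rewrite invr_ge0 ltW.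
by apply: mulr_ge0 => //; lra.
Qed.

Lemma coef_boundP (c rM k m r : R) kappa : 0 < c -> c <= m -> 0 <= r -> r <= rM -> nsq kappa <= k ->
  m^-1 <= coef_bound c rM k /\ r ^+ 2 * nsq kappa <= coef_bound c rM k ^+ 2.
Proof.
move=> c0 cm r0 rrM kk; have q0 := nsq_ge0 kappa; have k0 := le_trans q0 kk.
have rM0 := le_trans r0 rrM.
have ci : 0 <= c^-1 by rewrite invr_ge0 ltW.
have rk : 0 <= rM * (k + 1) by apply: mulr_ge0 => //; lra.
have m0 := lt_le_trans c0 cm.
split.
  by apply: (@le_trans _ _ c^-1); rewrite /coef_bound ?lerDl// lef_pV2// posrE.
apply: (@le_trans _ _ ((rM * (k + 1)) ^+ 2)); last first.
  by rewrite ler_sqr ?nnegrE ?addr_ge0// /coef_bound lerDr.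
rewrite exprMn ler_pM ?sqr_ge0// ?ler_sqr ?nnegrE//; nra.
Qed.

(** The flux at 0 is nonnegative by [flux_ge0] and equals - z |v 0|^2 by the
    Robin condition, so the Cauchy data at 0 vanish. *)
Lemma halfline_unique mu rho kappa v w z (rM c : R) :
  csol `]0, +oo[ mu rho kappa v w -> decays v w ->
  0 < c -> (forall x, c <= mu x) -> (forall x, 0 <= rho x) -> (forall x, rho x <= rM) ->
  0 <= Im kappa -> 0 < z ->
  - w 0 - 'i%C * z%:C * v 0 = 0 ->
  forall x, 0 <= x -> v x = 0 /\ w x = 0.
Proof.
move=> sol dec c0 muc rho0 rhoM k0 z0 rob x x0.
have mu0 y : 0 < mu y by exact: lt_le_trans (muc y).
have fl := flux_ge0 sol dec rho0 k0 (lexx 0).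
have w0 : w 0 = - ('i%C * z%:C * v 0) by apply/eqP; rewrite -subr_eq0 -oppr_eq0 -rob; apply/eqP; ring.
have v0 : nsq (v 0) = 0.
  apply/eqP; rewrite eq_le nsq_ge0 andbT -(pmulr_rle0 _ z0).
  by move: fl; rewrite /flux w0 !reim /nsq; lra.
have vz := nsq_eq0 v0.
have e0 : energy v w 0 = 0.
  by rewrite /energy w0 vz mulr0 oppr0 /nsq !reim; ring.
have rM0 : 0 <= rM by exact: le_trans (rhoM 0).
have C00 : 0 <= coef_bound c rM (nsq kappa) by exact: coef_bound_ge0 (nsq_ge0 _).
have pert : perturbed (x + 1) (coef_bound c rM (nsq kappa)) 0
    (fun x => (mu x)^-1) (fun x => (rho x)%:C * kappa) (fun=> 0) (fun=> 0) v w.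
  apply: (csol_perturbed _ sol) => //.
    by move=> y y0 _ /=; rewrite in_itv/= y0.
  by move=> y _ _; exact: coef_boundP.
have := perturbed_gronwall C00 pert x0; rewrite e0 expr0n addr0 mulr0.
have x1 : x <= x + 1 by rewrite lerDl.
move=> /(_ x1); rewrite /energy => H; have := nsq_ge0 (v x); have := nsq_ge0 (w x) => h1 h2.
by split; apply: nsq_eq0; lra.
Qed.

End HalfLine.

Section HalfLineRepresentative.
Context {R : realType}.
Implicit Types (L z x y t : R) (mu rho : R -> R) (u v w : R -> R[i]) (kappa c : R[i]).

Lemma ae_eq_int I (f g : R -> R) : measurable I -> measurable_fun I f -> measurable_fun I g ->
  (\forall x \ae (@lebesgue_measure R), I x -> f x = g x) ->
  (\int[leb]_(x in I) (f x)%:E = \int[leb]_(x in I) (g x)%:E)%E.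
Proof.
move=> mI mf mg fg; apply: ae_eq_integral => //; try exact/measurable_EFinP.
by apply: ae_mono fg => x /= H Ix; rewrite H.
Qed.

Lemma continuous_nsq v : ccont v -> continuous (fun x => nsq (v x)).
Proof. by move=> [? ?]; rewrite /nsq; cont. Qed.

(** The bound on mu is what makes w = mu g square integrable. *)
Lemma int_energy I mu (M : R) u g v w : open I -> continuous mu -> (forall x, 0 <= mu x) ->
  (forall x, mu x <= M) -> inL2 (fun=> 1) I u -> inL2 (fun=> 1) I g -> ccont v -> ccont w ->
  ae_eq_on I v u -> ae_eq_on I w (fun x => (mu x)%:C * g x) ->
  leb.-integrable I (EFin \o energy v w).
Proof.
move=> oI cmu mu0 muM /inL2P[mu_u ui] /inL2P[mu_g gi] cv cw vu wg.
have mI : measurable I by exact: open_measurable.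
have cmu2 : continuous (fun x => mu x ^+ 2) by cont.
have mv : measurable_fun I (fun x => nsq (v x)).
  apply: measurable_funTS; apply: continuous_measurable_fun.
  exact: continuous_nsq.
have mw : measurable_fun I (fun x => nsq (w x)).
  apply: measurable_funTS; apply: continuous_measurable_fun.
  exact: continuous_nsq.
have mun := measurable_nsq mu_u; have mgn := measurable_nsq mu_g.
have n0 (f : R -> R[i]) x : (0 <= (nsq (f x))%:E)%E by rewrite lee_fin nsq_ge0.
have iv : (\int[leb]_(x in I) (nsq (v x))%:E < +oo)%E.
  rewrite (@ae_eq_int I _ (fun x => nsq (u x)))//.
  by apply: ae_mono vu => x /= H Ix; rewrite H.
have iw : (\int[leb]_(x in I) (nsq (w x))%:E < +oo)%E.
  rewrite (@ae_eq_int I _ (fun x => mu x ^+ 2 * nsq (g x)))//.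
  - apply: (@le_lt_trans _ _ (\int[leb]_(x in I) ((M ^+ 2)%:E * (nsq (g x))%:E))%E).
      apply: ge0_le_integral => //.
      + by move=> x _; rewrite lee_fin mulr_ge0 ?sqr_ge0 ?nsq_ge0.
      + apply/measurable_EFinP; apply: measurable_funM => //; apply: measurable_funTS.
        exact: continuous_measurable_fun.
      + by apply/measurable_EFinP; apply: measurable_funM.
      + move=> x _; rewrite -EFinM lee_fin ler_wpM2r ?nsq_ge0// ler_sqr ?nnegrE//.
        exact: le_trans (mu0 x) _.
    rewrite ge0_integralZl//; [|by apply/measurable_EFinP|by rewrite lee_fin sqr_ge0].
    by rewrite lte_mul_pinfty// lee_fin sqr_ge0.
  - apply: measurable_funM => //; apply: measurable_funTS.
    exact: continuous_measurable_fun.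
  - apply: ae_mono wg => x /= H Ix; rewrite H// nsqM; congr (_ * _).
    by rewrite /nsq !reim; ring.
have iv' : leb.-integrable I (EFin \o (fun x => nsq (v x))).
  apply/integrableP; split; first exact/measurable_EFinP.
  rewrite (_ : (\int[leb]_(x in I) _)%E = (\int[leb]_(x in I) (nsq (v x))%:E)%E)//.
  by apply: eq_integral => x _ /=; rewrite ger0_norm ?nsq_ge0.
have iw' : leb.-integrable I (EFin \o (fun x => nsq (w x))).
  apply/integrableP; split; first exact/measurable_EFinP.
  rewrite (_ : (\int[leb]_(x in I) _)%E = (\int[leb]_(x in I) (nsq (w x))%:E)%E)//.
  by apply: eq_integral => x _ /=; rewrite ger0_norm ?nsq_ge0.
by have := integrableD _ iv' iw'; apply.
Qed.

(** Membership in H1 bounds the integral of the energy, which gives the decay. *)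
Lemma weak_sol_halfline (a : R) mu rho kappa u (M : R) : continuous mu -> continuous rho ->
  (forall x, 0 < mu x) -> (forall x, mu x <= M) ->
  weak_sol `]a, +oo[ mu rho kappa u ->
  exists v w, [/\ csol `]a, +oo[ mu rho kappa v w, ae_eq_on `]a, +oo[ v u,
    ae_eq_on `]a, +oo[ w (fun x => (mu x)%:C * wderiv `]a, +oo[ u x) &
    decays (fun x => v (a + x)) (fun x => w (a + x))].
Proof.
move=> cmu crho mu0 muM sol.
have oI : open (`]a, +oo[%classic : set R) by exact: interval_open.
have iI : is_interval (`]a, +oo[%classic : set R) by exact: interval_is_interval.
have I0 : (`]a, +oo[%classic : set R) !=set0.
  by exists (a + 1); rewrite /= in_itv/= andbT ltrDl.
have Ia : `]a, +oo[%classic `<=` [set x | a < x].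
  by move=> x /=; rewrite in_itv/= andbT.
have [v [w [cs vu wu]]] := weak_sol_rep oI iI I0 Ia cmu crho mu0 sol.
exists v, w; split => //.
have [cv cw _ _] := cs; have [[uL2 _ gL2] _] := sol.
have ei := int_energy oI cmu (fun x => ltW (mu0 x)) muM uL2 gL2 cv cw vu wu.
have ce := continuous_energy cv cw.
exists (fun x => (\int[leb]_(t in `[a, a + x]) energy v w t)%R),
  (fun x => energy v w (a + x)), (\int[leb]_(t in `]a, +oo[) energy v w t)%R => x x0.
have iab y : leb.-integrable `[a, y] (EFin \o energy v w).
  by apply: continuous_compact_integrable; [exact: segment_compact|exact: continuous_subspaceT].
split => //.
- have ax : a < a + x by rewrite ltrDl.
  have x1 : a + x < a + x + 1 by rewrite ltrDl.
  have [d1 d2] := continuous_FTC1_closed x1 (iab _) ax (ce (a + x)).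
  set G := (fun y : R => _) in d1 d2.
  have dG : is_derive (a + x) 1 G (energy v w (a + x)).
    by rewrite -d2 derive1E; exact/derivableP.
  have := @is_derive1_comp _ G (fun x => a + x) x _ 1 dG.
  by rewrite (mulr1 (energy _ _ _)); apply; apply: is_derive_eq; rewrite add0r mulr1.
- rewrite -Rintegral_itv_obnd_cbnd; last first.
    by apply: integrableS (iab _) => //; exact: subset_itv_oc_cc.
  rewrite /Rintegral fine_le//.
  + apply: integrable_fin_num => //; apply: integrableS (iab (a + x)) => //.
    exact: subset_itv_oc_cc.
  + exact: integrable_fin_num.
  + apply: ge0_subset_integral => //.
    * by case/integrableP : ei.
    * by move=> y _; rewrite lee_fin energy_ge0.
    * by move=> y /=; rewrite !in_itv/= andbT => /andP[].
Qed.

End HalfLineRepresentative.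

(** * Coefficients along a line of the periodic medium *)

Section PeriodicCoefficients.
Context {R : realType}.
Implicit Types (f : R -> R -> R) (x y : R).

Lemma periodic_int (f : R -> R) (n : int) x : (forall x, f (x + 1) = f x) ->
  f (x + n%:~R) = f x.
Proof.
move=> f1.
have fn (m : nat) y : f (y + m%:R) = f y.
  elim: m y => [|m IH] y; first by rewrite addr0.
  by rewrite -natr1 addrA f1 IH.
case: n => m; first exact: fn.
rewrite NegzE mulrNz /intmul.
by rewrite -[in RHS](subrK (m.+1%:R) x) fn.
Qed.

Lemma admissible_bounds f : admissible_coef f ->
  exists c M : R, [/\ 0 < c, forall x y, c <= f x y & forall x y, f x y <= M].
Proof.
move=> [cf f1 f2 [c c0 fc]].
pose F (p : R * R) := f p.1 p.2.
have cK : compact (`[0, 1]%classic `*` `[0, 1]%classic : set (R * R)).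
  by apply: compact_setX; exact: segment_compact.
have : compact (F @` (`[0, 1]%classic `*` `[0, 1]%classic)).
  by apply: continuous_compact => //; apply: continuous_subspaceT.
move=> /compact_bounded [M0 [_ HM]].
exists c, (M0 + 1); split => // x y.
have -> : f x y = f (x - (Num.floor x)%:~R) (y - (Num.floor y)%:~R).
  rewrite -mulrNz (periodic_int (f := fun x => f x _)) //.
  by rewrite -mulrNz (periodic_int (f := f x)).
apply: le_trans (ler_norm _) _.
apply: (HM (M0 + 1)); first by rewrite ltrDl.
exists (x - (Num.floor x)%:~R, y - (Num.floor y)%:~R) => //.
have fr (t : R) : `[0, 1]%classic (t - (Num.floor t)%:~R).
  rewrite /= in_itv/= subr_ge0 ge_floor/= lerBlDl addrC ltW//.
  by have := floorD1_gt t; rewrite intrD addrC.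
by split; exact: fr.
Qed.

End PeriodicCoefficients.

Section MediumCoefficients.
Context {R : realType}.
Implicit Types (S : medium R) (s x y t : R).

Definition period S : R := (theta2 S)^-1.

Definition line_coef (f : R -> R -> R) (t1 t2 s x : R) : R := f (s + t1 * x) (t2 * x).

Lemma line_coef_continuous2 (f : R -> R -> R) (t1 t2 : R) : continuous (fun p : R * R => f p.1 p.2) ->
  continuous (fun p : R * R => line_coef f t1 t2 p.1 p.2).
Proof.
move=> cf p.
have c1 : (q.1 + t1 * q.2) @[q --> p] --> p.1 + t1 * p.2.
  by apply: cvgD; [exact: cvg_fst|apply: cvgM; [exact: cvg_cst|exact: cvg_snd]].
have c2 : (t2 * q.2) @[q --> p] --> t2 * p.2.
  by apply: cvgM; [exact: cvg_cst|exact: cvg_snd].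
have := @continuous_comp _ _ _ (fun q : R * R => (q.1 + t1 * q.2, t2 * q.2)) (fun p : R * R => f p.1 p.2) p.
by apply; [exact: (cvg_pair c1 c2)|exact: cf].
Qed.

Lemma line_coef_continuous (f : R -> R -> R) (t1 t2 s : R) : continuous (fun p : R * R => f p.1 p.2) ->
  continuous (line_coef f t1 t2 s).
Proof.
move=> cf x.
have c1 : (fun _ : R => s) @ x --> s by exact: cvg_cst.
have c2 : (fun y : R => y) @ x --> x by exact: cvg_id.
have := @continuous_comp _ _ _ (fun y : R => (s, y)) (fun p : R * R => line_coef f t1 t2 p.1 p.2) x.
by apply; [exact: (cvg_pair c1 c2)|exact: line_coef_continuous2].
Qed.

Lemma line_coef_unif (f : R -> R -> R) (t1 t2 s l e : R) : continuous (fun p : R * R => f p.1 p.2) ->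
  0 < e -> \forall s' \near s, forall x, 0 <= x -> x <= l ->
    `|line_coef f t1 t2 s' x - line_coef f t1 t2 s x| <= e.
Proof.
move=> cf e0.
have := @segment_compact R 0 l; rewrite compact_near_coveringP.
move=> /(_ _ (nbhs s) (fun s' x => `|line_coef f t1 t2 s' x - line_coef f t1 t2 s x| <= e)) H.
suff : \forall s' \near s, `[0, l]%classic `<=` [set x | `|line_coef f t1 t2 s' x - line_coef f t1 t2 s x| <= e].
  by apply: filterS => s' K x x0 xl; apply: K => /=; rewrite in_itv/= x0.
apply: H => x _.
have e20 : 0 < e / 2 by rewrite divr_gt0.
have /cvgrPdist_le /(_ _ e20) := @line_coef_continuous2 f t1 t2 cf (s, x : R).
move=> [[A B] /= [As Bx] AB].
exists (B, A) => //= -[x' s'] /= [Bx' As'].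
have Ass : A s by exact: nbhs_singleton.
have h1 := AB (s', x') (conj As' Bx'); have h2 := AB (s, x') (conj Ass Bx').
rewrite /= in h1 h2; rewrite distrC in h1.
have -> : line_coef f t1 t2 s' x' - line_coef f t1 t2 s x' =
  (line_coef f t1 t2 s' x' - line_coef f t1 t2 s x) + (line_coef f t1 t2 s x - line_coef f t1 t2 s x') by ring.
by rewrite (le_trans (ler_normD _ _))// [leRHS]splitr lerD.
Qed.

Lemma line_coef_shift f S s x : 0 < theta2 S -> (forall x y, f x (y + 1) = f x y) ->
  line_coef f (theta1 S) (theta2 S) s (period S + x) =
  line_coef f (theta1 S) (theta2 S) (s + delta S) x.
Proof.
move=> t0 f2; rewrite /line_coef /period /delta.
have -> : theta2 S * ((theta2 S)^-1 + x) = theta2 S * x + 1 by field; rewrite gt_eqF.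
by rewrite f2 mulrDr addrA.
Qed.

Lemma line_coef_int f S a x : a * theta2 S \is a Num.int -> (forall x y, f x (y + 1) = f x y) ->
  line_coef f (theta1 S) (theta2 S) 0 (a + x) =
  line_coef f (theta1 S) (theta2 S) (a * theta1 S) x.
Proof.
move=> /intrP[n an] f2; rewrite /line_coef.
have -> : theta2 S * (a + x) = theta2 S * x + n%:~R by rewrite -an; ring.
rewrite (periodic_int (f := f _))//; congr f; ring.
Qed.

Lemma line_coef_per f S s x : (forall x y, f (x + 1) y = f x y) ->
  line_coef f (theta1 S) (theta2 S) (s + 1) x = line_coef f (theta1 S) (theta2 S) s x.
Proof. by move=> f1; rewrite /line_coef addrAC f1. Qed.

Record coef_bounds S (c rM mM : R) : Prop := {
  cb_c0 : 0 < c;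
  cb_muc : forall s x, c <= mu_ S s x;
  cb_mu0 : forall s x, 0 < mu_ S s x;
  cb_muM : forall s x, mu_ S s x <= mM;
  cb_rho0 : forall s x, 0 <= rho_ S s x;
  cb_rhoM : forall s x, rho_ S s x <= rM }.

Lemma standing_bounds S : standing_assumptions S -> exists c rM mM, coef_bounds S c rM mM.
Proof.
move=> hS; have [c [mM [c0 muc muM]]] := admissible_bounds (mup_admissible hS).
have [c' [rM [c'0 rhoc rhoM]]] := admissible_bounds (rhop_admissible hS).
exists c, rM, mM; split => // s x.
- exact: muc.
- exact: lt_le_trans c0 (muc _ _).
- exact: muM.
- exact: le_trans (ltW c'0) (rhoc _ _).
- exact: rhoM.
Qed.

Lemma standing_cont S : standing_assumptions S ->
  (forall s, continuous (mu_ S s)) /\ (forall s, continuous (rho_ S s)).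
Proof.
move=> hS; have [cm _ _ _] := mup_admissible hS; have [cr _ _ _] := rhop_admissible hS.
by split => s; exact: line_coef_continuous.
Qed.

(** A period in the second variable of the medium moves the starting point on
    the first axis by delta: this is where the rotation comes from. *)
Lemma standing_shift S : standing_assumptions S -> forall s,
  (fun x => mu_ S s (period S + x)) = mu_ S (s + delta S) /\
  (fun x => rho_ S s (period S + x)) = rho_ S (s + delta S).
Proof.
move=> hS s; have [_ _ m2 _] := mup_admissible hS; have [_ _ r2 _] := rhop_admissible hS.
have t0 := theta2_gt0 hS.
by split; apply/funext => x; exact: line_coef_shift.
Qed.

Lemma standing_int S a : standing_assumptions S -> a * theta2 S \is a Num.int ->
  (fun x => mu_ S 0 (a + x)) = mu_ S (a * theta1 S) /\
  (fun x => rho_ S 0 (a + x)) = rho_ S (a * theta1 S).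
Proof.
move=> hS ha; have [_ _ m2 _] := mup_admissible hS; have [_ _ r2 _] := rhop_admissible hS.
by split; apply/funext => x; exact: line_coef_int.
Qed.

Lemma standing_per S : standing_assumptions S -> forall s,
  mu_ S (s + 1) = mu_ S s /\ rho_ S (s + 1) = rho_ S s.
Proof.
move=> hS s; have [_ m1 _ _] := mup_admissible hS; have [_ r1 _ _] := rhop_admissible hS.
by split; apply/funext => x; exact: line_coef_per.
Qed.

Lemma standing_unif S l e s : standing_assumptions S -> 0 < e ->
  \forall s' \near s, forall x, 0 <= x -> x <= l ->
    `|mu_ S s' x - mu_ S s x| <= e /\ `|rho_ S s' x - rho_ S s x| <= e.
Proof.
move=> hS e0; have [cm _ _ _] := mup_admissible hS; have [cr _ _ _] := rhop_admissible hS.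
have := @line_coef_unif _ (theta1 S) (theta2 S) s l e cm e0.
have := @line_coef_unif _ (theta1 S) (theta2 S) s l e cr e0.
by apply: filterS2 => s' h1 h2 x x0 xl; split; [exact: h2|exact: h1].
Qed.

End MediumCoefficients.

(** * Irrational rotations *)

Section Rotation.
Context {R : realType}.
Implicit Types (F : R -> R) (s t d r : R).

(** The periods of F form a subgroup of the real line. If it has arbitrarily
    small positive elements, F is constant by continuity; otherwise it is
    generated by its least positive element m, and 1 and d are integer
    multiples of m, so that d is rational. *)
Lemma irrational_rotation F d : irrational d -> continuous F ->
  (forall s, F (s + 1) = F s) -> (forall s, F (s + d) = F s) ->
  forall s t, F s = F t.
Proof.
move=> irr cF F1 Fd.
(* the group of periods of F; m below is the infimum of its positive elements *)
pose G := [set g : R | forall s, F (s + g) = F s].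
have GD g h : G g -> G h -> G (g + h) by move=> Gg Gh s; rewrite addrA Gh Gg.
have GN g : G g -> G (- g) by move=> Gg s; rewrite -(Gg (s - g)) subrK.
have GMn g (n : nat) : G g -> G (g *+ n).
  move=> Gg; elim: n => [|n IH]; first by move=> s; rewrite addr0.
  by rewrite mulrS; exact: GD.
have GMz g (n : int) : G g -> G (g *~ n).
  by move=> Gg; case: n => n; [exact: GMn|rewrite NegzE mulrNz; apply/GN/GMn].
pose P := [set g : R | G g /\ 0 < g].
have P1 : P 1 by split.
have infP : has_inf P by split; [exists 1|exists 0 => g [_ /ltW]].
pose m := inf P.
have m0 : 0 <= m by apply: lb_le_inf; [exists 1|move=> g [_ /ltW]].
have small (e : R) : 0 < e -> exists g, [/\ G g, m <= g & g < m + e].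
  move=> e0; have [g [Gg g0] gm] := inf_adherent e0 infP.
  by exists g; split => //; apply: ge_inf => //; exact: infP.2.
have [mz|mnz] := eqVneq m 0.
  have dense s t : F s = F t.
    apply/eqP; rewrite -subr_eq0 -normr_le0; apply/ler_addgt0Pr => e e0; rewrite add0r.
    have /cvgrPdist_le /(_ _ e0) [r /= r0 rF] := cF s.
    have [g [Gg g0 gr]] : exists g, [/\ G g, 0 < g & g < r].
      have [g [Gg g0] gm] := inf_adherent r0 infP.
      by exists g; split => //; rewrite -[r]add0r -mz.
    pose n := Num.floor ((s - t) / g).
    have -> : F t = F (t + g *~ n) by rewrite GMz.
    apply: rF => /=.
    have n1 : n%:~R <= (s - t) / g by exact: ge_floor.
    have n2 : (s - t) / g < n%:~R + 1 by have := floorD1_gt ((s - t) / g); rewrite intrD.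
    rewrite ler_pdivlMr// in n1; rewrite ltr_pdivrMr// in n2.
    by rewrite -mulrzl ger0_norm; lra.
  exact: dense.
have {mnz}m0' : 0 < m by rewrite lt0r mnz.
have Pm g : G g -> 0 < g -> m <= g by move=> Gg g0; apply: ge_inf => //; exact: infP.2.
have Gm : G m.
  have [g [Gg mg gm]] := small m m0'.
  move: mg; rewrite le_eqVlt => /predU1P[->//|mg].
  have [h [Gh mh hg]] : exists h, [/\ G h, m <= h & h < m + (g - m)].
    by apply: small; rewrite subr_gt0.
  have := Pm (g - h) (GD _ _ Gg (GN _ Gh)).
  by rewrite subr_gt0 => /(_ _); lra.
have mult g : G g -> exists n : int, g = n%:~R * m.
  move=> Gg; pose n := Num.floor (g / m).
  exists n; apply/eqP; rewrite -subr_eq0; apply/eqP.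
  have n1 : n%:~R <= g / m by exact: ge_floor.
  have n2 : g / m < n%:~R + 1 by have := floorD1_gt (g / m); rewrite intrD.
  rewrite ler_pdivlMr// in n1; rewrite ltr_pdivrMr// in n2.
  have Gr : G (g - n%:~R * m) by rewrite mulrzl; apply: GD => //; apply/GN/GMz.
  have : 0 <= g - n%:~R * m by rewrite subr_ge0.
  rewrite le_eqVlt => /predU1P[//|r0].
  by have := Pm _ Gr r0; lra.
have [k kE] := mult 1 (fun s => F1 s); have [l lE] := mult d Fd.
exfalso; apply: irr => /=.
have k0 : k%:~R != 0 :> R by apply/eqP => k0; move: kE; rewrite k0 mul0r => /eqP; rewrite oner_eq0.
exists (l%:Q / k%:Q) => //.
rewrite fmorph_div/= !ratr_int lE.
have -> : m = k%:~R^-1 by rewrite -[LHS](mulKf k0) -kE mulr1.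
by [].
Qed.

(** At a maximum c of F, F c = r F (c + d) <= r F c, so r = 1. Then F is
    invariant under the rotation by d, hence constant. *)
Lemma rotation_pos F d r : irrational d -> continuous F -> (forall s, F (s + 1) = F s) ->
  (forall s, 0 <= F s) -> 0 <= r -> r <= 1 -> (forall s, F s = r * F (s + d)) ->
  (exists s, F s != 0) -> forall s, 0 < F s.
Proof.
move=> irr cF F1 F0 r0 r1 Fr [s0 Fs0] s.
have Fs0' : 0 < F s0 by rewrite lt0r Fs0 F0.
have [||c c01 cmax] := @EVT_max _ F 0 1; [exact: ler01|exact: continuous_subspaceT|].
have M t : F t <= F c.
  have -> : F t = F (t - (Num.floor t)%:~R) by rewrite -mulrNz periodic_int.
  apply: cmax; rewrite in_itv/= subr_ge0 ge_floor/= lerBlDl addrC ltW//.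
  by have := floorD1_gt t; rewrite intrD addrC.
have Fc : 0 < F c by apply: lt_le_trans Fs0' (M _).
have rE : r = 1.
  apply/eqP; rewrite eq_le r1/= -(ler_pM2r Fc) mul1r {1}(Fr c).
  by rewrite ler_wpM2l.
have Fd t : F (t + d) = F t by rewrite [RHS]Fr rE mul1r.
by rewrite (irrational_rotation irr cF F1 Fd s s0).
Qed.

End Rotation.

(** * Robin traces of solutions *)

Section Solutions.
Context {R : realType} (S : medium R) (hS : standing_assumptions S).
Context (c rM mM : R) (cb : coef_bounds S c rM mM).
Implicit Types (s x y t e : R) (u v w : R -> R[i]) (a b : R[i]) (I : set R).

Local Notation L := (period S).
Local Notation z := (zimp S).
Local Notation d := (delta S).

Lemma period_gt0 : 0 < L.
Proof. by rewrite invr_gt0; exact: theta2_gt0. Qed.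

(** The traces of the operators R^r_+ and R^r_- on the solution represented by
    (v, w), where w stands for mu v'. *)
Definition Rplus v w x : R[i] := - w x - 'i%C * z%:C * v x.
Definition Rminus v w x : R[i] := w x - 'i%C * z%:C * v x.

Lemma robin_rep I s u v w x : open I -> closure I x -> ccont v -> ccont w ->
  ae_eq_on I v u -> ae_eq_on I w (fun y => (mu_ S s y)%:C * wderiv I u y) ->
  robinP S Right I s u x = Rplus v w x /\ robinM S Right I s u x = Rminus v w x.
Proof.
move=> oI cx cv cw vu wu; rewrite /robinP /robinM /robin (crepE oI cv vu cx) (crepE oI cw wu cx).
rewrite /Rplus /Rminus /orient; split; last by rewrite mul1r.
by rewrite [(-1)%:C](_ : _ = -1) ?mulN1r//; apply: complex_eq; rewrite !reim ?oppr0.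
Qed.

Lemma closure_halfline (a x : R) : a <= x -> closure `]a, +oo[%classic x.
Proof.
move=> ax B [r /= r0 rB]; exists (x + r / 2); split => /=.
  by rewrite in_itv/= andbT; apply: le_lt_trans ax _; rewrite ltrDl divr_gt0.
apply: rB => /=; rewrite opprD addrA subrr sub0r normrN gtr0_norm ?divr_gt0//.
by rewrite ltr_pdivrMr// mulr_natr mulr2n ltrDl.
Qed.

Lemma closure_cell x : 0 <= x -> x <= L -> closure `]0, L[%classic x.
Proof.
move=> x0 xL B [r /= r0 rB]; have L0 := period_gt0.
pose m := Num.min (r / 2) (L / 4).
have m0 : 0 < m by rewrite lt_min !divr_gt0.
have mr : m < r by rewrite gt_min ltr_pdivrMr// mulr_natr mulr2n ltrDl r0.
have mL : m <= L / 4 by rewrite ge_min lexx orbT.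
have [xl|xl] := leP x (L / 2).
  exists (x + m); split => /=; first by rewrite in_itv/=; apply/andP; split; lra.
  by apply: rB => /=; rewrite opprD addrA subrr sub0r normrN gtr0_norm.
exists (x - m); split => /=; first by rewrite in_itv/=; apply/andP; split; lra.
by apply: rB => /=; rewrite opprB addrCA subrr addr0 gtr0_norm.
Qed.

Definition hsol e s v w := csol `]0, +oo[ (mu_ S s) (rho_ S s) (omega S ^+ 2 +i* e) v w /\ decays v w.

Definition cellsol s v w := csol `]0, L[ (mu_ S s) (rho_ S s) ((omega S ^+ 2)%:C) v w.

Lemma fundamental_rep e s u : is_fundamental S Right e s u ->
  exists v w, [/\ hsol e s v w, Rplus v w 0 = 1,
   robinP S Right (halfline Right) s u L = Rplus v w L &
   robinM S Right (halfline Right) s u L = Rminus v w L].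
Proof.
move=> [sol rob]; have [cm cr] := standing_cont hS.
have [v [w [cs vu wu dec]]] := weak_sol_halfline (cm s) (cr s) (cb_mu0 cb s) (cb_muM cb s) sol.
have oI : open (`]0, +oo[%classic : set R) by exact: interval_open.
have [cv cw _ _] := cs.
have rep x (x0 : 0 <= x) := robin_rep oI (closure_halfline x0) cv cw vu wu.
exists v, w; split.
- split => //; have := dec; congr decays; apply/funext => x; by rewrite add0r.
- by rewrite -rob /= (rep 0 (lexx _)).1.
- by rewrite /= (rep L (ltW period_gt0)).1.
- by rewrite /= (rep L (ltW period_gt0)).2.
Qed.

Lemma cell_rep b0 b1 s u : is_cell_fun S Right b0 b1 s u ->
  exists v w, [/\ cellsol s v w, Rplus v w 0 = b0, Rminus v w L = b1, ae_eq_on `]0, L[ v u &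
   robinM S Right (cell S Right) s u 0 = Rminus v w 0].
Proof.
move=> [sol rob0 rob1]; have [cm cr] := standing_cont hS; have L0 := period_gt0.
have oI : open (`]0, L[%classic : set R) by exact: interval_open.
have iI : is_interval (`]0, L[%classic : set R) by exact: interval_is_interval.
have I0 : (`]0, L[%classic : set R) !=set0.
  by exists (L / 2); rewrite /= in_itv/=; apply/andP; split; lra.
have Ia : `]0, L[%classic `<=` [set x | 0 < x].
  by move=> x /=; rewrite in_itv/= => /andP[].
have [v [w [cs vu wu]]] := weak_sol_rep oI iI I0 Ia (cm s) (cr s) (cb_mu0 cb s) sol.
have [cv cw _ _] := cs.
have rep x (x0 : 0 <= x) (xL : x <= L) := robin_rep oI (closure_cell x0 xL) cv cw vu wu.
exists v, w; split => //.
- by rewrite -rob0 /= (rep 0 (lexx _) (ltW L0)).1.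
- rewrite -rob1 /cell_end /orient mul1r -[(theta2 S)^-1]/L.
  by rewrite (rep L (ltW L0) (lexx _)).2.
- by rewrite (rep 0 (lexx _) (ltW L0)).2.
Qed.

Lemma halfline_sol_rep (al : R) e u : al * theta2 S \is a Num.int -> is_halfline_sol S al e u ->
  exists v w, [/\ hsol e (al * theta1 S) (fun x => v (al + x)) (fun x => w (al + x)),
   csol `]al, +oo[ (mu_ S 0) (rho_ S 0) (omega S ^+ 2 +i* e) v w,
   Rplus (fun x => v (al + x)) (fun x => w (al + x)) 0 = 1,
   ae_eq_on `]al, +oo[ v u &
   Lambda S al u = Rminus v w al].
Proof.
move=> hal [sol rob]; have [cm cr] := standing_cont hS.
have [v [w [cs vu wu dec]]] := weak_sol_halfline (cm 0) (cr 0) (cb_mu0 cb 0) (cb_muM cb 0) sol.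
have oI : open (`]al, +oo[%classic : set R) by exact: interval_open.
have [cv cw _ _] := cs.
have [r1 r2] := robin_rep oI (closure_halfline (lexx al)) cv cw vu wu.
exists v, w; split => //.
- split => //; have [<- <-] := standing_int hS hal.
  by apply: (csol_shift cs) => x /=; rewrite !in_itv/= !andbT ltrDl.
- by rewrite -rob r1 /Rplus addr0.
Qed.

Lemma hsolB e s v w v' w' a : hsol e s v w -> hsol e s v' w' ->
  hsol e s (fun x => v x - a * v' x) (fun x => w x - a * w' x).
Proof.
move=> [s1 d1] [s2 d2]; split.
  have := csolD s1 (csolZ (- a) s2); congr csol; apply/funext => x; by rewrite mulNr.
have := decaysD d1 (decaysZ (- a) d2); congr decays; apply/funext => x; by rewrite mulNr.
Qed.

(** The difference v - a v' decays and has a zero Robin trace at 0. *)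
Lemma hsol_unique e s v w v' w' a : 0 < e -> hsol e s v w -> hsol e s v' w' ->
  Rplus v w 0 = a * Rplus v' w' 0 ->
  forall x, 0 <= x -> v x = a * v' x /\ w x = a * w' x.
Proof.
move=> e0 h h' R0 x x0; have [sol dec] := hsolB a h h'.
have [||] := halfline_unique sol dec (cb_c0 cb) (cb_muc cb s) (cb_rho0 cb s) (cb_rhoM cb s) _ (zimp_gt0 hS) _ x0.
- exact: ltW.
- transitivity (Rplus v w 0 - a * Rplus v' w' 0); last by rewrite R0 subrr.
  by rewrite /Rplus; ring.
by move=> /eqP + /eqP; rewrite !subr_eq0 => /eqP -> /eqP ->.
Qed.

Lemma hsol_shift e s v w : hsol e s v w ->
  hsol e (s + d) (fun x => v (L + x)) (fun x => w (L + x)).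
Proof.
move=> [sol dec]; have L0 := period_gt0; split; last exact: decays_shift (ltW L0) dec.
have [<- <-] := standing_shift hS s.
by apply: (csol_shift sol) => x /=; rewrite !in_itv/= !andbT => x0; exact: addr_gt0.
Qed.

End Solutions.

(** * Continuity of the cell problem *)

Section CellStability.
Context {R : realType} (S : medium R) (hS : standing_assumptions S).
Context (c rM mM : R) (cb : coef_bounds S c rM mM).
Implicit Types (s x y t e eta : R) (v w : R -> R[i]) (I : set R).

Local Notation L := (period S).
Local Notation z := (zimp S).
Local Notation d := (delta S).
Local Notation cellI := (`]0, period S[%classic).

Lemma coef_rM_ge0 : 0 <= rM.
Proof. exact: le_trans (cb_rho0 cb 0 0) (cb_rhoM cb 0 0). Qed.

(** The difference of two solutions satisfies the equation of the first, with
    sources proportional to the difference of the coefficients. *)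
Lemma cell_stability (k : R) : 0 <= k -> exists2 C : R, 0 < C &
  forall s1 s2 (k1 k2 : R[i]) v1 w1 v2 w2 eta,
  csol cellI (mu_ S s1) (rho_ S s1) k1 v1 w1 -> csol cellI (mu_ S s2) (rho_ S s2) k2 v2 w2 ->
  0 <= Im k1 -> nsq k1 <= k ->
  (forall x, 0 < x -> x < L ->
     nsq ((((mu_ S s1 x)^-1)%:C - ((mu_ S s2 x)^-1)%:C) * w2 x) <= eta ^+ 2 /\
     nsq (((rho_ S s2 x)%:C * k2 - (rho_ S s1 x)%:C * k1) * v2 x) <= eta ^+ 2) ->
  forall x, 0 <= x -> x <= L ->
  energy (fun x => v1 x - v2 x) (fun x => w1 x - w2 x) x <=
  C * (nsq (Rplus S v1 w1 0 - Rplus S v2 w2 0) + nsq (Rminus S v1 w1 L - Rminus S v2 w2 L) + eta ^+ 2).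
Proof.
move=> k0; have C00 := coef_bound_ge0 (cb_c0 cb) coef_rM_ge0 k0.
have [C C0 HC] := robin_stability (period_gt0 hS) C00 (zimp_gt0 hS).
exists C => // s1 s2 k1 k2 v1 w1 v2 w2 eta [cv1 cw1 dv1 dw1] [cv2 cw2 dv2 dw2] ik1 nk1 gh.
have inI x : 0 < x -> x < L -> cellI x by move=> x0 xL; rewrite /= in_itv/= x0.
apply: (HC eta (fun x => (mu_ S s1 x)^-1) (fun x => (rho_ S s1 x)%:C * k1)
  (fun x => (((mu_ S s1 x)^-1)%:C - ((mu_ S s2 x)^-1)%:C) * w2 x)
  (fun x => ((rho_ S s2 x)%:C * k2 - (rho_ S s1 x)%:C * k1) * v2 x)); last 2 first.
- by rewrite /Rplus; ring.
- by rewrite /Rminus; ring.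
split.
- exact: ccontB.
- exact: ccontB.
- move=> x x0 xL; have Ix := inI x x0 xL.
  have := cderiveB (dv1 x Ix) (dv2 x Ix); congr cderive; ring.
- move=> x x0 xL; have Ix := inI x x0 xL.
  have := cderiveB (dw1 x Ix) (dw2 x Ix); congr cderive; ring.
- move=> x x0 xL; rewrite ger0_norm ?invr_ge0 ?(ltW (cb_mu0 cb s1 x))//.
  exact: (coef_boundP (cb_c0 cb) (cb_muc cb s1 x) (cb_rho0 cb s1 x) (cb_rhoM cb s1 x) nk1).1.
- move=> x x0 xL; split; last by rewrite !reim mul0r addr0 mulr_ge0// (cb_rho0 cb).
  rewrite nsqM [nsq _%:C](_ : _ = rho_ S s1 x ^+ 2); last by rewrite /nsq !reim; ring.
  exact: (coef_boundP (cb_c0 cb) (cb_muc cb s1 x) (cb_rho0 cb s1 x) (cb_rhoM cb s1 x) nk1).2.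
- exact: gh.
Qed.

Lemma cell_unique s v w v' w' : cellsol S s v w -> cellsol S s v' w' ->
  Rplus S v w 0 = Rplus S v' w' 0 -> Rminus S v w L = Rminus S v' w' L ->
  forall x, 0 <= x -> x <= L -> v x = v' x /\ w x = w' x.
Proof.
move=> sol sol' R0 RL x x0 xL.
have [C C0 HC] := cell_stability (nsq_ge0 (omega S ^+ 2)%:C).
have := HC s s _ _ v w v' w' 0 sol sol' (lexx _) (lexx _) _ x x0 xL.
have n0 : nsq (0 : R[i]) = 0 by rewrite /nsq !reim; ring.
rewrite R0 RL !subrr n0 expr0n /= !addr0 mulr0 => /(_ _)/wrap[].
  by move=> y _ _; rewrite !subrr !mul0r n0.
have := nsq_ge0 (v x - v' x); have := nsq_ge0 (w x - w' x); rewrite /energy => h1 h2 h3.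
split; apply/eqP; rewrite -subr_eq0; apply/eqP; apply: nsq_eq0; lra.
Qed.

Lemma energy_bounded v w (l : R) : ccont v -> ccont w ->
  exists2 B : R, 0 <= B & forall x, 0 <= x -> x <= l -> nsq (v x) <= B /\ nsq (w x) <= B.
Proof.
move=> cv cw.
have [M [_ HM]] := @continuous_bounded_itv _ _ 0 l (continuous_energy cv cw).
exists (`|M| + 1); first by rewrite addr_ge0.
move=> x x0 xl; have M1 : M < `|M| + 1 by rewrite (le_lt_trans (ler_norm _))// ltrDl.
have := HM _ M1 x; rewrite /= in_itv/= x0 xl => /(_ isT).
rewrite ger0_norm ?energy_ge0// /energy.
by have := nsq_ge0 (v x); have := nsq_ge0 (w x); lra.
Qed.

Lemma sqr_norm_le (u r : R) : `|u| <= r -> u ^+ 2 <= r ^+ 2.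
Proof.
move=> ur; have r0 := le_trans (normr_ge0 u) ur.
by rewrite -[u ^+ 2]real_normK ?num_real// ler_sqr ?nnegrE.
Qed.

Lemma nsq_real (r : R) : nsq r%:C = r ^+ 2.
Proof. by rewrite /nsq !reim; ring. Qed.

(** By [cell_stability], once the coefficients are close in the uniform norm.
    The filter is arbitrary because two limits are of interest: vanishing
    absorption at fixed s, and s tending to a point without absorption. *)
Lemma cell_cvg (T : Type) (F : set_system T) (FF : Filter F) (sj : T -> R) (kj : T -> R[i])
  (vj wj : T -> R -> R[i]) s v w : cellsol S s v w ->
  (\forall t \near F, csol cellI (mu_ S (sj t)) (rho_ S (sj t)) (kj t) (vj t) (wj t) /\ 0 <= Im (kj t)) ->
  sj @ F --> s ->
  (forall e, 0 < e -> \forall t \near F, nsq (kj t - (omega S ^+ 2)%:C) <= e) ->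
  (forall e, 0 < e -> \forall t \near F, nsq (Rplus S (vj t) (wj t) 0 - Rplus S v w 0) <= e) ->
  (forall e, 0 < e -> \forall t \near F, nsq (Rminus S (vj t) (wj t) L - Rminus S v w L) <= e) ->
  forall e, 0 < e -> \forall t \near F, forall x, 0 <= x -> x <= L ->
    energy (fun x => vj t x - v x) (fun x => wj t x - w x) x <= e.
Proof.
move=> sol solj sjs kjk Rp Rm e e0.
set K := (omega S ^+ 2)%:C in kjk; have K0 := nsq_ge0 K.
have k0 : 0 <= 2 * nsq K + 2 by lra.
have [C C0 HC] := cell_stability k0.
have [cv cw _ _] := sol; have [B B0 HB] := energy_bounded L cv cw.
(* a third of the error for each of the two Robin data and for the sources; the
   tolerances t1 and t2 for coefficients and spectral parameter make the sources
   at most eta *)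
pose e3 := e / (3 * C); have e30 : 0 < e3 by rewrite divr_gt0// mulr_gt0.
pose eta := Num.sqrt e3; have eta0 : 0 < eta by rewrite sqrtr_gt0.
have eta2 : eta ^+ 2 = e3 by rewrite sqr_sqrtr// ltW.
have c0 := cb_c0 cb.
have B1 : 0 < B + 1 by lra.
have K1 : 0 < nsq K + 1 by lra.
pose t1 := eta * Num.min (c ^+ 2 / (B + 1)) (1 / (2 * (nsq K + 1) * (B + 1))).
have m10 : 0 < Num.min (c ^+ 2 / (B + 1)) (1 / (2 * (nsq K + 1) * (B + 1))).
  by rewrite lt_min !divr_gt0 ?exprn_gt0 ?mulr_gt0.
have t10 : 0 < t1 by rewrite mulr_gt0.
have r1 : 0 < rM ^+ 2 + 1 by have := sqr_ge0 rM; lra.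
pose t2 := Num.min 1 (e3 / (4 * (rM ^+ 2 + 1) * (B + 1))).
have t20 : 0 < t2 by rewrite lt_min ltr01 divr_gt0// !mulr_gt0.
have near_coef := sjs _ (standing_unif L s hS t10).
near=> t.
have [solt Imt] : csol cellI (mu_ S (sj t)) (rho_ S (sj t)) (kj t) (vj t) (wj t) /\ 0 <= Im (kj t).
  by near: t.
have coeft : forall x, 0 <= x -> x <= L ->
    `|mu_ S (sj t) x - mu_ S s x| <= t1 /\ `|rho_ S (sj t) x - rho_ S s x| <= t1.
  by near: t.
have kt : nsq (kj t - K) <= t2 by near: t; exact: kjk.
have rp : nsq (Rplus S (vj t) (wj t) 0 - Rplus S v w 0) <= e3 by near: t; exact: Rp.
have rm : nsq (Rminus S (vj t) (wj t) L - Rminus S v w L) <= e3 by near: t; exact: Rm.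
move=> x x0 xL.
have kk : nsq (kj t) <= 2 * nsq K + 2.
  have := nsqD (kj t - K) K; rewrite subrK.
  have : t2 <= 1 by rewrite ge_min lexx.
  lra.
apply: (le_trans (HC _ _ _ _ _ _ _ _ eta solt sol Imt kk _ x x0 xL)); last first.
  rewrite eta2; apply: (@le_trans _ _ (C * (e3 + e3 + e3))).
    by rewrite ler_pM2l// !lerD.
  by rewrite le_eqVlt; apply/orP; left; apply/eqP; rewrite /e3; field; lra.
move=> y y0 yL; have [mt rt] := coeft y (ltW y0) (ltW yL).
have [vB wB] := HB y (ltW y0) (ltW yL).
move: (cb_muc cb (sj t) y) (cb_muc cb s y) (cb_rho0 cb (sj t) y) (cb_rhoM cb (sj t) y).
move: (mu_ S (sj t) y) (mu_ S s y) (rho_ S (sj t) y) (rho_ S s y) mt rt => m1 m2 q1 q2 mt rt cm1 cm2 q10 q1M.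
have q1sq : q1 ^+ 2 <= rM ^+ 2 by rewrite ler_sqr ?nnegrE// (le_trans q10).
have t1sq : t1 ^+ 2 = eta ^+ 2 * (Num.min (c ^+ 2 / (B + 1)) (1 / (2 * (nsq K + 1) * (B + 1)))) ^+ 2.
  by rewrite /t1 exprMn.
move: m10 t1sq; set m := Num.min _ _ => m10 t1sq.
have mc : m <= c ^+ 2 / (B + 1) by rewrite ge_min lexx.
have mk : m <= 1 / (2 * (nsq K + 1) * (B + 1)) by rewrite ge_min lexx orbT.
rewrite !nsqM; split.
  rewrite -rmorphB nsq_real.
  have m10' := lt_le_trans c0 cm1; have m20' := lt_le_trans c0 cm2.
  have -> : m1^-1 - m2^-1 = (m2 - m1) / (m1 * m2) by field; rewrite !gt_eqF.
  have d1 : (m2 - m1) ^+ 2 <= t1 ^+ 2.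
    by apply: sqr_norm_le; rewrite distrC.
  have d2 : c ^+ 4 <= (m1 * m2) ^+ 2.
    rewrite (_ : c ^+ 4 = (c * c) ^+ 2); last by ring.
    by rewrite ler_sqr ?nnegrE ?mulr_ge0 ?(ltW m10') ?(ltW m20') ?(ltW c0)// ler_pM ?(ltW c0).
  rewrite expr_div_n mulrAC ler_pdivrMr; last by rewrite exprn_gt0// mulr_gt0.
  apply: (@le_trans _ _ (t1 ^+ 2 * B)); first by rewrite ler_pM ?sqr_ge0 ?nsq_ge0.
  apply: (@le_trans _ _ (eta ^+ 2 * c ^+ 4)); last by rewrite ler_wpM2l ?sqr_ge0.
  rewrite t1sq -mulrA ler_wpM2l ?sqr_ge0//.
  have mc2 : m ^+ 2 <= (c ^+ 2 / (B + 1)) ^+ 2.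
    by rewrite ler_sqr ?nnegrE ?(ltW m10)// divr_ge0 ?sqr_ge0 ?ltW.
  apply: (@le_trans _ _ ((c ^+ 2 / (B + 1)) ^+ 2 * B)); first by rewrite ler_wpM2r.
  rewrite expr_div_n mulrAC ler_pdivrMr ?exprn_gt0// -exprM ler_wpM2l ?exprn_ge0 ?(ltW c0)//.
  nra.
have -> : q2%:C * K - q1%:C * kj t = (q2 - q1)%:C * K + (- q1)%:C * (kj t - K).
  by rewrite rmorphB rmorphN; ring.
apply: (@le_trans _ _ ((2 * (t1 ^+ 2 * nsq K) + 2 * (rM ^+ 2 * t2)) * B)).
  apply: ler_pM; rewrite ?nsq_ge0//.
  apply: (le_trans (nsqD _ _)); rewrite !nsqM !nsq_real sqrrN lerD// ler_pM2l// ler_pM ?sqr_ge0 ?nsq_ge0//.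
  by apply: sqr_norm_le; rewrite distrC.
have part1 : 2 * (t1 ^+ 2 * nsq K) * B <= eta ^+ 2 / 2.
  have mk2 : m ^+ 2 <= (1 / (2 * (nsq K + 1) * (B + 1))) ^+ 2.
    by rewrite ler_sqr ?nnegrE ?(ltW m10)// divr_ge0// ltW// !mulr_gt0.
  have D0 : 0 < (2 * (nsq K + 1) * (B + 1)) ^+ 2 by rewrite exprn_gt0// !mulr_gt0.
  rewrite t1sq.
  have -> : 2 * (eta ^+ 2 * m ^+ 2 * nsq K) * B = eta ^+ 2 * (m ^+ 2 * (2 * nsq K * B)) by ring.
  rewrite ler_wpM2l ?sqr_ge0//.
  apply: (@le_trans _ _ ((1 / (2 * (nsq K + 1) * (B + 1))) ^+ 2 * (2 * nsq K * B))).
    by rewrite ler_wpM2r// !mulr_ge0.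
  rewrite expr_div_n expr1n mulrAC mul1r ler_pdivrMr//.
  have : 0 <= nsq K * B by rewrite mulr_ge0.
  have : nsq K * B <= ((nsq K + 1) * (B + 1)) ^+ 2 by nra.
  rewrite -mulrA exprMn; lra.
have part2 : 2 * (rM ^+ 2 * t2) * B <= eta ^+ 2 / 2.
  have t2b : t2 <= e3 / (4 * (rM ^+ 2 + 1) * (B + 1)) by rewrite ge_min lexx orbT.
  have D0 : 0 < 4 * (rM ^+ 2 + 1) * (B + 1) by rewrite !mulr_gt0.
  rewrite eta2; apply: (@le_trans _ _ (2 * (rM ^+ 2 * (e3 / (4 * (rM ^+ 2 + 1) * (B + 1)))) * B)).
    by rewrite ler_wpM2r// ler_pM2l// ler_wpM2l ?sqr_ge0.
  have -> : 2 * (rM ^+ 2 * (e3 / (4 * (rM ^+ 2 + 1) * (B + 1)))) * B =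
     e3 * (2 * rM ^+ 2 * B) / (4 * (rM ^+ 2 + 1) * (B + 1)) by ring.
  rewrite ler_pdivrMr// -[e3 / 2 * _]mulrA ler_pM2l//.
  have := sqr_ge0 rM; nra.
rewrite mulrDl; lra.
Unshelve. all: by end_near. Qed.

End CellStability.

(** * Limits of complex-valued families *)

Section ComplexLimits.
Context {R : realType} {T : Type} (F : set_system T) {FF : ProperFilter F}.
Implicit Types (f g : T -> R[i]) (l m : R[i]).

Definition ccvg f l := forall e : R, 0 < e -> \forall t \near F, nsq (f t - l) <= e.

Lemma ccvgP f l : ccvg f l <->
  ((fun t => Re (f t)) @ F --> Re l /\ (fun t => Im (f t)) @ F --> Im l).
Proof.
split=> [fl|[f1 f2] e e0].
  split; apply/cvgrPdist_le => e e0; have := fl (e ^+ 2) (exprn_gt0 2 e0);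
    apply: filterS => t; rewrite /nsq !reim => H;
    rewrite distrC -(ler_sqr (_ : _ \is Num.nneg) (_ : _ \is Num.nneg)) ?nnegrE ?(ltW e0)//
      real_normK ?num_real//; apply: le_trans H.
    by rewrite lerDl sqr_ge0.
  by rewrite lerDr sqr_ge0.
have g1 : (fun t => Re (f t) - Re l) @ F --> (0 : R).
  by rewrite -[X in _ --> X](subrr (Re l)); apply: cvgB f1 _; exact: cvg_cst.
have g2 : (fun t => Im (f t) - Im l) @ F --> (0 : R).
  by rewrite -[X in _ --> X](subrr (Im l)); apply: cvgB f2 _; exact: cvg_cst.
have : (fun t => (Re (f t) - Re l) * (Re (f t) - Re l) + (Im (f t) - Im l) * (Im (f t) - Im l)) @ F --> (0 * 0 + 0 * 0 : R).
  by apply: cvgD; exact: cvgM.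
rewrite mul0r addr0 => /cvgr0_norm_le /(_ _ e0); apply: filterS => t H.
apply: le_trans H; rewrite /nsq !reim !expr2; exact: ler_norm.
Qed.

Lemma ccvgM f g l m : ccvg f l -> ccvg g m -> ccvg (fun t => f t * g t) (l * m).
Proof.
move=> /ccvgP[f1 f2] /ccvgP[g1 g2]; apply/ccvgP; rewrite !reim; split.
  rewrite (_ : (fun t => _) = (fun t => Re (f t) * Re (g t) - Im (f t) * Im (g t))).
    by apply: cvgB; exact: cvgM.
  by apply/funext => t; rewrite !reim.
rewrite (_ : (fun t => _) = (fun t => Re (f t) * Im (g t) + Im (f t) * Re (g t))).
  by apply: cvgD; exact: cvgM.
by apply/funext => t; rewrite !reim.
Qed.

Lemma ccvgB f g l m : ccvg f l -> ccvg g m -> ccvg (fun t => f t - g t) (l - m).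
Proof.
move=> /ccvgP[f1 f2] /ccvgP[g1 g2]; apply/ccvgP; rewrite !reim; split.
  rewrite (_ : (fun t => _) = (fun t => Re (f t) - Re (g t))); first exact: cvgB.
  by apply/funext => t; rewrite !reim.
rewrite (_ : (fun t => _) = (fun t => Im (f t) - Im (g t))); first exact: cvgB.
by apply/funext => t; rewrite !reim.
Qed.

Lemma ccvg_cst l : ccvg (fun=> l) l.
Proof.
by move=> e e0; near=> t; rewrite subrr /nsq !reim expr0n /= addr0 ltW.
Unshelve. all: by end_near. Qed.

Lemma ccvgX f l n : ccvg f l -> ccvg (fun t => f t ^+ n) (l ^+ n).
Proof.
move=> fl; elim: n => [|n IH]; first exact: ccvg_cst.
have := ccvgM fl IH; rewrite -exprS.
by rewrite (_ : (fun t => f t * f t ^+ n) = (fun t => f t ^+ n.+1))//; apply/funext => t; rewrite exprS.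
Qed.

Lemma ccvg_unique f l m : ccvg f l -> ccvg f m -> l = m.
Proof.
move=> /ccvgP[f1 f2] /ccvgP[g1 g2]; apply: complex_eq.
  exact: (cvg_unique _ f1 g1).
exact: (cvg_unique _ f2 g2).
Qed.

Lemma cvg_nsq f l : ccvg f l -> (fun t => nsq (f t)) @ F --> nsq l.
Proof.
move=> /ccvgP[f1 f2]; rewrite /nsq.
by apply: cvgD; rewrite expr2; under eq_cvg do rewrite expr2; exact: cvgM.
Qed.

Lemma ccvgV f l : l != 0 -> ccvg f l -> ccvg (fun t => (f t)^-1) l^-1.
Proof.
move=> l0 fl; have nl : nsq l != 0 by apply: contra_neq l0; exact: nsq_eq0.
have cn : (fun t => (nsq (f t))^-1) @ F --> (nsq l)^-1.
  by apply: cvgV => //; exact: cvg_nsq.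
have /ccvgP[f1 f2] := fl; apply/ccvgP.
have RV (z : R[i]) : Re z^-1 = Re z * (nsq z)^-1 by case: z => x y.
have IV (z : R[i]) : Im z^-1 = - (Im z * (nsq z)^-1) by case: z => x y.
split.
  rewrite RV (_ : (fun t => _) = (fun t => Re (f t) * (nsq (f t))^-1)); first exact: cvgM.
  by apply/funext => t; rewrite RV.
rewrite IV (_ : (fun t => _) = (fun t => - (Im (f t) * (nsq (f t))^-1))).
  by apply: cvgN; exact: cvgM.
by apply/funext => t; rewrite IV.
Qed.

Lemma ccvg_normc f l : ccvg f l -> (fun t => normc (f t - l)) @ F --> (0 : R).
Proof.
move=> fl; apply/cvgrPdist_le => e e0; have := fl (e ^+ 2) (exprn_gt0 2 e0).
apply: filterS => t H; rewrite sub0r normrN ger0_norm ?normc_nneg//.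
exact: normc_lt (ltW e0) H.
Qed.

End ComplexLimits.

(** * Gluing solutions across cells *)

Section Gluing.
Context {R : realType}.
Implicit Types (f g : nat -> R -> R[i]) (L x y t : R) (n : nat).

Definition glued (T : Type) L (f : nat -> R -> T) x : T :=
  let n := Num.truncn (x / L) in f n (x - n%:R * L).

Lemma glued_cell (T : Type) L (f : nat -> R -> T) n x : 0 < L ->
  (forall n, f n L = f n.+1 0) -> n%:R * L <= x -> x <= n.+1%:R * L ->
  glued L f x = f n (x - n%:R * L).
Proof.
move=> L0 fL nx; rewrite le_eqVlt => /predU1P[->|xn].
  rewrite /glued mulfK ?gt_eqF// natrK subrr -fL; congr f.
  by rewrite -natr1; ring.
rewrite /glued (_ : Num.truncn (x / L) = n)//; apply: truncn_def.
by rewrite ler_pdivlMr// ltr_pdivrMr// nx.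
Qed.

Lemma glued_left (T : Type) L (f : nat -> R -> T) x : 0 < L ->
  (forall n, f n L = f n.+1 0) -> x <= L -> glued L f x = f 0%N x.
Proof.
move=> L0 fL xL; have [x0|x0] := leP 0 x.
  by rewrite (@glued_cell _ _ _ 0%N) ?mul0r ?mul1r ?subr0.
rewrite /glued (_ : Num.truncn (x / L) = 0%N) ?mul0r ?subr0//.
rewrite truncn_floor leNgt (_ : x / L < 0)//.
by rewrite pmulr_llt0 ?invr_gt0.
Qed.

Lemma glued_continuous L (f : nat -> R -> R) : 0 < L -> (forall n, continuous (f n)) ->
  (forall n, f n L = f n.+1 0) -> continuous (glued L f).
Proof.
move=> L0 cf fL.
have within n : {within `]-oo, n.+1%:R * L], continuous (glued L f)}.
  elim: n => [|n IH].
    rewrite mul1r; apply: (@subspace_eq_continuous _ _ _ (f 0%N)).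
      by move=> x; rewrite inE/= in_itv/= => xL; rewrite /from_subspace glued_left.
    exact: continuous_subspaceT.
  have -> : `]-oo, n.+2%:R * L]%classic = `]-oo, n.+1%:R * L]%classic `|` `[n.+1%:R * L, n.+2%:R * L]%classic.
    apply/seteqP; split => x /=; rewrite !in_itv/=.
      by move=> xn; have [|/ltW] := leP x (n.+1%:R * L); [left|right; apply/andP].
    by move=> [xn|/andP[]//]; apply: (le_trans xn); rewrite ler_pM2r// ler_nat.
  apply: withinU_continuous => //; first exact: itv_closed.
  apply: (@subspace_eq_continuous _ _ _ (fun x => f n.+1 (x - n.+1%:R * L))).
    move=> x; rewrite inE/= in_itv/= => /andP[x1 x2].
    by rewrite /from_subspace (glued_cell L0 fL x1 x2).
  apply: continuous_subspaceT.
  by apply: (@cont_comp _ _ _ (f n.+1) (fun x => x - n.+1%:R * L)); [cont|exact: cf].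
move=> x; pose n := Num.truncn (`|x| / L).
have xn : x < n.+1%:R * L.
  apply: (le_lt_trans (ler_norm x)); rewrite -ltr_pdivrMr//.
  exact: truncnS_gt.
have : {within `]-oo, n.+1%:R * L[, continuous (glued L f)}.
  apply: (@continuous_subspaceW _ _ _ `]-oo, n.+1%:R * L]%classic) => //.
  by move=> y /=; rewrite !in_itv/= => /ltW.
rewrite continuous_open_subspace; last exact: interval_open.
by apply; rewrite inE /= in_itv.
Qed.

(** The difference of h and a primitive of k is continuous and constant on
    each cell, so that it is constant, nodes included. *)
Lemma derive_across L (h k : R -> R) : 0 < L -> continuous h -> continuous k ->
  (forall n x, n%:R * L < x -> x < n.+1%:R * L -> is_derive x 1 h (k x)) ->
  forall x, 0 < x -> is_derive x 1 h (k x).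
Proof.
move=> L0 ch ck dh.
pose P x := (\int[leb]_(t in `[(-1)%R, x]) k t)%R.
have dP x : -1 < x -> is_derive x 1 P (k x).
  move=> x1; have x2 : x < x + 1 by rewrite ltrDl.
  have ki : leb.-integrable `[(-1)%R, x + 1] (EFin \o k).
    by apply: continuous_compact_integrable; [exact: segment_compact|exact: continuous_subspaceT].
  have [d1 d2] := continuous_FTC1_closed x2 ki x1 (ck x).
  by rewrite -d2 derive1E; exact/derivableP.
have nL n : 0 <= n%:R * L by rewrite mulr_ge0// ltW.
have cell n x : n%:R * L <= x -> x <= n.+1%:R * L -> h x - P x = h (n%:R * L) - P (n%:R * L).
  move=> nx xn.
  have [||y _] := @MVT_segment _ (fun x => h x - P x) (fun=> 0) (n%:R * L) x nx.
  - move=> y; rewrite in_itv/= => /andP[y1 y2].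
    have H1 := dh n y y1 (lt_le_trans y2 xn).
    have H2 : is_derive y 1 P (k y) by apply: dP; have := nL n; lra.
    by apply: is_derive_eq; rewrite subrr.
  - apply: continuous_in_subspaceT => y; rewrite inE/= in_itv/= => /andP[y1 _].
    apply: cvgB; first exact: ch.
    apply: differentiable_continuous; apply/derivable1_diffP.
    by have [] := dP y _; first by have := nL n; lra.
  by rewrite mul0r => /eqP; rewrite subr_eq0 => /eqP.
have node n : h (n%:R * L) - P (n%:R * L) = h 0 - P 0.
  elim: n => [|n <-]; first by rewrite mul0r.
  by apply: cell => //; rewrite ler_pM2r// ler_nat.
have const x : 0 <= x -> h x - P x = h 0 - P 0.
  move=> x0; pose n := Num.truncn (x / L).
  have xL0 : 0 <= x / L by rewrite divr_ge0// ltW.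
  have /andP[n1 n2] := truncn_itv xL0.
  rewrite -(node n); apply: cell; first by rewrite -ler_pdivlMr.
  by rewrite ltW// -ltr_pdivrMr.
move=> x x0.
have H : is_derive x 1 P (k x) by apply: dP; lra.
have H2 : is_derive x 1 (fun y => P y + (h 0 - P 0)) (k x).
  by apply: is_derive_eq; rewrite addr0.
apply: (@near_eq_is_derive _ _ _ (fun y => P y + (h 0 - P 0))) => //.
near=> y; rewrite -(const y); first by rewrite addrC subrK.
by apply: ltW; near: y; exact: lt_nbhsr.
Unshelve. all: by end_near. Qed.

Lemma csol_glued L (mu rho : R -> R) (kappa : R[i]) f g : 0 < L ->
  continuous mu -> continuous rho -> (forall x, mu x != 0) ->
  (forall n, csol `]0, L[ (fun x => mu (n%:R * L + x)) (fun x => rho (n%:R * L + x)) kappa (f n) (g n)) ->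
  (forall n, f n L = f n.+1 0) -> (forall n, g n L = g n.+1 0) ->
  csol `]0, +oo[ mu rho kappa (glued L f) (glued L g).
Proof.
move=> L0 cmu crho mu0 sol fL gL.
have reE (h : nat -> R -> R[i]) : (fun x => Re (glued L h x)) = glued L (fun n x => Re (h n x)) by [].
have imE (h : nat -> R -> R[i]) : (fun x => Im (glued L h x)) = glued L (fun n x => Im (h n x)) by [].
have cfg (h : nat -> R -> R[i]) : (forall n, ccont (h n)) -> (forall n, h n L = h n.+1 0) -> ccont (glued L h).
  move=> ch hL; split.
    by rewrite reE; apply: glued_continuous => // n; [case: (ch n)|rewrite hL].
  by rewrite imE; apply: glued_continuous => // n; [case: (ch n)|rewrite hL].
have cf : ccont (glued L f) by apply: cfg => // n; case: (sol n).
have cg : ccont (glued L g) by apply: cfg => // n; case: (sol n).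
have cmuV : continuous (fun x => (mu x)^-1) by exact: contV.
have across (h k : R -> R[i]) : ccont h -> ccont k ->
    (forall n x, n%:R * L < x -> x < n.+1%:R * L -> cderive x h (k x)) ->
    forall x, 0 < x -> cderive x h (k x).
  move=> [h1 h2] [k1 k2] H x x0; split.
    by apply: (derive_across L0 h1 k1) => // n y y1 y2; case: (H n y y1 y2).
  by apply: (derive_across L0 h2 k2) => // n y y1 y2; case: (H n y y1 y2).
have cellD (h k : nat -> R -> R[i]) n x : (forall n, h n L = h n.+1 0) -> (forall n, k n L = k n.+1 0) ->
    n%:R * L < x -> x < n.+1%:R * L ->
    forall l, cderive (x - n%:R * L) (h n) l -> cderive x (glued L h) l.
  move=> hL kL x1 x2 l.
  have nearE : \forall y \near x, h n (- (n%:R * L) + y) = glued L h y.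
    near=> y; rewrite (@glued_cell _ _ _ n)//; first by rewrite addrC.
      by apply: ltW; near: y; exact: lt_nbhsr.
    by apply: ltW; near: y; exact: lt_nbhsl.
  rewrite addrC => /(@cderive_shift _ x (h n)) [H1 H2]; split.
    by apply: near_eq_is_derive H1; apply: filterS nearE => y ->.
  by apply: near_eq_is_derive H2; apply: filterS nearE => y ->.
have inc n x : n%:R * L < x -> x < n.+1%:R * L -> `]0, L[%classic (x - n%:R * L).
  by move=> x1 x2; rewrite /= in_itv/= subr_gt0 x1/= ltrBlDl -[X in _ < _ + X]mul1r -mulrDl natr1.
have cellE (h : nat -> R -> R[i]) n x : (forall n, h n L = h n.+1 0) -> n%:R * L < x -> x < n.+1%:R * L ->
   glued L h x = h n (x - n%:R * L).
  by move=> hL x1 x2; apply: glued_cell => //; exact: ltW.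
split => // x /=; rewrite in_itv/= andbT; move: x; apply: across => //.
- by apply: ccontM => //; exact: ccont_real.
- move=> n x x1 x2; rewrite (cellE g n)//; apply: (cellD f g n) => //.
  by have := csol_dv (sol n) (inc n x x1 x2); rewrite /= subrKC.
- rewrite (_ : (fun x => _) = (fun x => (- (rho x)%:C * kappa) * glued L f x)); last first.
    by apply/funext => x; ring.
  apply: ccontM => //; apply: ccontM; last exact: ccont_cst.
  rewrite (_ : (fun x => _) = (fun x => (- rho x)%:C)); last by apply/funext => x; rewrite rmorphN.
  by apply: ccont_real; cont.
- move=> n x x1 x2; rewrite (cellE f n)//; apply: (cellD g f n) => //.
  by have := csol_dw (sol n) (inc n x x1 x2); rewrite /= subrKC.
Unshelve. all: by end_near. Qed.

End Gluing.

(** * Translation of null sets *)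

Section Translation.
Context {R : realType}.
Implicit Types (I : set R) (c x : R).

(** Both sides are measures in A which agree on intervals. *)
Lemma lebesgue_measure_shift c (A : set R) : measurable A ->
  leb ((fun x => x + c) @^-1` A) = leb A.
Proof.
move=> mA.
have mc : measurable_fun setT ((fun x : R => x + c) : R -> measurableTypeR R).
  by apply: measurable_funD.
pose f : {mfun R >-> measurableTypeR R} := HB.pack (fun x : R => x + c : measurableTypeR R) (isMeasurableFun.Build _ _ _ _ _ mc).
change (pushforward leb f A = leb A).
apply/esym/lebesgue_measure_unique => //= X.
case/ocitvP => [->|[[a b] /= ab ->]]; first by rewrite !measure0.
rewrite /pushforward.
rewrite (_ : f @^-1` _ = `](a - c), (b - c)]%classic); last first.
  by apply/seteqP; split => x /=; rewrite !in_itv/= ltrBlDr lerBrDr.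
by rewrite !lebesgue_measure_itv/= !lte_fin ltrD2r ab -!EFinB; congr EFin; ring.
Qed.

Lemma ae_shift (P : R -> Prop) c :
  (\forall x \ae (@lebesgue_measure R), P x) -> \forall x \ae (@lebesgue_measure R), P (x + c).
Proof.
move=> [N [mN N0 PN]].
have mc : measurable_fun setT ((fun x => x + c) : R -> measurableTypeR R).
  by apply: measurable_funD.
exists ((fun x => x + c) @^-1` N); split.
- by rewrite -[_ @^-1` _]setTI; exact: mc.
- by rewrite lebesgue_measure_shift.
by move=> x /= Px; apply: PN.
Qed.

End Translation.

(** * From classical derivatives to the H1 norm *)

Section ClassicalDerivative.
Context {R : realType}.
Implicit Types (I : set R) (f h k : R -> R) (a b x y : R) (u g D G : R -> R[i]).

Lemma compact_sub_itv I (K : set R) : open I -> is_interval I -> compact K -> K `<=` I -> K !=set0 ->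
  exists a b, [/\ a < b, K `<=` `]a, b[%classic & `[a, b]%classic `<=` I].
Proof.
move=> oI iI cK KI K0.
have ci : {within K, continuous (id : R -> R)} by apply: continuous_subspaceT; exact: cont_id.
have [m Km mK] := compact_EVT_min K0 cK ci.
have [M KM MK] := compact_EVT_max K0 cK ci.
have [e e0 eI] := open_itv_sub oI (KI _ (set_mem Km)).
have [e' e0' eI'] := open_itv_sub oI (KI _ (set_mem KM)).
have mM : m <= M by apply: MK.
exists (m - e / 2), (M + e' / 2); split.
- by lra.
- move=> x Kx; rewrite /= in_itv/=; have := mK x; have := MK x.
  rewrite !inE => /(_ Kx) + /(_ Kx); move=> /= ? ?; apply/andP; split; lra.
- have Ia : I (m - e / 2) by apply: eI; rewrite /= in_itv/=; apply/andP; split; lra.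
  have Ib : I (M + e' / 2) by apply: eI'; rewrite /= in_itv/=; apply/andP; split; lra.
  by move=> x; rewrite /= in_itv/=; exact: (iI _ _ Ia Ib).
Qed.

(** Integration by parts on a segment that contains the support of the test
    function. *)
Lemma weak_id_classical I h k : open I -> is_interval I -> continuous h -> continuous k ->
  (forall x, I x -> is_derive x 1 h (k x)) -> weak_id I h k.
Proof.
move=> oI iI ch ck hk phi [dphi cphi [K [cK KI phiK]]].
have [K0|K0] := pselect (K !=set0); last first.
  have phi0 x : phi x = 0 by apply: phiK => Kx; apply: K0; exists x.
  have -> : phi = fun=> 0 by apply/funext.
  rewrite (@Rintegral_sub _ set0) ?sub0set//; last by move=> x _ _; rewrite derive1_cst mulr0.
  rewrite Rintegral_set0 (@Rintegral_sub _ set0) ?sub0set//; last by move=> x _ _; rewrite mulr0.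
  by rewrite Rintegral_set0 oppr0.
have [a [b [ab Kab abI]]] := compact_sub_itv oI iI cK KI K0.
have nK x : ~ `[a, b]%classic x -> ~ K x.
  by move=> nx /Kab /=; rewrite in_itv/= => /andP[/ltW ? /ltW ?]; apply: nx; rewrite /= in_itv/=; apply/andP.
have phi_a : phi a = 0 by apply: phiK => /Kab /=; rewrite in_itv/= ltxx.
have phi_b : phi b = 0 by apply: phiK => /Kab /=; rewrite in_itv/= ltxx andbF.
rewrite (Rintegral_sub abI); last first.
  by move=> x _ /nK nx; rewrite (derive1_supp cK phiK nx) mulr0.
rewrite (Rintegral_sub abI); last by move=> x _ /nK /phiK ->; rewrite mulr0.
have cp : continuous phi.
  by move=> x; apply: differentiable_continuous; apply/derivable1_diffP.
have ci f : continuous f -> leb.-integrable `[a, b] (EFin \o f).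
  move=> cf; apply: continuous_compact_integrable; first exact: segment_compact.
  exact: continuous_subspaceT.
have c1 : continuous (fun x => h x * derive1 phi x) by cont.
have c2 : continuous (fun x => k x * phi x) by cont.
apply/eqP; rewrite -subr_eq0 opprK -RintegralD//; [|exact: ci..].
have dhp x : I x -> is_derive x 1 (fun x => h x * phi x) (h x * derive1 phi x + k x * phi x).
  move=> /hk dh; have dp : is_derive x 1 phi (derive1 phi x).
    by rewrite derive1E; apply: DeriveDef.
  by apply: is_derive_eq; rewrite /GRing.scale /= [phi x * _]mulrC.
have chp : continuous (fun x => h x * phi x) by cont.
rewrite /Rintegral (@continuous_FTC2 _ _ (fun x => h x * phi x)) ?phi_a ?phi_b ?mulr0 ?subrr//=.
- by rewrite subrr.
- by apply: continuous_subspaceT; cont.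
- split.
  + move=> x; rewrite in_itv/= => /andP[/ltW ax /ltW xb].
    have xI : I x by apply: abI; rewrite /= in_itv/= ax.
    by have [] := dhp x xI.
  + by apply: cvg_at_right_filter; exact: chp.
  + by apply: cvg_at_left_filter; exact: chp.
move=> x; rewrite in_itv/= => /andP[/ltW ax /ltW xb].
by rewrite derive1E; apply: derive_val; apply: dhp; apply: abI; rewrite /= in_itv/= ax.
Qed.

Lemma locint_ae I f h : open I -> measurable_fun I f -> continuous h ->
  (\forall x \ae (@lebesgue_measure R), I x -> h x = f x) -> locally_integrable I f.
Proof.
move=> oI mf ch hf; split => // K KI cK.
have mK : measurable K by exact: compact_measurable.
have mI : measurable I by exact: open_measurable.
have hi : leb.-integrable K (EFin \o h).
  by apply: continuous_compact_integrable => //; exact: continuous_subspaceT.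
have /integrableP[mh] := hi; apply: le_lt_trans.
rewrite le_eqVlt; apply/orP; left; apply/eqP; apply: ae_eq_integral => //.
- by apply/measurable_EFinP; apply: measurableT_comp => //; exact: measurable_funS mf.
- apply: measurableT_comp => //.
- by apply: ae_mono hf => x H /KI /H /= ->.
Qed.

Lemma is_wderiv_classical I u D G : open I -> is_interval I -> cmeasurable I u ->
  ccont D -> ccont G -> ae_eq_on I D u -> (forall x, I x -> cderive x D (G x)) ->
  is_wderiv I u G.
Proof.
move=> oI iI [m1 m2] [cD1 cD2] [cG1 cG2] Du dD.
have mI : measurable I by exact: open_measurable.
have mG h : continuous h -> measurable_fun I h.
  by move=> ch; apply: measurable_funTS; exact: continuous_measurable_fun.
have l1 : locally_integrable I (fun x => Re (u x)).
  by apply: (locint_ae oI m1 cD1); apply: ae_mono Du => x H /H ->.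
have l2 : locally_integrable I (fun x => Im (u x)).
  by apply: (locint_ae oI m2 cD2); apply: ae_mono Du => x H /H ->.
split.
- by split.
- by split; [apply: (locint_ae oI _ cG1)|apply: (locint_ae oI _ cG2)]; (try exact: mG); apply: aeW.
move=> phi tphi.
have w1 := weak_id_classical oI iI cD1 cG1 (fun x Ix => (dD x Ix).1) tphi.
have w2 := weak_id_classical oI iI cD2 cG2 (fun x Ix => (dD x Ix).2) tphi.
have swap (f h : R -> R) : locally_integrable I f -> continuous h ->
    (\forall x \ae (@lebesgue_measure R), I x -> h x = f x) ->
    (\int[leb]_(x in I) (f x * derive1 phi x) = \int[leb]_(x in I) (h x * derive1 phi x))%R.
  move=> lf ch hf; rewrite /Rintegral; congr fine; apply: ae_eq_integral => //.
  - by have /integrableP[] := integrable_test_derive lf tphi.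
  - have lh : locally_integrable I h by apply: (locint_ae oI (mG _ ch) ch); apply: aeW.
    by have /integrableP[] := integrable_test_derive lh tphi.
  - by apply: ae_mono hf => x H /H ->.
have e1 := swap _ _ l1 cD1; have e2 := swap _ _ l2 cD2.
apply: complex_eq; rewrite /cint /=.
  transitivity (\int[leb]_(x in I) (Re (u x) * derive1 phi x))%R.
    by apply: eq_Rintegral => x _; rewrite !reim mulr0 subr0.
  rewrite e1 ?w1; last by apply: ae_mono Du => x H /H ->.
  by congr (- _); apply: eq_Rintegral => x _; rewrite !reim mulr0 subr0.
transitivity (\int[leb]_(x in I) (Im (u x) * derive1 phi x))%R.
  by apply: eq_Rintegral => x _; rewrite !reim mulr0 add0r.
rewrite e2 ?w2; last by apply: ae_mono Du => x H /H ->.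
by congr (- _); apply: eq_Rintegral => x _; rewrite !reim mulr0 add0r.
Qed.

Lemma wderiv_unique I u g (h : R -> R[i]) : is_wderiv I u g -> is_wderiv I u h -> ae_eq_on I g h.
Proof.
move=> ug uh; have [_ [lg1 lg2] _] := ug; have [_ [lh1 lh2] _] := uh.
have [a1 a2] := wderiv_weak_id ug; have [b1 b2] := wderiv_weak_id uh.
have zero (f f' q : R -> R) : locally_integrable I f -> locally_integrable I f' ->
    weak_id I q f -> weak_id I q f' -> \forall x \ae (@lebesgue_measure R), I x -> f x - f' x = 0.
  move=> lf lf' wf wf'; apply: weak_zero.
    exact: locally_integrableB.
  move=> phi tphi; transitivity (\int[leb]_(x in I) (f x * phi x) - \int[leb]_(x in I) (f' x * phi x))%R.
    rewrite -RintegralB//; last 2 first.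
    - exact: integrable_test.
    - exact: integrable_test.
    - by apply: eq_Rintegral => x _; rewrite mulrBl.
    - by have [_ oI _] := lf; exact: open_measurable.
  by apply/eqP; rewrite subr_eq0 -eqr_opp -wf// -wf'.
have z1 := zero _ _ _ lg1 lh1 a1 b1; have z2 := zero _ _ _ lg2 lh2 a2 b2.
apply: ae_mono (ae_and z1 z2) => x [h1 h2] Ix.
by apply: complex_eq; apply/eqP; rewrite -subr_eq0 ?h1 ?h2.
Qed.

(** Weak derivatives are unique up to null sets, so a classical derivative of
    a representative is a version of the one that [wderiv] selects. *)
Lemma wderiv_classical I u D G : open I -> is_interval I -> cmeasurable I u ->
  ccont D -> ccont G -> ae_eq_on I D u -> (forall x, I x -> cderive x D (G x)) ->
  is_wderiv I u (wderiv I u) /\ ae_eq_on I G (wderiv I u).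
Proof.
move=> oI iI mu cD cG Du dD; have H := is_wderiv_classical oI iI mu cD cG Du dD.
have W : is_wderiv I u (wderiv I u) by apply: xgetPex; exists G.
by split => //; exact: wderiv_unique H W.
Qed.

Lemma int_bounded a b (f : R -> R) K : a < b -> measurable_fun `]a, b[ f ->
  (forall x, 0 <= f x) -> (\forall x \ae (@lebesgue_measure R), `]a, b[%classic x -> f x <= K) ->
  (\int[leb]_(x in `]a, b[) (f x)%:E <= ((b - a) * K)%:E)%E.
Proof.
move=> ab mf f0 fK.
have K0 : 0 <= K.
  have oI : open (`]a, b[%classic : set R) by exact: interval_open.
  have I0 : (`]a, b[%classic : set R) !=set0.
    by exists ((a + b) / 2); rewrite /= in_itv/=; apply/andP; split; lra.
  by have [x [Ix /(_ Ix) H]] := ae_open_ex oI I0 fK; exact: le_trans H.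
apply: (@le_trans _ _ (\int[leb]_(x in `]a, b[) K%:E)%E).
  apply: ae_ge0_le_integral => //.
  - by move=> x _; rewrite lee_fin.
  - exact/measurable_EFinP.
rewrite integral_cst//= lebesgue_measure_itv/= lte_fin ab -EFinB -EFinM lee_fin mulrC//.
Qed.

(** This turns uniform convergence of representatives and of their derivatives
    into convergence in H1. *)
Lemma H1norm_le a b u D G K : a < b -> cmeasurable `]a, b[ u -> ccont D -> ccont G ->
  ae_eq_on `]a, b[ D u -> (forall x, `]a, b[%classic x -> cderive x D (G x)) ->
  (forall x, `]a, b[%classic x -> nsq (D x) + nsq (G x) <= K) ->
  (H1norm `]a, b[ u <= (Num.sqrt ((b - a) * K))%:E)%E.
Proof.
move=> ab mu cD cG Du dD DK.
have oI : open (`]a, b[%classic : set R) by exact: interval_open.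
have iI : is_interval (`]a, b[%classic : set R) by exact: interval_is_interval.
have [W GW] := wderiv_classical oI iI mu cD cG Du dD.
have mW : cmeasurable `]a, b[ (wderiv `]a, b[ u) by have [_ [[m1 _ _] [m2 _ _]] _] := W.
have K0 : 0 <= K.
  apply: le_trans (DK ((a + b) / 2) _); first by rewrite addr_ge0 ?nsq_ge0.
  by rewrite /= in_itv/=; apply/andP; split; lra.
have bd : \forall x \ae (@lebesgue_measure R), `]a, b[%classic x ->
    nsq (u x) + nsq (wderiv `]a, b[ u x) <= K.
  by apply: ae_mono (ae_and Du GW) => x [h1 h2] Ix; rewrite -h1// -h2// DK.
have inL g : cmeasurable `]a, b[ g -> (\forall x \ae (@lebesgue_measure R), `]a, b[%classic x -> nsq (g x) <= K) ->
    inL2 (fun=> 1) `]a, b[ g.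
  move=> mg gK; split => //; rewrite /L2norm; apply: poweR_lty.
  under eq_integral do rewrite mul1r normc_sq.
  apply: (le_lt_trans (int_bounded ab (measurable_nsq mg) _ gK)); last exact: ltry.
  by move=> x; exact: nsq_ge0.
have H1 : inH1 `]a, b[ u.
  split => //; apply: inL => //; apply: ae_mono bd => x H /H.
    by apply: le_trans; rewrite lerDl nsq_ge0.
  by apply: le_trans; rewrite lerDr nsq_ge0.
rewrite /H1norm asboolT// -powR12_sqrt ?mulr_ge0 ?subr_ge0 ?(ltW ab)// -poweR_EFin.
under eq_integral do rewrite !normc_sq.
apply: gt0_ler_poweR => //.
- rewrite in_itv/= leey andbT; apply: integral_ge0 => x _.
  by rewrite lee_fin addr_ge0 ?nsq_ge0.
- by rewrite in_itv/= leey andbT lee_fin mulr_ge0 ?subr_ge0 ?(ltW ab).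
apply: int_bounded => //.
  by apply: measurable_funD; exact: measurable_nsq.
by move=> x; rewrite addr_ge0 ?nsq_ge0.
Qed.

End ClassicalDerivative.

(** * Measurability of glued functions *)

Section GluedMeasurable.
Context {R : realType}.
Implicit Types (I J : set R) (c L x y : R) (n : nat).

Lemma ae_neq c : \forall x \ae (@lebesgue_measure R), x != c.
Proof.
exists [set c]; split => //; first by rewrite lebesgue_measure_set1.
by move=> x /= /negP; rewrite negbK => /eqP.
Qed.

(** The nodes form a null set, so the values of f at the ends of the cells do
    not matter. *)
Lemma ae_glued L (f h : nat -> R -> R[i]) : 0 < L ->
  (forall n, ae_eq_on `]0, L[ (f n) (h n)) -> ae_eq_on `]0, +oo[ (glued L f) (glued L h).
Proof.
move=> L0 fh.
have H1 n : \forall x \ae (@lebesgue_measure R),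
    (`]0, L[%classic (x - n%:R * L) -> f n (x - n%:R * L) = h n (x - n%:R * L)) /\ x != n%:R * L.
  by apply: ae_and (ae_neq _); exact: ae_shift (fh n).
have := ae_forall_count H1; apply: ae_mono => x H; rewrite /= in_itv/= andbT => x0.
rewrite /glued; have [Hn xn] := H (Num.truncn (x / L)); apply: Hn.
have /truncn_itv/andP[] : 0 <= x / L by rewrite divr_ge0 // ltW.
rewrite ler_pdivlMr// ltr_pdivrMr// => n1 n2.
rewrite /= in_itv/= subr_gt0; apply/andP; split; last first.
  by move: n2; rewrite -natr1 mulrDl mul1r ltrBlDl.
by rewrite lt_neqAle eq_sym n1 andbT.
Qed.

Lemma cmeasurable_shift I J c (f : R -> R[i]) : measurable I -> (forall x, J x -> I (x - c)) ->
  cmeasurable I f -> cmeasurable J (fun x => f (x - c)).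
Proof.
move=> mI JI [m1 m2].
have H (g : R -> R) : measurable_fun I g -> measurable_fun J (fun x => g (x - c)).
  move=> mg; apply: (measurable_comp mI _ mg); last by apply: measurable_funB.
  by move=> _ [x Jx <-]; exact: JI.
by split; [exact: (H (fun x => Re (f x)))|exact: (H (fun x => Im (f x)))].
Qed.

(** The half-line is the countable union of the open cells and of the nodes. *)
Lemma cmeasurable_glued L (f : nat -> R -> R[i]) : 0 < L ->
  (forall n, cmeasurable `]0, L[ (f n)) -> cmeasurable `]0, +oo[ (glued L f).
Proof.
move=> L0 mf.
pose J n : set R := `](n%:R * L), (n.+1%:R * L)[%classic `|` [set n.+1%:R * L].
have JE : `]0, +oo[%classic `<=` \bigcup_n J n.
  move=> x /=; rewrite in_itv/= andbT => x0.
  have /truncn_itv/andP[] : 0 <= x / L by rewrite divr_ge0 // ltW.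
  set n := Num.truncn _; rewrite ler_pdivlMr// ltr_pdivrMr// => n1 n2.
  have [xn|xn] := eqVneq x (n%:R * L); last first.
    by exists n => //; left; rewrite /= in_itv/= n2 andbT lt_neqAle eq_sym xn.
  case E : n xn => [|m] xm; first by move: x0; rewrite xm mul0r ltxx.
  by exists m => //; right.
have mJ n : measurable (J n) by apply: measurableU.
have mU : measurable (\bigcup_n J n) by exact: bigcupT_measurable.
have H (p : R[i] -> R) : (forall n, measurable_fun `]0, L[ (fun x => p (f n x))) ->
    measurable_fun (`]0, +oo[%classic : set R) (fun x => p (glued L f x)).
  move=> mp; apply: (measurable_funS mU JE); apply/measurable_fun_bigcup => // n.
  apply/measurable_funU => //; split; last exact: measurable_fun_set1.
  apply: (@eq_measurable_fun _ _ _ _ _ (fun x => p (f n (x - n%:R * L)))).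
    move=> x; rewrite inE/= in_itv/= => /andP[/ltW n1 n2]; rewrite /glued.
    rewrite (_ : Num.truncn (x / L) = n)//; apply: truncn_def.
    by rewrite ler_pdivlMr// ltr_pdivrMr// n1.
  have mI : measurable (`]0, L[%classic : set R) by [].
  apply: (measurable_comp mI _ (mp n)).
    move=> _ [x + <-]; rewrite /= !in_itv/= => /andP[n1 n2]; rewrite subr_gt0 n1/=.
    by move: n2; rewrite -natr1 mulrDl mul1r ltrBlDl.
  by apply: measurable_funB.
by split; [apply: (H (@complex.Re R)) => n; case: (mf n)|apply: (H (@complex.Im R)) => n; case: (mf n)].
Qed.

Lemma cmeasurable_lin I (f g : R -> R[i]) (a b : R[i]) : cmeasurable I f -> cmeasurable I g ->
  cmeasurable I (fun x => a * f x + b * g x).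
Proof.
move=> [f1 f2] [g1 g2]; split.
  rewrite (_ : (fun x => _) = (fun x => (Re a * Re (f x) - Im a * Im (f x)) + (Re b * Re (g x) - Im b * Im (g x)))).
    by apply: measurable_funD; apply: measurable_funB; apply: measurable_funM.
  by apply/funext => x; rewrite !reim.
rewrite (_ : (fun x => _) = (fun x => (Re a * Im (f x) + Im a * Re (f x)) + (Re b * Im (g x) + Im b * Re (g x)))).
  by apply: measurable_funD; apply: measurable_funD; apply: measurable_funM.
by apply/funext => x; rewrite !reim.
Qed.

End GluedMeasurable.

(** * Vanishing absorption along the orbit of the rotation *)

Section LimitProfile.
Context {R : realType} (S : medium R) (hS : standing_assumptions S).
Context (c rM mM : R) (cb : coef_bounds S c rM mM).
Implicit Types (s x y t e : R) (n j : nat).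

Local Notation L := (period S).
Local Notation d := (delta S).

(** [V j s] and [W j s] represent the decaying solution u_{s,eps_j} with unit
    Robin trace, and [X s], [Y s] the solution of the cell problem without
    absorption whose data are those of the limits phi0 and psi0. *)
Context (eps : nat -> R) (eps0 : forall j, 0 < eps j) (epscvg : eps @ \oo --> (0 : R)).
Context (V W : nat -> R -> R -> R[i]).
Context (HV : forall j s, hsol S (eps j) s (V j s) (W j s)).
Context (HV0 : forall j s, Rplus S (V j s) (W j s) 0 = 1).
Context (lamj : nat -> R[i]) (phij : nat -> R -> R[i]) (lam0 : R[i]) (phi0 psi0 : R -> R[i]).
Context (eig : forall j s, Rplus S (V j s) (W j s) L * phij j s = lamj j * phij j (s + d)).
Context (lamj1 : forall j, nsq (lamj j) <= 1).
Context (lamcvg : ccvg \oo lamj lam0).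
Context (phicvg : forall s, ccvg \oo (phij ^~ s) (phi0 s)).
Context (psicvg : forall s, ccvg \oo (fun j => Rminus S (V j s) (W j s) L * phij j s) (psi0 (s + d))).
Context (phi0c : ccont phi0) (psi0c : ccont psi0).
Context (phi0p : forall s, phi0 (s + 1) = phi0 s) (psi0p : forall s, psi0 (s + 1) = psi0 s).
Context (X Y : R -> R -> R[i]).
Context (HX : forall s, cellsol S s (X s) (Y s)).
Context (HX0 : forall s, Rplus S (X s) (Y s) 0 = phi0 s).
Context (HXL : forall s, Rminus S (X s) (Y s) L = psi0 (s + d)).

Lemma RplusZ a v w x : Rplus S (fun x => a * v x) (fun x => a * w x) x = a * Rplus S v w x.
Proof. by rewrite /Rplus; ring. Qed.
Lemma RminusZ a v w x : Rminus S (fun x => a * v x) (fun x => a * w x) x = a * Rminus S v w x.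
Proof. by rewrite /Rminus; ring. Qed.
Lemma fluxZ (a : R[i]) v w x : flux (fun x => a * v x) (fun x => a * w x) x = nsq a * flux v w x.
Proof. by rewrite /flux /nsq !reim; ring. Qed.

(** From its second cell on, a decaying solution is a decaying solution for
    the starting point s + d, determined by its Robin trace there. *)
Lemma hsol_rot j s x : 0 <= x ->
  V j s (L + x) = Rplus S (V j s) (W j s) L * V j (s + d) x /\
  W j s (L + x) = Rplus S (V j s) (W j s) L * W j (s + d) x.
Proof.
move=> x0; apply: (hsol_unique hS cb (eps0 j) (hsol_shift hS (HV j s)) (HV j (s + d)) _ x0).
by rewrite HV0 mulr1 /Rplus addr0.
Qed.

(** The eigenvalue equation turns the product of the factors of [hsol_rot]
    along the orbit into a power of the eigenvalue. *)
Lemma hsol_rotn j s n x : 0 <= x ->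
  phij j s * V j s (n%:R * L + x) = lamj j ^+ n * (phij j (s + n%:R * d) * V j (s + n%:R * d) x) /\
  phij j s * W j s (n%:R * L + x) = lamj j ^+ n * (phij j (s + n%:R * d) * W j (s + n%:R * d) x).
Proof.
have L0 := period_gt0 hS.
elim: n x => [|n IH] x x0; first by rewrite !mul0r add0r !addr0 expr0 !mul1r.
have -> : n.+1%:R * L + x = n%:R * L + (L + x) by rewrite -natr1; ring.
have [-> ->] := IH (L + x) (addr_ge0 (ltW L0) x0).
have [-> ->] := hsol_rot j (s + n%:R * d) x0.
have -> : s + n.+1%:R * d = s + n%:R * d + d by rewrite -natr1; ring.
rewrite exprSr; have E := eig j (s + n%:R * d).
set P := Rplus _ _ _ _ in E *; set p := phij j (s + n%:R * d) in E *.
set p' := phij j _ in E *.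
have E' u : p * (P * u) = lamj j * (p' * u) by rewrite [RHS]mulrA -E; ring.
by rewrite !E' !mulrA.
Qed.

(** The left-hand functions solve a cell problem whose Robin data converge to
    those of X s; [cell_cvg] applies. *)
Lemma profile_cvg s e : 0 < e -> \forall j \near \oo, forall x, 0 <= x -> x <= L ->
  energy (fun x => phij j s * V j s x - X s x) (fun x => phij j s * W j s x - Y s x) x <= e.
Proof.
move=> e0.
apply: (@cell_cvg _ S hS _ _ _ cb nat \oo _ (fun=> s) (fun j => omega S ^+ 2 +i* eps j)
  (fun j x => phij j s * V j s x) (fun j x => phij j s * W j s x) s (X s) (Y s)) => //.
- near=> j; split; last by rewrite /= ltW.
  apply/csolZ/(csolS _ (HV j s).1) => x /=.
  by rewrite !in_itv/= andbT => /andP[].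
- exact: cvg_cst.
- move=> e' e'0; have /cvgr0_norm_le /(_ _ (_ : 0 < Num.sqrt e')) := epscvg.
  rewrite sqrtr_gt0 => /(_ e'0); apply: filterS => j H.
  rewrite /nsq !reim /= subrr oppr0 addr0 expr0n /= add0r.
  by have := sqr_norm_le H; rewrite sqr_sqrtr// ltW.
- by move=> e' e'0; under eq_near do rewrite RplusZ HV0 mulr1 HX0; exact: phicvg.
- by move=> e' e'0; under eq_near do rewrite RminusZ mulrC HXL; exact: psicvg.
Unshelve. all: by end_near. Qed.

Lemma profile_ccvg s x : 0 <= x -> x <= L ->
  ccvg \oo (fun j => phij j s * V j s x) (X s x) /\
  ccvg \oo (fun j => phij j s * W j s x) (Y s x).
Proof.
move=> x0 xL; split => e e0; have := profile_cvg s e0; apply: filterS => j /(_ x x0 xL);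
  rewrite /energy; apply: le_trans.
  by rewrite lerDl nsq_ge0.
by rewrite lerDr nsq_ge0.
Qed.

(** The limit of [hsol_rotn] for n = 1 and x = 0. *)
Lemma profile_rot s : X s L = lam0 * X (s + d) 0 /\ Y s L = lam0 * Y (s + d) 0.
Proof.
have L0 := period_gt0 hS.
have [cX cY] := profile_ccvg s (ltW L0) (lexx _).
have [cX' cY'] := profile_ccvg (s + d) (lexx 0) (ltW L0).
have H j : phij j s * V j s L = lamj j * (phij j (s + d) * V j (s + d) 0) /\
           phij j s * W j s L = lamj j * (phij j (s + d) * W j (s + d) 0).
  by have := hsol_rotn j s 1 (lexx 0); rewrite mul1r addr0 expr1 mul1r.
split.
  apply: (ccvg_unique cX).
  by rewrite (funext (fun j => (H j).1)); exact: ccvgM.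
apply: (ccvg_unique cY).
by rewrite (funext (fun j => (H j).2)); exact: ccvgM.
Qed.

Definition profile_flux s := flux (X s) (Y s) 0.

Lemma flux_cvg (T : Type) (F : set_system T) (FF : ProperFilter F) (f g : T -> R[i]) (l m : R[i]) :
  ccvg F f l -> ccvg F g m ->
  (fun t : T => Im (g t) * Re (f t) - Re (g t) * Im (f t)) @ F --> (Im m * Re l - Re m * Im l).
Proof. by move=> /ccvgP[f1 f2] /ccvgP[g1 g2]; apply: cvgB; exact: cvgM. Qed.

Lemma profile_flux_ge0 s : 0 <= profile_flux s.
Proof.
have L0 := period_gt0 hS.
have [cX cY] := profile_ccvg s (lexx 0) (ltW L0).
apply: (cvgr_to_ge (flux_cvg _ cX cY)); near=> j.
have := fluxZ (phij j s) (V j s) (W j s) 0; rewrite /flux => ->.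
rewrite mulr_ge0 ?nsq_ge0//; have [h1 h2] := HV j s.
by apply: (flux_ge0 h1 h2 (cb_rho0 cb s)) => //=; exact: ltW.
Unshelve. all: by end_near. Qed.

(** Without absorption the flux is constant along the cell, and [profile_rot]
    compares its ends. *)
Lemma profile_flux_rot s : profile_flux s = nsq lam0 * profile_flux (s + d).
Proof.
have L0 := period_gt0 hS; have [cX cY _ _] := HX s.
have [hX hY] := profile_rot s.
transitivity (flux (X s) (Y s) L); last by rewrite /flux hX hY /profile_flux /flux /nsq !reim; ring.
have cf := continuous_flux cX cY.
have df x : 0 < x -> x < L -> is_derive x 1 (flux (X s) (Y s)) 0.
  move=> x0 xL; have := @flux_derive _ _ _ _ _ _ _ x (HX s); rewrite ImC mulr0 mul0r oppr0; apply.
  by rewrite /= in_itv/= x0.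
have [||x _] := @MVT_segment _ (flux (X s) (Y s)) (fun=> 0) 0 L (ltW L0).
- by move=> x; rewrite in_itv/= => /andP[x0 xL]; exact: df.
- exact: continuous_subspaceT.
by rewrite mul0r => /eqP; rewrite subr_eq0 => /eqP ->.
Qed.

(** The data phi0 s and psi0 (s + d) and the coefficients depend continuously
    on s. *)
Lemma profile_flux_cont : continuous profile_flux.
Proof.
move=> s0; have L0 := period_gt0 hS.
have H e : 0 < e -> \forall s \near s0, forall x, 0 <= x -> x <= L ->
    energy (fun x => X s x - X s0 x) (fun x => Y s x - Y s0 x) x <= e.
  move=> e0; apply: (@cell_cvg _ S hS _ _ _ cb R (nbhs s0) _ id (fun=> (omega S ^+ 2)%:C) X Y s0 (X s0) (Y s0)) => //.
  - by near=> t; split => //; exact: HX.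
  - by move=> e' e'0; near=> t; rewrite subrr /nsq !reim expr0n /= addr0 ltW.
  - move=> e' e'0; under eq_near do rewrite !HX0.
    have : ccvg (nbhs s0) phi0 (phi0 s0) by apply/ccvgP; case: phi0c => h1 h2; split; [exact: h1|exact: h2].
    exact.
  - move=> e' e'0; under eq_near do rewrite !HXL.
    have cd : continuous (fun s : R => s + d) by cont.
    have : ccvg (nbhs s0) (fun s => psi0 (s + d)) (psi0 (s0 + d)).
      by apply/ccvgP; case: (ccont_comp cd psi0c) => h1 h2; split; [exact: h1|exact: h2].
    exact.
have c1 : ccvg (nbhs s0) (fun s => X s 0) (X s0 0).
  move=> e e0; have := H e e0; apply: filterS => s /(_ 0 (lexx 0) (ltW L0)).
  by rewrite /energy; apply: le_trans; rewrite lerDl nsq_ge0.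
have c2 : ccvg (nbhs s0) (fun s => Y s 0) (Y s0 0).
  move=> e e0; have := H e e0; apply: filterS => s /(_ 0 (lexx 0) (ltW L0)).
  by rewrite /energy; apply: le_trans; rewrite lerDr nsq_ge0.
exact: (flux_cvg _ c1 c2).
Unshelve. all: by end_near. Qed.

Lemma profile_flux_per s : profile_flux (s + 1) = profile_flux s.
Proof.
have L0 := period_gt0 hS; have [m1 r1] := standing_per hS s.
have sol : cellsol S s (X (s + 1)) (Y (s + 1)) by have := HX (s + 1); rewrite /cellsol m1 r1.
have [|| h1 h2] := cell_unique hS cb sol (HX s) _ _ (lexx 0) (ltW L0).
- by rewrite !HX0 phi0p.
- by rewrite !HXL addrAC psi0p.
by rewrite /profile_flux /flux h1 h2.
Qed.

(** The factor in [rotation_pos] is |lam0|^2, which is at most 1 as a limit of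
    such numbers. *)
Lemma profile_flux_gt0 : (exists s, profile_flux s != 0) -> forall s, 0 < profile_flux s.
Proof.
apply: (rotation_pos (delta_irrational hS) profile_flux_cont profile_flux_per profile_flux_ge0
  (nsq_ge0 lam0) _ profile_flux_rot).
by apply: (cvgr_to_le (cvg_nsq lamcvg)); near=> j; exact: lamj1.
Unshelve. all: by end_near. Qed.

(** If phi0 s = 0, the Robin condition at 0 makes the flux there equal to - z
    |X s 0|^2. *)
Lemma phi0_neq0 : (exists s, profile_flux s != 0) -> forall s, phi0 s != 0.
Proof.
move=> ex s; apply/eqP => p0; have := profile_flux_gt0 ex s.
have : Y s 0 = - ('i%C * (zimp S)%:C * X s 0).
  by apply/eqP; rewrite -subr_eq0 -oppr_eq0 -p0 -HX0 /Rplus; apply/eqP; ring.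
rewrite /profile_flux /flux => ->; rewrite !reim ltNge => /negP; apply.
have := mulr_ge0 (ltW (zimp_gt0 hS)) (nsq_ge0 (X s 0)); rewrite /nsq; lra.
Qed.

Context (phi0n : forall s, phi0 s != 0) (phijn : forall j s, phij j s != 0).

Lemma standing_shiftn n s :
  (fun x => mu_ S s (n%:R * L + x)) = mu_ S (s + n%:R * d) /\
  (fun x => rho_ S s (n%:R * L + x)) = rho_ S (s + n%:R * d).
Proof.
elim: n s => [|n IH] s; first by rewrite !mul0r addr0; split; apply/funext => x; rewrite add0r.
have [e1 e2] := IH (s + d); have [<- <-] : mu_ S (s + d + n%:R * d) = mu_ S (s + n.+1%:R * d) /\
   rho_ S (s + d + n%:R * d) = rho_ S (s + n.+1%:R * d).
  by rewrite -natr1 mulrDl mul1r -addrA [d + _]addrC.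
have [m r] := standing_shift hS s.
split; rewrite -?e1 -?e2 -?m -?r; apply/funext => x; congr (_ _ _ _); rewrite -natr1; ring.
Qed.

Definition limit_v s := glued L (fun n x => lam0 ^+ n * (phi0 s)^-1 * X (s + n%:R * d) x).
Definition limit_w s := glued L (fun n x => lam0 ^+ n * (phi0 s)^-1 * Y (s + n%:R * d) x).

(** By [profile_rot], the jump of the profile at the end of a cell is
    compensated by one more power of lam0. *)
Lemma limit_match s n :
  lam0 ^+ n * (phi0 s)^-1 * X (s + n%:R * d) L = lam0 ^+ n.+1 * (phi0 s)^-1 * X (s + n.+1%:R * d) 0 /\
  lam0 ^+ n * (phi0 s)^-1 * Y (s + n%:R * d) L = lam0 ^+ n.+1 * (phi0 s)^-1 * Y (s + n.+1%:R * d) 0.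
Proof.
have [-> ->] := profile_rot (s + n%:R * d).
have -> : s + n%:R * d + d = s + n.+1%:R * d by rewrite -natr1; ring.
by rewrite exprS; split; ring.
Qed.

Lemma limit_csol s : csol `]0, +oo[ (mu_ S s) (rho_ S s) ((omega S ^+ 2)%:C) (limit_v s) (limit_w s).
Proof.
have [cm cr] := standing_cont hS.
apply: csol_glued => //.
- exact: period_gt0.
- by move=> x; rewrite gt_eqF// (cb_mu0 cb).
- by move=> n; have [-> ->] := standing_shiftn n s; exact: csolZ (HX _).
- by move=> n; case: (limit_match s n).
- by move=> n; case: (limit_match s n).
Qed.

Lemma limit_cell s n x : 0 <= x -> x <= L ->
  limit_v s (n%:R * L + x) = lam0 ^+ n * (phi0 s)^-1 * X (s + n%:R * d) x /\
  limit_w s (n%:R * L + x) = lam0 ^+ n * (phi0 s)^-1 * Y (s + n%:R * d) x.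
Proof.
move=> x0 xL; have L0 := period_gt0 hS.
have n1 : n%:R * L <= n%:R * L + x by rewrite lerDl.
have n2 : n%:R * L + x <= n.+1%:R * L by rewrite -natr1 mulrDl mul1r lerD2l.
split.
  rewrite /limit_v (glued_cell L0 _ n1 n2); first by congr (_ * X _ _); ring.
  by move=> m; case: (limit_match s m).
rewrite /limit_w (glued_cell L0 _ n1 n2); first by congr (_ * Y _ _); ring.
by move=> m; case: (limit_match s m).
Qed.

(** On the n-th cell V j s is b_j times the function of [profile_cvg] at s + n
    d, where b_j = lamj j ^+ n / phij j s converges. *)
Lemma limit_cvg s n e : 0 < e -> \forall j \near \oo, forall x, 0 <= x -> x <= L ->
  nsq (V j s (n%:R * L + x) - limit_v s (n%:R * L + x)) +
  nsq (W j s (n%:R * L + x) - limit_w s (n%:R * L + x)) <= e.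
Proof.
move=> e0; set s' := s + n%:R * d.
pose b j := lamj j ^+ n * (phij j s)^-1; pose b0 := lam0 ^+ n * (phi0 s)^-1.
have cb0 : ccvg \oo b b0 by apply: ccvgM; [exact: ccvgX|exact: ccvgV].
have [M0 [Mr HM]] : [bounded energy (X s') (Y s') x | x in `[0, L]%classic].
  by apply: continuous_bounded_itv; have [cX cY _ _] := HX s'; exact: continuous_energy.
pose M := `|M0| + 1; have M1 : 0 < M by rewrite ltr_wpDl.
have EM x : 0 <= x -> x <= L -> energy (X s') (Y s') x <= M.
  move=> x0 xL; apply: le_trans (ler_norm _) _; apply: HM; last by rewrite /= in_itv/= x0.
  by rewrite /M; apply: le_lt_trans (ler_norm M0) _; rewrite ltrDl.
have B0 : 0 < nsq b0 + 1 by rewrite ltr_wpDl ?nsq_ge0.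
have e1 : 0 < e / (4 * (nsq b0 + 1)) by rewrite divr_gt0// mulr_gt0.
have e2 : 0 < e / (4 * M) by rewrite divr_gt0// mulr_gt0.
have nb : \forall j \near \oo, nsq (b j) <= nsq b0 + 1.
  by apply: (cvgr_le _ (cvg_nsq cb0)); rewrite ltrDl.
near=> j => x x0 xL.
have H1 : energy (fun x => phij j s' * V j s' x - X s' x) (fun x => phij j s' * W j s' x - Y s' x) x <= e / (4 * (nsq b0 + 1)).
  by move: x x0 xL; near: j; exact: profile_cvg e1.
have H2 : nsq (b j - b0) <= e / (4 * M) by near: j; exact: cb0 e2.
have H3 : nsq (b j) <= nsq b0 + 1 by near: j.
have [h1 h2] := hsol_rotn j s n x0.
have EV : V j s (n%:R * L + x) = b j * (phij j s' * V j s' x).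
  by apply: (mulfI (phijn j s)); rewrite h1 /b -/s'; field; exact: phijn.
have EW : W j s (n%:R * L + x) = b j * (phij j s' * W j s' x).
  by apply: (mulfI (phijn j s)); rewrite h2 /b -/s'; field; exact: phijn.
have [-> ->] := limit_cell s n x0 xL; rewrite EV EW -/s' -/b0.
set p := phij j s' * V j s' x in H1 *; set q := phij j s' * W j s' x in H1 *.
have -> : b j * p - b0 * X s' x = b j * (p - X s' x) + (b j - b0) * X s' x by ring.
have -> : b j * q - b0 * Y s' x = b j * (q - Y s' x) + (b j - b0) * Y s' x by ring.
have D1 := nsqD (b j * (p - X s' x)) ((b j - b0) * X s' x).
have D2 := nsqD (b j * (q - Y s' x)) ((b j - b0) * Y s' x).
rewrite !(nsqM (b j)) !(nsqM (b j - b0)) in D1 D2; have E1 := EM x x0 xL; rewrite /energy in H1 E1.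
have P1 : nsq (b j) * (nsq (p - X s' x) + nsq (q - Y s' x)) <= (nsq b0 + 1) * (e / (4 * (nsq b0 + 1))).
  by apply: ler_pM => //; rewrite ?nsq_ge0// addr_ge0 ?nsq_ge0.
have P2 : nsq (b j - b0) * (nsq (X s' x) + nsq (Y s' x)) <= e / (4 * M) * M.
  by apply: ler_pM => //; rewrite ?nsq_ge0// addr_ge0 ?nsq_ge0.
have Q1 : (nsq b0 + 1) * (e / (4 * (nsq b0 + 1))) = e / 4 by field; rewrite gt_eqF.
have Q2 : e / (4 * M) * M = e / 4 by field; rewrite gt_eqF.
rewrite Q1 in P1; rewrite Q2 in P2.
have fin (A B x1 x2 y1 y2 r t : R) : r <= 2 * (A * x1) + 2 * (B * x2) ->
    t <= 2 * (A * y1) + 2 * (B * y2) -> A * (x1 + y1) <= e / 4 -> B * (x2 + y2) <= e / 4 ->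
    r + t <= e by move=> *; lra.
exact: fin D1 D2 P1 P2.
Unshelve. all: by end_near. Qed.

End LimitProfile.

(** * Convergence on the half-line *)

Section HalfLineConvergence.
Context {R : realType} (S : medium R) (hS : standing_assumptions S).
Context (c rM mM : R) (cb : coef_bounds S c rM mM).
Implicit Types (s x y e : R) (u v w : R -> R[i]).

Local Notation L := (period S).
Local Notation z := (zimp S).
Local Notation d := (delta S).

(** The two factors of the flux density are the difference and the sum of the
    Robin traces at 0 of the combination of the cell functions, that is, - 2 w
    and - 2 i z v. *)
Lemma fluxQ_flux (E0 E1 : R -> R -> R[i]) (phi psi : R -> R[i]) s v0 w0 v1 w1 :
  Rplus S v0 w0 0 = 1 -> tcoef S Right E0 s = Rminus S v0 w0 0 ->
  Rplus S v1 w1 0 = 0 -> tcoef S Right E1 s = Rminus S v1 w1 0 ->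
  fluxQ S Right E0 E1 phi psi s =
  4 * z * flux (fun x => phi s * v0 x + psi (s + d) * v1 x)
               (fun x => phi s * w0 x + psi (s + d) * w1 x) 0.
Proof.
move=> p0 t0 p1 t1; rewrite /fluxQ t0 t1 /delta_ /orient mul1r.
set p := phi s; set q := psi _.
set X := p * v0 0 + q * v1 0; set Y := p * w0 0 + q * w1 0.
have E1' : (1 - Rminus S v0 w0 0) * p - Rminus S v1 w1 0 * q = - 2%:R * Y.
  transitivity ((Rplus S v0 w0 0 - Rminus S v0 w0 0) * p - (Rminus S v1 w1 0 - Rplus S v1 w1 0) * q).
    by rewrite p0 p1 subr0.
  by rewrite /Rplus /Rminus /Y; ring.
have E2' : (1 + Rminus S v0 w0 0) * p + Rminus S v1 w1 0 * q = - 2%:R * ('i%C * z%:C * X).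
  transitivity ((Rplus S v0 w0 0 + Rminus S v0 w0 0) * p + (Rminus S v1 w1 0 + Rplus S v1 w1 0) * q).
    by rewrite p0 p1 addr0.
  by rewrite /Rplus /Rminus /X; ring.
by rewrite E1' E2' /flux -/X -/Y; move: X Y {E1' E2'} => X Y; rewrite !reim; ring.
Qed.

Lemma Lambda_classical (al : R) u v w (kappa : R[i]) :
  csol `]al, +oo[ (mu_ S 0) (rho_ S 0) kappa v w -> cmeasurable `]al, +oo[ u ->
  ae_eq_on `]al, +oo[ v u -> Lambda S al u = Rminus S v w al.
Proof.
move=> [cv cw dv _] mu vu; have [cm _] := standing_cont hS.
have oI : open (`]al, +oo[%classic : set R) by exact: interval_open.
have iI : is_interval (`]al, +oo[%classic : set R) by exact: interval_is_interval.
have cG : ccont (fun x => ((mu_ S 0 x)^-1)%:C * w x).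
  apply: ccontM => //; apply: ccont_real; apply: contV; first exact: cm.
  by move=> x; rewrite gt_eqF// (cb_mu0 cb).
have [_ Gw] := wderiv_classical oI iI mu cv cG vu dv.
apply: (robin_rep (s := 0) oI (closure_halfline (lexx al)) cv cw vu _).2.
apply: ae_mono Gw => x H /H <-; rewrite mulrA -rmorphM/= mulfV ?mul1r//.
by rewrite gt_eqF// (cb_mu0 cb).
Qed.

Lemma cts_ccont (f : R -> R[i]) : cts_on setT f -> ccont f.
Proof.
have H (g : R -> R) : {within setT, continuous g} -> continuous g.
  by rewrite continuous_open_subspace; [move=> cg x; apply: cg; rewrite inE|exact: openT].
by move=> [f1 f2]; split; exact: H.
Qed.

Lemma nsq_le_normc (a : R[i]) e : 0 < e -> normc a <= Num.sqrt e -> nsq a <= e.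
Proof.
by move=> e0 ae; rewrite -normc_sq -[leRHS](@sqr_sqrtr _ e) ?(ltW e0)// ler_sqr ?nnegrE ?normc_nneg ?sqrtr_ge0.
Qed.

Lemma unif_cvg_ccvg (f : nat -> R -> R[i]) g s : unif_cvg f g -> ccvg \oo (f ^~ s) (g s).
Proof.
move=> fg e e0; have := fg (Num.sqrt e); rewrite sqrtr_gt0 => /(_ e0).
by apply: filterS => j /(_ s); exact: nsq_le_normc.
Qed.

Lemma normc_ccvg (f : nat -> R[i]) l : normc (f j - l) @[j --> \oo] --> (0 : R) -> ccvg \oo f l.
Proof.
move=> fl e e0; have /cvgr0_norm_le /(_ (Num.sqrt e)) := fl.
rewrite sqrtr_gt0 => /(_ e0); apply: filterS => j.
by rewrite ger0_norm ?normc_nneg//; exact: nsq_le_normc.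
Qed.

Lemma H1norm_ge0 (I : set R) u : (0 <= H1norm I u)%E.
Proof. by rewrite /H1norm; case: ifP => // _; exact: poweR_ge0. Qed.

(** The difference of the two functions has weak derivative (wj j - w) / mu,
    and 1 / mu <= 1 / c. *)
Lemma H1_cvg_cell (al : R) n (kj : nat -> R[i]) k (uj vj wj : nat -> R -> R[i]) u v w :
  (forall j, csol `]al, +oo[ (mu_ S 0) (rho_ S 0) (kj j) (vj j) (wj j)) ->
  (forall j, cmeasurable `]al, +oo[ (uj j)) -> (forall j, ae_eq_on `]al, +oo[ (vj j) (uj j)) ->
  csol `]al, +oo[ (mu_ S 0) (rho_ S 0) k v w -> cmeasurable `]al, +oo[ u ->
  ae_eq_on `]al, +oo[ v u ->
  (forall e, 0 < e -> \forall j \near \oo, forall x, 0 <= x -> x <= L ->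
     nsq (vj j (al + (n%:R * L + x)) - v (al + (n%:R * L + x))) +
     nsq (wj j (al + (n%:R * L + x)) - w (al + (n%:R * L + x))) <= e) ->
  H1norm `](al + n%:R * L), (al + n.+1%:R * L)[ (fun x => uj j x - u x) @[j --> \oo] --> (0 : \bar R).
Proof.
move=> solj muj vuj sol mu vu near0; have L0 := period_gt0 hS; have c0 := cb_c0 cb.
have [cm _] := standing_cont hS.
set al0 := al + n%:R * L; set al1 := al + n.+1%:R * L.
have al01 : al1 - al0 = L by rewrite /al1 /al0 -natr1; ring.
have al01' : al0 < al1 by rewrite -subr_gt0 al01.
have sub x : `]al0, al1[%classic x -> `]al, +oo[%classic x.
  rewrite /= !in_itv/= andbT => /andP[+ _]; apply: le_lt_trans.
  by rewrite lerDl mulr_ge0// ltW.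
have B0 : 0 < 1 + (c^-1) ^+ 2 by rewrite ltr_wpDr ?sqr_ge0.
have bound e : 0 < e -> \forall j \near \oo, (H1norm `]al0, al1[ (fun x => uj j x - u x)%R <= e%:E)%E.
  move=> e0; pose e' := e ^+ 2 / (L * (1 + (c^-1) ^+ 2)).
  have e'0 : 0 < e' by rewrite divr_gt0 ?mulr_gt0 ?exprn_gt0.
  have := near0 e' e'0; apply: filterS => j H.
  have [cvj cwj dvj _] := solj j; have [cv cw dv _] := sol.
  have -> : e = Num.sqrt ((al1 - al0) * ((1 + (c^-1) ^+ 2) * e')).
    rewrite al01 mulrA /e' mulrCA mulfV ?gt_eqF ?mulr_gt0// mulr1 sqrtr_sqr ger0_norm// ltW//.
  apply: (@H1norm_le _ _ _ _ (fun x => vj j x - v x) (fun x => ((mu_ S 0 x)^-1)%:C * (wj j x - w x))) => //.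
  - have m1 : cmeasurable `]al0, al1[ (uj j).
      by case: (muj j) => h1 h2; split; apply: measurable_funS sub _.
    have m2 : cmeasurable `]al0, al1[ u.
      by case: mu => h1 h2; split; apply: measurable_funS sub _.
    have := cmeasurable_lin 1 (-1) m1 m2; congr cmeasurable; apply/funext => x.
    by rewrite mul1r mulN1r.
  - exact: ccontB.
  - apply: ccontM; last exact: ccontB.
    apply: ccont_real; apply: contV; first exact: cm.
    by move=> x; rewrite gt_eqF// (cb_mu0 cb).
  - by apply: ae_mono (ae_and (vuj j) vu) => x [h1 h2] /sub Ix; rewrite h1// h2.
  - move=> x /sub Ix; rewrite mulrBr; apply: cderiveB; [exact: dvj|exact: dv].
  move=> x /=; rewrite in_itv/= => /andP[x1 x2].
  have := H (x - al0); rewrite subr_ge0 (ltW x1) lerBlDr.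
  have -> : L + al0 = al1 by rewrite -al01 subrK.
  rewrite (ltW x2) => /(_ isT isT).
  have -> : al + (n%:R * L + (x - al0)) = x by rewrite /al0; ring.
  rewrite nsqM.
  set A := nsq (_ - _); set B := nsq (wj j x - _) => AB.
  have m0 := cb_mu0 cb 0 x.
  have mc : nsq ((mu_ S 0 x)^-1)%:C <= (c^-1) ^+ 2.
    by rewrite /nsq !reim expr0n/= addr0 ler_sqr ?nnegrE ?invr_ge0 ?(ltW c0) ?(ltW m0)// lef_pV2 ?posrE// (cb_muc cb).
  have A0 : 0 <= A by exact: nsq_ge0.
  have B1 : 0 <= B by exact: nsq_ge0.
  have : nsq ((mu_ S 0 x)^-1)%:C * B <= c^-1 ^+ 2 * B by apply: ler_wpM2r.
  have : c^-1 ^+ 2 * A + c^-1 ^+ 2 * B <= c^-1 ^+ 2 * e'.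
    by rewrite -mulrDr ler_wpM2l// sqr_ge0.
  have : 0 <= c^-1 ^+ 2 * A by rewrite mulr_ge0// sqr_ge0.
  rewrite [(1 + _) * e']mulrDl mul1r; lra.
apply/fine_cvgP; split.
  have := bound 1 ltr01; apply: filterS => j H.
  rewrite ge0_fin_numE ?H1norm_ge0//; exact: le_lt_trans H (ltry _).
apply/cvgrPdist_le => e e0; have := bound e e0; apply: filterS => j H.
rewrite sub0r normrN ger0_norm ?fine_ge0 ?H1norm_ge0//=.
rewrite -lee_fin fineK// ge0_fin_numE ?H1norm_ge0//; exact: le_lt_trans H (ltry _).
Qed.

End HalfLineConvergence.

Lemma halfline_limitE (R : realType) (S : medium R) (a : R) (lam : R[i]) (phi psi : R -> R[i])
    (E0 E1 : R -> R -> R[i]) (s := a * theta1 S) :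
  halfline_limit S a lam phi psi E0 E1 = fun y =>
    glued (period S) (fun n x => lam ^+ n * (phi s)^-1 *
      (phi (s + n%:R * delta S) * E0 (s + n%:R * delta S) x +
       psi (s + n%:R * delta S + delta S) * E1 (s + n%:R * delta S) x)) (y - a).
Proof.
apply/funext => y; rewrite /halfline_limit /glued /period invrK -/s.
set n := Num.truncn _; have -> // : s + n.+1%:R * delta S = s + n%:R * delta S + delta S.
by rewrite -natr1; ring.
Qed.

Theorem proposition5p21 (R : realType) (S : medium R) (a : R)
  (hS : standing_assumptions S)
  (ha : a * theta2 S \is a Num.int)
  (U : side -> R -> R -> R -> R[i])
  (hU : forall (i : side) (e s : R), 0 < e -> is_fundamental S i e s (U i e s))
  (lam : side -> R -> R[i]) (phi : side -> R -> R -> R[i])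
  (hphi : forall (i : side) (e : R), 0 < e ->
     is_fundamental_eigenpair S i (U i e) (lam i e) (phi i e))
  (E0 E1 : side -> R -> R -> R[i])
  (hE0 : forall (i : side) (s : R), is_cell_fun S i 1 0 s (E0 i s))
  (hE1 : forall (i : side) (s : R), is_cell_fun S i 0 1 s (E1 i s))
  (ueps : R -> R -> R[i])
  (hueps : forall e : R, 0 < e -> is_halfline_sol S a e (ueps e))
  (eps : nat -> R) (lam0 : side -> R[i]) (phi0 psi0 : side -> R -> R[i])
  (hreg : regular_along S U lam phi E0 E1 eps lam0 phi0 psi0) :
  let u := halfline_limit S a (lam0 Right) (phi0 Right) (psi0 Right)
             (E0 Right) (E1 Right) in
  [/\ forall n : nat,
        H1norm `](a + n%:R / theta2 S), (a + n.+1%:R / theta2 S)[%classic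
               (fun x => ueps (eps j) x - u x) @[j --> \oo] --> (0 : \bar R)%E,
      normc (Lambda S a (ueps (eps j)) - Lambda S a u) @[j --> \oo]
        --> (0 : R) &
      0 < complex.Re ((1 - Lambda S a u) * ((1 + Lambda S a u)^*)%C)].
Proof.
move=> u.
have [c [rM [mM cb]]] := standing_bounds hS.
have L0 := period_gt0 hS.
have [eps0 epscvg /(_ Right) [lamc [phic phip] [psic psip] [uphi upsi] [s1 Q1]]] := hreg.
have [VW HVW] := choice (fun js : nat * R => fundamental_rep hS cb (hU Right (eps js.1) js.2 (eps0 js.1))).
have [VW' HVW'] := choice HVW; clear HVW.
pose V j s := VW (j, s); pose W j s := VW' (j, s).
have HV j s : hsol S (eps j) s (V j s) (W j s) by case: (HVW' (j, s)).
have HV0 j s : Rplus S (V j s) (W j s) 0 = 1 by case: (HVW' (j, s)).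
have HVp j s : pcoef S Right (U Right (eps j)) s = Rplus S (V j s) (W j s) (period S).
  by case: (HVW' (j, s)) => _ _ <- _; rewrite /pcoef /cell_end /orient mul1r.
have HVs j s : scoef S Right (U Right (eps j)) s = Rminus S (V j s) (W j s) (period S).
  by case: (HVW' (j, s)) => _ _ _ <-; rewrite /scoef /cell_end /orient mul1r.
have dR : delta_ S Right = delta S by rewrite /delta_ /orient mul1r.
pose lamj j := lam Right (eps j); pose phij j := phi Right (eps j).
have eig j s : Rplus S (V j s) (W j s) (period S) * phij j s = lamj j * phij j (s + delta S).
  have [_ _ _ _ /(congr1 (fun f => f (s + delta S)))] := hphi Right (eps j) (eps0 j).
  by rewrite /opP dR addrK HVp.
have lamj1 j : nsq (lamj j) <= 1.
  have [l1 _ _ _ _] := hphi Right (eps j) (eps0 j).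
  rewrite -normc_sq expr_le1 ?normc_nneg//; exact: ltW.
have phijn j s : phij j s != 0 by have [_ [_ _ ->] _ _ _] := hphi Right (eps j) (eps0 j).
have lamcvg : ccvg \oo lamj (lam0 Right) by exact: normc_ccvg.
have phicvg s : ccvg \oo (phij ^~ s) (phi0 Right s) by exact: unif_cvg_ccvg.
have psicvg s : ccvg \oo (fun j => Rminus S (V j s) (W j s) (period S) * phij j s)
    (psi0 Right (s + delta S)).
  have := unif_cvg_ccvg (s + delta S) upsi.
  by congr (ccvg _ _ _); apply/funext => j; rewrite /opS dR addrK HVs.
have [e0v /choice [e0w He0]] := choice (fun s => cell_rep hS cb (hE0 Right s)).
have [e1v /choice [e1w He1]] := choice (fun s => cell_rep hS cb (hE1 Right s)).
pose X s x := phi0 Right s * e0v s x + psi0 Right (s + delta S) * e1v s x.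
pose Y s x := phi0 Right s * e0w s x + psi0 Right (s + delta S) * e1w s x.
have HX s : cellsol S s (X s) (Y s).
  have [h0 _ _ _ _] := He0 s; have [h1 _ _ _ _] := He1 s.
  exact: csolD (csolZ _ h0) (csolZ _ h1).
have HX0 s : Rplus S (X s) (Y s) 0 = phi0 Right s.
  have [_ h0 _ _ _] := He0 s; have [_ h1 _ _ _] := He1 s.
  transitivity (phi0 Right s * Rplus S (e0v s) (e0w s) 0 + psi0 Right (s + delta S) * Rplus S (e1v s) (e1w s) 0).
    by rewrite /Rplus /X /Y; ring.
  by rewrite h0 h1 mulr1 mulr0 addr0.
have HXL s : Rminus S (X s) (Y s) (period S) = psi0 Right (s + delta S).
  have [_ _ h0 _ _] := He0 s; have [_ _ h1 _ _] := He1 s.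
  transitivity (phi0 Right s * Rminus S (e0v s) (e0w s) (period S) + psi0 Right (s + delta S) * Rminus S (e1v s) (e1w s) (period S)).
    by rewrite /Rminus /X /Y; ring.
  by rewrite h0 h1 mulr1 mulr0 add0r.
have cphi0 := cts_ccont phic; have cpsi0 := cts_ccont psic.
have fluxE s : fluxQ S Right (E0 Right) (E1 Right) (phi0 Right) (psi0 Right) s = 4 * zimp S * profile_flux X Y s.
  have [_ h0 _ _ t0] := He0 s; have [_ h1 _ _ t1] := He1 s.
  exact: fluxQ_flux h0 t0 h1 t1.
have exF : exists s, profile_flux X Y s != 0.
  by exists s1; move: Q1; rewrite fluxE; apply: contra_neq => ->; rewrite mulr0.
have fpos := profile_flux_gt0 hS cb eps0 epscvg HV HV0 eig lamj1 lamcvg phicvg psicvg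
  cphi0 cpsi0 phip psip HX HX0 HXL exF.
have phi0n := phi0_neq0 hS cb eps0 epscvg HV HV0 eig lamj1 lamcvg phicvg psicvg
  cphi0 cpsi0 phip psip HX HX0 HXL exF.
(* a * theta2 being an integer, the medium seen from a is that of parameter s *)
pose s := a * theta1 S.
have limsol := limit_csol hS cb eps0 epscvg HV HV0 eig lamcvg phicvg psicvg HX HX0 HXL s.
have limcvg := limit_cvg hS cb eps0 epscvg HV HV0 eig lamcvg phicvg psicvg HX HX0 HXL phi0n phijn s.
have limcell := limit_cell hS cb eps0 epscvg HV HV0 eig lamcvg phicvg psicvg HX HX0 HXL s.
have limcell0 := limit_cell hS cb eps0 epscvg HV HV0 eig lamcvg phicvg psicvg HX HX0 HXL s 0 (lexx 0) (ltW L0).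
clear limcell.
set v := limit_v _ _ _ _ _ in limsol limcvg limcell0.
set w := limit_w _ _ _ _ _ in limsol limcvg limcell0.
have mI : measurable (`]0, +oo[%classic : set R) by [].
have shiftI x : `]a, +oo[%classic x -> `]0, +oo[%classic (x - a).
  by rewrite /= !in_itv/= !andbT subr_gt0.
have solA : csol `]a, +oo[ (mu_ S 0) (rho_ S 0) ((omega S ^+ 2)%:C) (fun x => v (x - a)) (fun x => w (x - a)).
  have [m1 r1] := standing_int hS ha.
  have shI x : `]a, +oo[%classic x -> `]0, +oo[%classic (- a + x) by rewrite addrC; exact: shiftI.
  have := csol_shift limsol shI; rewrite -m1 -r1.
  by congr csol; apply/funext => x; rewrite ?addNKr// addrC.
pose f n x := lam0 Right ^+ n * (phi0 Right s)^-1 *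
  (phi0 Right (s + n%:R * delta S) * E0 Right (s + n%:R * delta S) x +
   psi0 Right (s + n%:R * delta S + delta S) * E1 Right (s + n%:R * delta S) x).
(* u is glued from combinations of the given cell functions, which determine it
   only up to null sets: its measurability is checked on them, and its values
   are compared with those of v cell by cell *)
have uE : u = fun y => glued (period S) f (y - a) by rewrite /u halfline_limitE.
have mu : cmeasurable `]a, +oo[ u.
  rewrite uE; apply: (@cmeasurable_shift _ _ _ a (glued (period S) f) mI shiftI).
  apply: cmeasurable_glued => // n; set s' := s + n%:R * delta S.
  have [[[[m0 _] _ _] _] _ _] := hE0 Right s'; have [[[[m1 _] _ _] _] _ _] := hE1 Right s'.
  have -> : f n = fun x => lam0 Right ^+ n * (phi0 Right s)^-1 * phi0 Right s' * E0 Right s' x +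
      lam0 Right ^+ n * (phi0 Right s)^-1 * psi0 Right (s' + delta S) * E1 Right s' x.
    by apply/funext => x; rewrite /f -/s'; ring.
  exact: cmeasurable_lin m0 m1.
have vu : ae_eq_on `]a, +oo[ (fun x => v (x - a)) u.
  have aeX n : ae_eq_on `]0, period S[ (fun x => lam0 Right ^+ n * (phi0 Right s)^-1 * X (s + n%:R * delta S) x) (f n).
    have [_ _ _ h0 _] := He0 (s + n%:R * delta S); have [_ _ _ h1 _] := He1 (s + n%:R * delta S).
    by apply: ae_mono (ae_and h0 h1) => x [g0 g1] Ix; rewrite /f -g0// -g1.
  rewrite uE; have := ae_shift (- a) (ae_glued L0 aeX).
  by apply: ae_mono => x H /shiftI; exact: H.
have [ve /choice [we Hve]] := choice (fun j => halfline_sol_rep hS cb ha (hueps (eps j) (eps0 j))).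
have veV j x : 0 <= x -> ve j (a + x) = V j s x /\ we j (a + x) = W j s x.
  move=> x0; have [h _ h0 _ _] := Hve j.
  have [|-> ->] := hsol_unique hS cb (a := 1) (eps0 j) h (HV j s) _ x0; last by rewrite !mul1r.
  by rewrite h0 HV0 mulr1.
have LamE : Lambda S a u = Rminus S v w 0.
  have := Lambda_classical hS cb solA mu vu => ->.
  by rewrite /Rminus subrr.
have LamX : Lambda S a u = (phi0 Right s)^-1 * Rminus S (X s) (Y s) 0.
  rewrite LamE /Rminus; have := limcell0; rewrite !mul0r !addr0 expr0 mul1r => -[-> ->].
  by ring.
have near0 n e : 0 < e -> \forall j \near \oo, forall x, 0 <= x -> x <= period S ->
   nsq (ve j (a + (n%:R * period S + x)) - v (a + (n%:R * period S + x) - a)) +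
   nsq (we j (a + (n%:R * period S + x)) - w (a + (n%:R * period S + x) - a)) <= e.
  move=> e0; have := limcvg n e e0; apply: filterS => j H x x0 xL.
  have nx : 0 <= n%:R * period S + x by rewrite addr_ge0// mulr_ge0// ltW.
  by have [-> ->] := veV j _ nx; rewrite (addrC a) addrK; exact: H.
split.
- move=> n.
  apply: (H1_cvg_cell hS cb _ _ _ solA mu vu (near0 n)).
  + by move=> j; case: (Hve j) => _ + _ _ _; exact.
  + by move=> j; have [[[[m0 _] _ _] _] _] := hueps (eps j) (eps0 j).
  + by move=> j; case: (Hve j).
- apply: ccvg_normc.
  have -> : (fun j => Lambda S a (ueps (eps j))) = fun j => Rminus S (V j s) (W j s) 0.
    apply/funext => j; have [_ _ _ _ ->] := Hve j; rewrite /Rminus.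
    by have [] := veV j 0 (lexx 0); rewrite addr0 => -> ->.
  rewrite LamE /Rminus; have cw : ccvg \oo (fun j => W j s 0) (w 0).
    move=> e e0; have := limcvg 0%N e e0; apply: filterS => j /(_ 0 (lexx 0) (ltW L0)).
    by rewrite mul0r addr0; apply: le_trans; rewrite lerDr nsq_ge0.
  have cv : ccvg \oo (fun j => V j s 0) (v 0).
    move=> e e0; have := limcvg 0%N e e0; apply: filterS => j /(_ 0 (lexx 0) (ltW L0)).
    by rewrite mul0r addr0; apply: le_trans; rewrite lerDl nsq_ge0.
  exact: (ccvgB cw (ccvgM (ccvg_cst _) cv)).
have z0 := zimp_gt0 hS.
have -> : Re ((1 - Lambda S a u) * ((1 + Lambda S a u)^*)%C) =
    nsq (phi0 Right s)^-1 * (4 * zimp S * profile_flux X Y s).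
  set p := phi0 Right s; have p0 : p != 0 by exact: phi0n.
  have E1' : 1 - Lambda S a u = p^-1 * (- 2%:R * Y s 0).
    rewrite LamX -/p; apply: (mulfI p0); rewrite mulrBr mulr1 !mulVKf//.
    by rewrite /p -HX0 /Rplus /Rminus; ring.
  have E2' : 1 + Lambda S a u = p^-1 * (- 2%:R * ('i%C * (zimp S)%:C * X s 0)).
    rewrite LamX -/p; apply: (mulfI p0); rewrite mulrDr mulr1 !mulVKf//.
    by rewrite /p -HX0 /Rplus /Rminus; ring.
  rewrite E1' E2' /profile_flux /flux /nsq; move: (X s 0) (Y s 0) p^-1 => X0 Y0 q.
  by rewrite !reim; ring.
apply: mulr_gt0; last by rewrite !mulr_gt0.
rewrite lt_neqAle nsq_ge0 andbT eq_sym; apply/eqP => /nsq_eq0 /eqP.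
by rewrite invr_eq0; apply/negP; exact: phi0n.
Qed.
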